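(* Let $R$ be an $\omega$-stable ring of characteristic zero. Then $R$ can be decomposed into a finite direct product $$R\cong R_1\times\cdots\times R_n\times R_0,$$ where each $R_i$, $i=1,\ldots,n$, is an indecomposable $k_i$-algebra, $k_i$ is an algebraically closed field of characteristic zero, and $R_0$ is a $\mathbb{Q}$-algebra with zero multiplication.
   Context: A ring means an abelian group $(R,+)$ with a binary operation $\cdot$ that distributes over $+$ on both sides; it is not assumed associative, commutative or unitary. Algebras over a field are likewise not assumed associative, commutative or unitary. A ring $R$ has characteristic zero if its additive group $R^+$ is torsion-free. $R$ is $\omega$-stable if its complete first-order theory in the language of rings is $\omega$-stable. A $k$-algebra is (directly) indecomposable if it is not a direct product of two nonzero $k$-algebras. *)

(* Defs.v *)
From HB Require Import structures.
From mathcomp Require Import all_boot all_order all_algebra.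
From mathcomp Require Import boolp classical_sets functions cardinality.

Set Implicit Arguments.
Unset Strict Implicit.
Unset Printing Implicit Defensive.

Import GRing.Theory.
Local Open Scope ring_scope.
Local Open Scope classical_set_scope.

(* MathComp's own rings are associative and unitary, and so are its algebras,
   so neither hierarchy can be used here. *)

HB.mixin Record Zmodule_isNonAssocRing R of GRing.Zmodule R := {
  namul : R -> R -> R;
  namulDl : left_distributive namul +%R;
  namulDr : right_distributive namul +%R
}.

#[short(type="naRingType")]
HB.structure Definition NonAssocRing :=
  { R of Zmodule_isNonAssocRing R & GRing.Zmodule R }.

Notation "x ** y" := (namul x y)
  (at level 40, left associativity) : ring_scope.

HB.mixin Record Lmodule_isNonAssocAlgebra (k : fieldType) A
    of GRing.Lmodule k A & NonAssocRing A := {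
  scale_namull : forall (a : k) (x y : A), a *: (x ** y) = (a *: x) ** y;
  scale_namulr : forall (a : k) (x y : A), a *: (x ** y) = x ** (a *: y)
}.

#[short(type="naAlgType")]
HB.structure Definition NonAssocAlgebra (k : fieldType) :=
  { A of Lmodule_isNonAssocAlgebra k A & GRing.Lmodule k A & NonAssocRing A }.

Section BinaryProduct.

Variables R S : naRingType.

Definition pair_namul (x y : R * S) : R * S := (x.1 ** y.1, x.2 ** y.2).

Lemma pair_namulDl : left_distributive pair_namul +%R.
Proof. by move=> x y z; congr pair; exact: namulDl. Qed.

Lemma pair_namulDr : right_distributive pair_namul +%R.
Proof. by move=> x y z; congr pair; exact: namulDr. Qed.

HB.instance Definition _ :=
  Zmodule_isNonAssocRing.Build (R * S)%type pair_namulDl pair_namulDr.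

End BinaryProduct.

Section BinaryProductAlgebra.

Variables (k : fieldType) (A B : naAlgType k).

Lemma pair_scale_namull (a : k) (x y : A * B) :
  a *: (x ** y) = (a *: x) ** y.
Proof. by congr pair; exact: scale_namull. Qed.

Lemma pair_scale_namulr (a : k) (x y : A * B) :
  a *: (x ** y) = x ** (a *: y).
Proof. by congr pair; exact: scale_namulr. Qed.

HB.instance Definition _ := Lmodule_isNonAssocAlgebra.Build k (A * B)%type
  pair_scale_namull pair_scale_namulr.

End BinaryProductAlgebra.

Section FiniteProduct.

Variables (I : finType) (R : I -> naRingType).
Notation prodR := {dffun forall i, R i}.

Definition dffun_zero : prodR := [ffun i => 0].
Definition dffun_opp (x : prodR) : prodR := [ffun i => - x i].
Definition dffun_add (x y : prodR) : prodR := [ffun i => x i + y i].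
Definition dffun_namul (x y : prodR) : prodR := [ffun i => x i ** y i].

Lemma dffun_addA : associative dffun_add.
Proof. by move=> x y z; apply/ffunP=> i; rewrite !ffunE addrA. Qed.

Lemma dffun_addC : commutative dffun_add.
Proof. by move=> x y; apply/ffunP=> i; rewrite !ffunE addrC. Qed.

Lemma dffun_add0 : left_id dffun_zero dffun_add.
Proof. by move=> x; apply/ffunP=> i; rewrite !ffunE add0r. Qed.

Lemma dffun_addN : left_inverse dffun_zero dffun_opp dffun_add.
Proof. by move=> x; apply/ffunP=> i; rewrite !ffunE addNr. Qed.

HB.instance Definition _ := Algebra.isZmodule.Build prodR
  dffun_addA dffun_addC dffun_add0 dffun_addN.

Lemma dffun_namulDl : left_distributive dffun_namul +%R.
Proof. by move=> x y z; apply/ffunP=> i; rewrite !ffunE namulDl. Qed.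

Lemma dffun_namulDr : right_distributive dffun_namul +%R.
Proof. by move=> x y z; apply/ffunP=> i; rewrite !ffunE namulDr. Qed.

HB.instance Definition _ :=
  Zmodule_isNonAssocRing.Build prodR dffun_namulDl dffun_namulDr.

End FiniteProduct.

Definition ring_isomorphic (R S : naRingType) : Prop :=
  exists f : R -> S,
    [/\ bijective f, {morph f : x y / x + y} & {morph f : x y / x ** y}].

Definition alg_isomorphic (k : fieldType) (A B : naAlgType k) : Prop :=
  exists f : A -> B,
    [/\ bijective f, {morph f : x y / x + y}, {morph f : x y / x ** y}
      & forall (a : k) (x : A), f (a *: x) = a *: f x].

Definition indecomposable (k : fieldType) (A : naAlgType k) : Prop :=
  ~ exists B C : naAlgType k,
      [/\ exists b : B, b != 0, exists c : C, c != 0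
        & alg_isomorphic A (B * C)%type].

Definition char_zero (R : naRingType) : Prop :=
  forall (x : R) (m : nat), (0 < m)%N -> x *+ m = 0 -> x = 0.

(* First-order logic in the language of rings, without a symbol for 1; [C] indexes
   additional constant symbols. *)

Inductive term (C : Type) (n : nat) : Type :=
| Var of 'I_n
| Cst of C
| TZero
| TOpp of term C n
| TAdd of term C n & term C n
| TMul of term C n & term C n.

(* [formula C n] : formulas with free variables among x_0, ..., x_(n-1). In
   [FEx f] the quantifier binds x_0 of f, and x_(i+1) of f is x_i outside. *)
Inductive formula (C : Type) : nat -> Type :=
| FEq n of term C n & term C n : formula C n
| FNot n of formula C n : formula C n
| FAnd n of formula C n & formula C n : formula C n
| FEx n of formula C n.+1 : formula C n.

(* A structure for the language of rings; no axiom is imposed. *)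
Record structure : Type := Structure {
  carrier :> Type;
  szero : carrier;
  sopp : carrier -> carrier;
  sadd : carrier -> carrier -> carrier;
  smul : carrier -> carrier -> carrier
}.

Section Semantics.

Variables (M : structure) (C : Type) (c : C -> M).

Definition extend n (a : M) (v : 'I_n -> M) (i : 'I_n.+1) : M :=
  if unlift ord0 i is Some j then v j else a.

Fixpoint eval n (v : 'I_n -> M) (t : term C n) : M :=
  match t with
  | Var i => v i
  | Cst a => c a
  | TZero => szero M
  | TOpp t1 => sopp (eval v t1)
  | TAdd t1 t2 => sadd (eval v t1) (eval v t2)
  | TMul t1 t2 => smul (eval v t1) (eval v t2)
  end.

Fixpoint sat n (f : formula C n) : ('I_n -> M) -> Prop :=
  match f with
  | FEq _ t u => fun v => eval v t = eval v u
  | FNot _ g => fun v => ~ sat g v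
  | FAnd _ g h => fun v => sat g v /\ sat h v
  | FEx _ g => fun v => exists a : M, sat g (extend a v)
  end.

Definition finitely_satisfiable n (p : set (formula C n)) : Prop :=
  forall q : set (formula C n), q `<=` p -> finite_set q ->
    exists v : 'I_n -> M, forall f, q f -> sat f v.

Definition maximal_finitely_satisfiable n (p : set (formula C n)) : Prop :=
  finitely_satisfiable p /\
  forall q : set (formula C n), p `<=` q -> finitely_satisfiable q -> q = p.

End Semantics.

Definition sentence := formula void 0.

Definition models (M : structure) (T : set sentence) : Prop :=
  forall f, T f -> forall v : 'I_0 -> M, sat (of_void M) f v.

Definition theory (M : structure) : set sentence :=
  [set f | forall v : 'I_0 -> M, sat (of_void M) f v].

(* S_n^M(A), the complete n-types over the parameter set A: by compactness
   these are the maximal sets of formulas over A, in n free variables, that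
   are finitely satisfiable in M. *)
Definition complete_types (M : structure) (A : set M) (n : nat) :
    set (set (formula A n)) :=
  [set p | maximal_finitely_satisfiable (@set_val M A) p].

Definition omega_stable_theory (T : set sentence) : Prop :=
  forall M : structure, models M T ->
  forall A : set M, countable A ->
  forall n : nat, countable (@complete_types M A n).

Definition ring_structure (R : naRingType) : structure :=
  Structure (0 : R) -%R +%R namul.

Definition omega_stable (R : naRingType) : Prop :=
  omega_stable_theory (theory (ring_structure R)).

(* Main.v *)
(** Only the ring [R] itself is used, not the other models of its theory: by
    [omega]-stability no binary tree of nonempty definable sets (with parameters)
    exists in [R], because the branches would give continuum many types over a
    countable set.  Hence definable subgroups satisfy the descending chain
    condition; in particular a torsion-free [R] is divisible.

    Let [ann R] be the two-sided annihilator.  Following Myasnikov, consider the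
    commutative ring [P] of the endomorphisms [al] of [R / ann R] that are scalars
    of the multiplication: [al x * y = x * al y] extends to a well-defined map of
    [R * R].  A scalar is determined by its values on a finite system with
    annihilator [ann R], so that [P] is interpretable in [R].  The identity of [P]
    is a finite sum of orthogonal primitive idempotents [e_i], and each [P e_i] is
    a local ring with nil radical whose maximal subfields [k_i] represent the
    residue field (Newton iteration), hence are interpretable as well.

    An interpretable field [L] of characteristic zero is closed under [q]-th roots:
    the groups of [q^n]-th powers stabilise at a subgroup [H] of finite index of
    the multiplicative group.  In a maximal affine-invariant proper ideal of
    definable sets, the translations act trivially on the finitely many atoms of
    the quotient (they form a divisible group), so that [H] contains translates of
    all finite sets; if [H] were proper, "infinitesimal" expansions with digits in
    two cosets of [H] would form a forbidden tree.  Finite extensions of [L] are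
    interpretable, and Kummer theory makes [L] algebraically closed.

    Finally [k_i] acts on [e_i (R / ann R)] and on [R * R]; choosing complements of
    [R * R] stable under these actions, and one of [ann R] intersected with [R * R]
    inside [ann R], decomposes [R] into [k_i]-algebras and a null algebra. *)

Require Import Defs.
From HB Require Import structures.
From mathcomp Require Import all_boot all_order all_fingroup all_algebra all_solvable all_field.
From mathcomp Require Import boolp classical_sets functions cardinality.
From mathcomp Require Import ring zify.

Set Implicit Arguments.
Unset Strict Implicit.
Unset Printing Implicit Defensive.

Import GRing.Theory.
Local Open Scope ring_scope.

(** * Definable sets *)

(** The obstacle to interpreting the scalars is that the defining condition concerns sums of
    products of every length, hence is not first-order as it stands. It is cut into stages, one for
    each number of summands; the codes of a stage form a definable group, and the descending chain
    condition makes one stage decide all of them. No quotient by [ann R] is formed: an additive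
    projection [pr] picks representatives, and equalities are tested modulo [ann].

    [tame] isolates what is used of definability. It passes to interpreted structures, so that
    tuples, residue fields and finite extensions need no return to types.

    The annihilator threatens indecomposability: a central projection of the i-th factor is
    controlled by the primitive idempotent only modulo [ann R]. This is why a complement of the
    intersection of [ann R] and [R ** R] goes to the null algebra. The annihilating elements left in
    a factor lie in [R ** R], and a central idempotent map with such values vanishes: its value is a
    sum of products, and applying the map again multiplies annihilating elements. *)

Definition lift_ren n m (r : 'I_n -> 'I_m) (i : 'I_n.+1) : 'I_m.+1 :=
  if unlift ord0 i is Some j then lift ord0 (r j) else ord0.

Fixpoint map_term C C' (g : C -> C') n m (r : 'I_n -> 'I_m) (t : term C n) :
    term C' m :=
  match t with
  | Var i => Var C' (r i)
  | Cst a => Cst m (g a)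
  | TZero => TZero C' m
  | TOpp t1 => TOpp (map_term g r t1)
  | TAdd t1 t2 => TAdd (map_term g r t1) (map_term g r t2)
  | TMul t1 t2 => TMul (map_term g r t1) (map_term g r t2)
  end.

Fixpoint map_formula C C' (g : C -> C') n (f : formula C n) :
    forall m, ('I_n -> 'I_m) -> formula C' m :=
  match f in formula _ n return forall m, ('I_n -> 'I_m) -> formula C' m with
  | FEq _ t u => fun m r => FEq (map_term g r t) (map_term g r u)
  | FNot _ f1 => fun m r => FNot (map_formula g f1 r)
  | FAnd _ f1 f2 => fun m r => FAnd (map_formula g f1 r) (map_formula g f2 r)
  | FEx _ f1 => fun m r => FEx (map_formula g f1 (lift_ren r))
  end.

Lemma eval_map (M : structure) C C' (c : C' -> M) (g : C -> C') n m
    (r : 'I_n -> 'I_m) (t : term C n) v :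
  eval c v (map_term g r t) = eval (c \o g) (v \o r) t.
Proof. by elim: t => //= [t -> | t1 -> t2 -> | t1 -> t2 ->]. Qed.

Lemma extend_lift (M : structure) n m (r : 'I_n -> 'I_m) (a : M) v :
  extend a v \o lift_ren r = extend a (v \o r).
Proof.
apply/funext => i; rewrite /extend /lift_ren /=.
by case: (unliftP ord0 i) => [j|] _; rewrite ?liftK ?unlift_none.
Qed.

Lemma sat_map (M : structure) C C' (c : C' -> M) (g : C -> C') n
    (f : formula C n) : forall m (r : 'I_n -> 'I_m) v,
  sat c (map_formula g f r) v = sat (c \o g) f (v \o r).
Proof.
elim: f => /= {n}.
- by move=> n t u m r v; rewrite !eval_map.
- by move=> n f IH m r v; rewrite IH.
- by move=> n f IHf h IHh m r v; rewrite IHf IHh.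
- move=> n f IH m r v; apply: eq_exists => a.
  by rewrite IH extend_lift.
Qed.

(* Variables are all of [nat], so that renaming is composition; constants are
   drawn from a countable type, as only countable parameter sets matter. *)
Definition definable (M : structure) (X : (nat -> M) -> Prop) : Prop :=
  exists (C : countType) (c : C -> M) (n : nat) (f : formula C n),
    forall e : nat -> M, X e = sat c f (fun i => e i).

Section Definable.

Variable M : structure.
Implicit Types X Y : (nat -> M) -> Prop.

Lemma definable_not X : definable X -> definable (fun e => ~ X e).
Proof.
move=> [C [c [n [f fP]]]]; exists C, c, n, (FNot f) => e /=.
by rewrite fP.
Qed.

Lemma definable_and X Y :
  definable X -> definable Y -> definable (fun e => X e /\ Y e).
Proof.
move=> [C [c [n [f fP]]]] [C' [c' [n' [f' fP']]]].
pose d (s : C + C') := match s with inl a => c a | inr b => c' b end.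
exists (C + C')%type, d, (maxn n n').
exists (FAnd (map_formula inl f (widen_ord (leq_maxl n n')))
             (map_formula inr f' (widen_ord (leq_maxr n n')))) => e /=.
by rewrite !sat_map fP fP'.
Qed.

Lemma definable_ren X (r : nat -> nat) :
  definable X -> definable (fun e => X (fun i => e (r i))).
Proof.
move=> [C [c [n [f fP]]]]; exists C, c, (\max_(i < n) r i).+1.
have lt_r (i : 'I_n) : (r i < (\max_(j < n) r j).+1)%N.
  by rewrite ltnS (leq_bigmax (F := fun j : 'I_n => r j)).
exists (map_formula id f (fun i => Ordinal (lt_r i))) => e.
by rewrite fP sat_map.
Qed.

Lemma definable_ex (X : (nat -> M) -> M -> Prop) :
  definable (fun e => X (fun i => e i.+1) (e 0%N)) ->
  definable (fun e => exists a, X e a).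
Proof.
move=> [C [c [n [f fP]]]]; exists C, c, n.
exists (FEx (map_formula id f (widen_ord (leqnSn n)))) => e /=.
apply: eq_exists => a; rewrite sat_map.
have := fP (fun k => if k is k'.+1 then e k' else a); rewrite /= => ->.
congr sat; apply/funext => i /=; rewrite /extend /=.
case: unliftP => [j /(congr1 val)/=|/(congr1 val)/=] ->; last by [].
by rewrite /bump.
Qed.

Lemma definable_eq i j : definable (fun e : nat -> M => e i = e j).
Proof.
exists nat, (fun=> szero M), (maxn i j).+1.
have lti : (i < (maxn i j).+1)%N by rewrite ltnS leq_maxl.
have ltj : (j < (maxn i j).+1)%N by rewrite ltnS leq_maxr.
by exists (FEq (Var _ (Ordinal lti)) (Var _ (Ordinal ltj))).
Qed.

Lemma definable_cst i (a : M) : definable (fun e : nat -> M => e i = a).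
Proof.
by exists nat, (fun=> a), i.+1, (FEq (Var _ ord_max) (Cst _ 0%N)).
Qed.

Lemma definable_add : definable (fun e : nat -> M => sadd (e 0%N) (e 1%N) = e 2%N).
Proof.
exists nat, (fun=> szero M), 3.
by exists (FEq (TAdd (Var _ (@Ordinal 3 0 isT)) (Var _ (@Ordinal 3 1 isT)))
               (Var _ (@Ordinal 3 2 isT))).
Qed.

Lemma definable_mul : definable (fun e : nat -> M => smul (e 0%N) (e 1%N) = e 2%N).
Proof.
exists nat, (fun=> szero M), 3.
by exists (FEq (TMul (Var _ (@Ordinal 3 0 isT)) (Var _ (@Ordinal 3 1 isT)))
               (Var _ (@Ordinal 3 2 isT))).
Qed.

End Definable.

(** Types have finitely many variables, so a tree is forbidden only under a bound common to all its
    nodes: without one, fixing successive variables to be equal or unequal to some element gives a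
    splitting tree in any structure with two elements. *)
Definition depends_below T (n : nat) (X : (nat -> T) -> Prop) : Prop :=
  forall e e' : nat -> T, (forall i, (i < n)%N -> e i = e' i) -> X e -> X e'.

Definition splitting_tree E (X : seq bool -> E -> Prop) : Prop :=
  [/\ forall s, exists e, X s e,
      forall s b e, X (rcons s b) e -> X s e
    & forall s e, X (rcons s true) e -> X (rcons s false) e -> False].

(** * Splitting trees and the number of types *)

Section MaximalTypes.

Variables (M : structure) (C : Type) (c : C -> M) (n : nat).
Notation form := {classic formula C n}.

Lemma finitely_satisfiableP (p : set form) :
  finitely_satisfiable c p <->
  forall s : seq form, {in s, forall f, p f} ->
    exists v, {in s, forall f, sat c (f : formula C n) v}.
Proof.
split=> [pfs s sp | pfs q qp qfin].
  have [||v vP] := pfs [set` s]%classic; first by move=> f /= /sp.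
    by apply: (finite_seqP (T := form) _).2; exists s.
  by exists v.
have [s sE] := (finite_seqP (T := form) q).1 qfin.
have [f fs|v vP] := pfs s; first by apply: qp; rewrite sE.
by exists v => f; rewrite sE => /vP.
Qed.

Lemma finitely_satisfiable_extend (p : set form) :
  finitely_satisfiable c p ->
  exists2 q : set form,
    (p `<=` q)%classic & maximal_finitely_satisfiable c q.
Proof.
move=> pfs.
(* The sets [q] are joined with [p] instead of being required to contain it, because Zorn's lemma
   also asks for the union of the empty chain. *)
have [F Fsat totF|q [qfs qmax]] :=
    @Zorn_bigcup _ [set q : set form | finitely_satisfiable c (q `|` p)%classic].
  apply/finitely_satisfiableP => s sF.
  suff [q Fq qs] : exists2 q : set form, F q \/ q = set0 &
      {in s, forall f, (q `|` p)%classic f}.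
    have /finitely_satisfiableP : finitely_satisfiable c (q `|` p)%classic.
      by case: Fq => [/Fsat|->]; rewrite ?set0U.
    exact.
  elim: s sF => [|f s IH] sF; first by exists set0; [right | ].
  have [g gs|q Fq qs] := IH; first by apply: sF; rewrite inE gs orbT.
  have [[r Fr rf]|pf] := sF f (mem_head _ _); last first.
    by exists q => // g; rewrite inE => /predU1P[->|/qs//]; right.
  have rs : {in f :: s, forall g, g \in s \/ g = f}.
    by move=> g; rewrite inE => /predU1P[->|]; [right | left].
  case: Fq => [Fq|q0]; last first.
    exists r; first by left.
    by move=> g /rs[/qs|->]; [rewrite q0 => -[//|]; right | left].
  have [rq|qr] := totF r q Fr Fq.
    by exists q => [|g /rs[/qs|->]]; [left | | left; apply: rq].
  exists r => [|g /rs[/qs[qg|pg]|->]]; [by left | | by right | by left].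
  by left; apply: qr.
have pq : (p `<=` q)%classic.
  apply: contrapT => npq; apply: (qmax (q `|` p)%classic); last first.
    by rewrite /= -setUA setUid.
  split=> [f qf|qpq]; first by left.
  by apply: npq => f pf; apply: qpq; right.
exists q => //; split; first by move: qfs; rewrite /= (setUidl pq).
move=> r qr rfs; apply: contrapT => rq; apply: (qmax r).
  split=> // rq'; apply: rq; apply/seteqP; split=> //.
by rewrite /= (setUidl (subset_trans pq qr)).
Qed.

End MaximalTypes.

(** Cantor's diagonal argument: at the index that [g] gives to a branch [x], the branch [d] takes
    the opposite of the value of [x]. *)
Lemma branches_uncountable (T : Type) (A : set T) (F : (nat -> bool) -> T) :
  injective F -> (forall x, A (F x)) -> ~ countable A.
Proof.
move=> Finj FA Acount.
have /countable_injP[g ginj] : countable (range F).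
  by apply: sub_countable Acount; apply: subset_card_le => _ [x _ <-].
pose d k := if pselect (exists2 x, g (F x) = k & x k) then false else true.
have dE : d (g (F d)) = ~~ `[< exists2 x, g (F x) = g (F d) & x (g (F d)) >].
  by rewrite {1}/d; case: pselect => P; case: asboolP.
case: asboolP dE => [[x gx xk]|nex] /= dE; last first.
  by apply: nex; exists d; rewrite ?dE.
have xd : x = d by apply/Finj/ginj; rewrite ?inE //; eexists.
by move: xk; rewrite xd dE.
Qed.

(** The formulas along a branch are finitely satisfiable and extend to a complete type over the
    parameters of the whole tree, which are countably many. Where two branches part, their types
    contain contradictory formulas. *)
Lemma no_splitting_tree (M : structure) (N : nat)
    (X : seq bool -> (nat -> M) -> Prop) :
  (forall (A : set M), countable A -> countable (@complete_types M A N.+1)) ->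
  (forall s, definable (X s)) -> (forall s, depends_below N (X s)) ->
  splitting_tree X -> False.
Proof.
move=> types_count Xdef Xdep [Xne Xsub Xdisj].
(* One variable more than [N] makes [inord] available even for [N = 0]; the sets of the tree see
   only the first [N] values. *)
pose rep v : nat -> M := fun i => v (inord i : 'I_N.+1).
have [C HC] := choice Xdef.
pose c s := sval (cid (HC s)); have Hc s := svalP (cid (HC s)).
pose cst (u : {s : seq bool & C s}) : M := c (tag u) (tagged u).
pose A : set M := range cst.
have [g gP] : exists g : forall s, formula A N.+1,
    forall s v, sat (@set_val M A) (g s) v <-> X s (rep v).
  have /choice[g gP] : forall s, exists g : formula A N.+1,
    forall v, sat (@set_val M A) g v <-> X s (rep v); last by exists g.
  move=> s; have [n [f fP]] := Hc s.
  have memA a : cst (existT C s a) \in A by rewrite inE; exists (existT C s a).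
  exists (map_formula (fun a => SigSub (memA a)) f (fun i => inord i)) => v.
  rewrite sat_map fP.
  by have -> : @set_val M A \o (fun a => SigSub (memA a)) = c s.
have rep_ne s : exists v, X s (rep v).
  have [e Xe] := Xne s; exists (fun i => e i).
  by apply: Xdep Xe => i ltiN; rewrite /rep inordK // ltnW.
have Xtake s t v : X (s ++ t) v -> X s v.
  by elim/last_ind: t => [|t b IH]; rewrite ?cats0 // -rcons_cat => /Xsub/IH.
pose pre (x : nat -> bool) n := mkseq x n.
have preS x n : pre x n.+1 = rcons (pre x n) (x n) by rewrite /pre mkseqS.
have Xpre x m n v : (m <= n)%N -> X (pre x n) v -> X (pre x m) v.
  move=> /subnKC <-; elim: (n - m)%N => [|k IH]; rewrite ?addn0 //.
  by rewrite addnS preS => /Xsub.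
pose p (x : nat -> bool) : set {classic formula A N.+1} := range (g \o pre x).
have /choice[q qP] : forall x, exists q : set {classic formula A N.+1},
    (p x `<=` q)%classic /\ maximal_finitely_satisfiable (@set_val M A) q.
  move=> x; have [|q pq qmax] := @finitely_satisfiable_extend M A (@set_val M A) _ (p x); last by exists q.
  apply/finitely_satisfiableP => s sp.
  suff [n nP] : exists n, {in s, forall f, forall v, X (pre x n) (rep v) ->
      sat (@set_val M A) (f : formula A N.+1) v}.
    by have [v /nP vP] := rep_ne (pre x n); exists v => f fs; apply: vP fs.
  elim: s sp => [|f s IH] sp; first by exists 0%N.
  have [h hs|n nP] := IH; first by apply: sp; rewrite inE hs orbT.
  have [k _ kf] := sp f (mem_head _ _).
  exists (maxn n k) => h; rewrite inE => /predU1P[->|hs] v Xv.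
    by rewrite -kf; apply/gP; apply: Xpre Xv; rewrite leq_maxr.
  by apply: nP => //; apply: Xpre Xv; rewrite leq_maxl.
apply: (@branches_uncountable _ (@complete_types M A N.+1) q) => [x y qxy|x|].
- have /contrapT H : ~ ~ forall n, pre x n = pre y n.
    move=> nH; have [n] : exists n, pre x n != pre y n.
      by apply: contrapT => nex; apply: nH => n; apply/eqP; apply: contrapT => /negP; apply: contra_not nex => ?; exists n.
    elim: n => [|n IH]; first by rewrite eqxx.
    have [Exy|/IH//] := eqVneq (pre x n) (pre y n).
    rewrite !preS Exy eqseq_rcons eqxx /= => nxy.
    have [qfs _] := (qP x).2.
    have qg z : z = x \/ z = y -> q x (g (pre z n.+1)).
      by case=> ->; [apply: (qP x).1 | rewrite qxy; apply: (qP y).1]; exists n.+1.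
    have [f|v vP] := (finitely_satisfiableP (@set_val M A) (q x)).1 qfs
         [:: g (pre x n.+1); g (pre y n.+1)].
      by rewrite !inE => /orP[] /eqP ->; apply: qg; [left | right].
    have /gP X1 := vP _ (mem_head _ _).
    have /gP X2 : sat (@set_val M A) (g (pre y n.+1)) v.
      by apply: vP; rewrite !inE eqxx orbT.
    move: X1 X2; rewrite !preS Exy.
    by case: (x n) (y n) nxy => [] [] // _ X1 X2; [apply: Xdisj X1 X2 | apply: Xdisj X2 X1].
  apply/funext => n; have := H n.+1.
  by rewrite !preS => /rcons_inj[].
- exact: (qP x).2.
- apply: types_count; apply: card_le_trans (card_image_le _ _) _.
  exact: (@countableP {s : seq bool & C s}).
Qed.

(** * Families of definable sets without splitting trees *)

(* [D X] reads "X is definable"; the sets [X] live on assignments of all the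
   variables 0, 1, 2, ..., and [tame_ex] quantifies over variable 0. *)
Record tame (T : Type) (D : ((nat -> T) -> Prop) -> Prop) : Prop := Tame {
  tame_not : forall X, D X -> D (fun e => ~ X e);
  tame_and : forall X Y, D X -> D Y -> D (fun e => X e /\ Y e);
  tame_ren : forall X (r : nat -> nat), D X -> D (fun e => X (fun i => e (r i)));
  tame_ex : forall X : (nat -> T) -> T -> Prop,
    D (fun e => X (fun i => e i.+1) (e 0%N)) -> D (fun e => exists a, X e a);
  tame_eq : D (fun e => e 0%N = e 1%N);
  tame_cst : forall a, D (fun e => e 0%N = a);
  tame_tree : forall n (X : seq bool -> (nat -> T) -> Prop),
    (forall s, D (X s)) -> (forall s, depends_below n (X s)) ->
    splitting_tree X -> False
}.

Section TameClosure.

Variables (T : Type) (D : ((nat -> T) -> Prop) -> Prop).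
Hypothesis tD : tame D.
Implicit Types (X Y : (nat -> T) -> Prop) (F G : (nat -> T) -> T).

Lemma tame_ext X Y : (forall e, X e <-> Y e) -> D X -> D Y.
Proof. by move=> XY; congr D; apply/funext => e; apply/propext. Qed.

Lemma tame_or X Y : D X -> D Y -> D (fun e => X e \/ Y e).
Proof.
move=> /(tame_not tD) DX /(tame_not tD) DY.
by apply: tame_ext (tame_not tD (tame_and tD DX DY)) => e; rewrite not_andE !notK.
Qed.

Lemma tame_imp X Y : D X -> D Y -> D (fun e => X e -> Y e).
Proof.
move=> /(tame_not tD) DX DY.
by apply: tame_ext (tame_or DX DY) => e; rewrite implyE.
Qed.

Lemma tame_all (X : (nat -> T) -> T -> Prop) :
  D (fun e => X (fun i => e i.+1) (e 0%N)) -> D (fun e => forall a, X e a).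
Proof.
move=> DX; have DnX := @tame_ex _ _ tD (fun e a => ~ X e a) (tame_not tD DX).
apply: tame_ext (tame_not tD DnX) => e; split=> [nX a|Xe [a]]; last exact.
by apply: contrapT => nXa; apply: nX; exists a.
Qed.

Lemma tame_prop (P : Prop) : D (fun=> P).
Proof.
have DT : D (fun=> True) by apply: tame_ext (tame_ren tD (fun=> 0%N) (tame_eq tD)).
case: (pselect P) => HP; first by apply: tame_ext DT.
by apply: tame_ext (tame_not tD DT) => e; split.
Qed.

Lemma tame_all_ord m (X : 'I_m -> (nat -> T) -> Prop) :
  (forall j, D (X j)) -> D (fun e => forall j, X j e).
Proof.
move=> DX.
have DXs (s : seq 'I_m) : D (fun e => forall j, j \in s -> X j e).
  elim: s => [|j s IH]; first by apply: tame_ext (tame_prop True).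
  apply: tame_ext (tame_and tD (DX j) IH) => e.
  split=> [[Xj Xs] k|Xs]; first by rewrite inE => /predU1P[->//|/Xs].
  by split=> [|k ks]; apply: Xs; rewrite inE ?eqxx ?ks ?orbT.
apply: tame_ext (DXs (enum 'I_m)) => e.
by split=> Xe j => [|_]; [apply: Xe; rewrite mem_enum | exact: Xe].
Qed.

(** The value sits in variable 0, the one over which [tame_ex] quantifies, so that substituting [F]
    amounts to quantifying over its value. *)
Definition tame_fun F : Prop := D (fun e => F (fun i => e i.+1) = e 0%N).

Lemma tame_let (X : (nat -> T) -> T -> Prop) F :
  D (fun e => X (fun i => e i.+1) (e 0%N)) -> tame_fun F -> D (fun e => X e (F e)).
Proof.
move=> DX DF.
apply: tame_ext (@tame_ex _ _ tD (fun e a => F e = a /\ X e a) (tame_and tD DF DX)).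
by move=> e; split=> [[a [->]]|Xe] //; exists (F e).
Qed.

Lemma tame_eq_var i j : D (fun e => e i = e j).
Proof. exact: (tame_ren tD (fun k => if k is 0 then i else j) (tame_eq tD)). Qed.

Lemma tame_fun_var i : tame_fun (fun e => e i).
Proof. exact: tame_eq_var. Qed.

Lemma tame_fun_cst a : tame_fun (fun=> a).
Proof. by apply: tame_ext (tame_cst tD a) => e; split. Qed.

Lemma tame_fun_ren F (r : nat -> nat) :
  tame_fun F -> tame_fun (fun e => F (fun i => e (r i))).
Proof.
by move=> DF; exact: (tame_ren tD (fun k => if k is k'.+1 then (r k').+1 else 0%N) DF).
Qed.

Lemma tame_eq_fun F G : tame_fun F -> tame_fun G -> D (fun e => F e = G e).
Proof.
move=> DF DG; apply: (tame_let (X := fun e a => a = G e) _ DF).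
by apply: tame_ext DG => e; split.
Qed.

Lemma tame_unary (X : T -> Prop) F :
  D (fun e => X (e 0%N)) -> tame_fun F -> D (fun e => X (F e)).
Proof. by move=> DX; apply: (@tame_let (fun=> X)). Qed.

Lemma tame_fun_op (op : T -> T -> T) F G :
    D (fun e => op (e 0%N) (e 1%N) = e 2%N) -> tame_fun F -> tame_fun G ->
  tame_fun (fun e => op (F e) (G e)).
Proof.
move=> Dop DF DG.
apply: (tame_let (X := fun e a => op a (G (fun i => e i.+1)) = e 0%N) _
                 (tame_fun_ren succn DF)).
apply: (tame_let (X := fun e b => op (e 0%N) b = e 1%N) _
                 (tame_fun_ren (addn 2) DG)).
exact: (tame_ren tD (fun k => match k with 0 => 1 | 1 => 0 | _ => 2 end)%N Dop).
Qed.

End TameClosure.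

(** * Interpretations *)

Section Interpretation.

Variables (T T' : Type) (D : ((nat -> T) -> Prop) -> Prop).
Variables (m : nat) (pi : ('I_m.+1 -> T) -> T').

Definition block (e : nat -> T) (i : nat) (j : 'I_m.+1) : T := e (i * m.+1 + j)%N.

(** [pi] is defined on all tuples, so that no definable domain has to be carried along; tuples that
    code nothing receive some value as well. *)
Definition pullback (X : (nat -> T') -> Prop) : Prop :=
  D (fun e => X (fun i => pi (block e i))).

Hypothesis tD : tame D.

Lemma tame_ex_block n (Y : (nat -> T) -> ('I_n -> T) -> Prop) :
  D (fun e => Y (fun i => e (n + i)%N) (fun j => e j)) ->
  D (fun e => exists t, Y e t).
Proof.
elim: n Y => [|n IH] Y DY.
  apply: tame_ext DY => e; split=> [Ye|[t Yt]]; first by exists (fun j => e j).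
  by have -> : (fun j : 'I_0 => e j) = t by apply/funext => -[].
pose cons_ord a (t : 'I_n -> T) (j : 'I_n.+1) : T :=
  if unlift ord0 j is Some k then t k else a.
have DY' : D (fun e => exists t, exists a, Y e (cons_ord a t)).
  apply: IH; apply: (tame_ex tD (X := fun e a => Y _ (cons_ord a _))).
  apply: tame_ext DY => e.
  have -> // : (fun j : 'I_n.+1 => e j) = cons_ord (e 0%N) (fun j => e j.+1).
  apply/funext => j; rewrite /cons_ord.
  by case: unliftP => [k|] ->.
apply: tame_ext DY' => e; split=> [[t [a Yt]]|[t Yt]]; first by eexists; exact: Yt.
exists (t \o lift ord0), (t ord0).
have -> // : cons_ord (t ord0) (t \o lift ord0) = t.
apply/funext => j; rewrite /cons_ord.
by case: unliftP => [k|] ->.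
Qed.

Hypothesis pi_surj : forall y, exists t, pi t = y.
Hypothesis pi_eq : pullback (fun e => e 0%N = e 1%N).

Lemma block_cat (e : nat -> T) (i : nat) :
  block (fun k => e (m.+1 + k)%N) i = block e i.+1.
Proof. by apply/funext => j; rewrite /block mulSn addnA. Qed.

Lemma block0 (e : nat -> T) : block e 0 = (fun j => e j).
Proof. by apply/funext. Qed.

Lemma lift_assignment (e : nat -> T') :
  exists e' : nat -> T, forall i, pi (block e' i) = e i.
Proof.
have [t tP] := choice (fun i => pi_surj (e i)).
exists (fun k => t (k %/ m.+1)%N (inord (k %% m.+1)%N)) => i.
rewrite -tP; congr pi; apply/funext => j.
rewrite /block divnMDl // divn_small // addn0 modnMDl modn_small //.
by rewrite inord_val.
Qed.

(** A quantifier over [T'] becomes a block of [m.+1] quantifiers over [T], and a splitting tree in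
    [n] variables pulls back to one in [n * m.+1] variables. *)
Lemma tame_interpretation : tame pullback.
Proof.
split.
- by move=> X DX; exact: (tame_not tD DX).
- by move=> X Y DX DY; exact: (tame_and tD DX DY).
- move=> X r; rewrite /pullback => DX.
  pose r' k := (r (k %/ m.+1) * m.+1 + k %% m.+1)%N.
  apply: tame_ext (tame_ren tD r' DX) => e.
  rewrite (_ : (fun i => pi (block _ i)) = (fun i => pi (block e (r i)))) //.
  apply/funext => i; congr pi; apply/funext => j.
  by rewrite /block /r' divnMDl // divn_small // addn0 modnMDl modn_small.
- move=> X; rewrite /pullback => DX.
  have DX' : D (fun e => exists t, X (fun i => pi (block e i)) (pi t)).
    apply: tame_ex_block; apply: tame_ext DX => e /=; rewrite block0.
    rewrite (_ : (fun i => pi (block _ i.+1)) =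
      (fun i => pi (block (fun k => e (m.+1 + k)%N) i))) //.
    by apply/funext => i; rewrite block_cat.
  apply: tame_ext DX' => e; split=> [[t Xt]|[a]]; first by exists (pi t).
  by have [t <-] := pi_surj a => Xt; exists t.
- exact: pi_eq.
- move=> a; have [u ua] := pi_surj a; subst a; rewrite /pullback.
  have DX : D (fun e => exists t, pi (block e 0) = pi t /\ forall j, t j = u j).
    apply: (@tame_ex_block _ (fun e t => pi (block e 0) = pi t /\ forall j, t j = u j)).
    apply: (tame_and tD); last first.
      apply: tame_all_ord => // j.
      exact: (tame_ren tD (fun=> j : nat) (tame_cst tD (u j))).
    move: pi_eq; rewrite /pullback; apply: tame_ext => e.
    by rewrite block_cat block0; split=> ->.
  apply: tame_ext DX => e; split=> [[t [-> tu]]|pe].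
    by congr pi; apply/funext.
  by exists u.
move=> n X DX Xdep [Xne Xsub Xdisj].
apply: (@tame_tree _ _ tD (n * m.+1)%N
          (fun s e => X s (fun i => pi (block e i)))) => //.
- move=> s e e' ee'; apply: Xdep => i ltin.
  congr pi; apply/funext => j; apply: ee'.
  by rewrite -(leq_pmul2r (ltn0Sn m)) in ltin; apply: leq_trans ltin; rewrite mulSn addnC -addSn leq_add2r.
- split=> [s|s b e|s e]; [|exact: Xsub|exact: Xdisj].
  have [e Xe] := Xne s; have [e' e'P] := lift_assignment e.
  by exists e'; rewrite (_ : (fun i => _) = e) //; apply/funext.
Qed.

End Interpretation.

(** [H n.+1] and its image under [g n] are disjoint parts of [H n]; choosing one of the two at each
    level, along a binary word, produces a splitting tree. With translations for [g n] this covers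
    descending chains of subgroups, additive as well as multiplicative. *)
Lemma no_chain_of_maps (T : Type) (D : ((nat -> T) -> Prop) -> Prop)
    (H : nat -> T -> Prop) (g : nat -> T -> T) :
  tame D ->
  (forall n, D (fun e => H n (e 0%N))) ->
  (forall n, tame_fun D (fun e => g n (e 0%N))) ->
  (forall n, injective (g n)) ->
  (forall n, exists x, H n x) ->
  (forall n x, H n.+1 x -> H n x /\ H n (g n x)) ->
  (forall n x y, H n.+1 x -> H n.+1 y -> g n x <> y) -> False.
Proof.
move=> tD DH Dg g_inj H_ne H_sub H_disj.
pose h b n x := if b then g n x else x.
pose X := fix X n s : T -> Prop := if s is b :: s' then
  (fun x => exists y, X n.+1 s' y /\ h b n y = x) else H n.
have h_inj b n : injective (h b n) by case: b => // x y /g_inj.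
have X_sub s b : forall n x, X n (rcons s b) x -> X n s x.
  elim: s => [|c s IH] n x /=; last by case=> y [/IH Xy <-]; exists y.
  by case=> y [Hy <-]; have [] := H_sub _ _ Hy; case: b.
apply: (@tame_tree _ _ tD 1 (fun s e => X 0%N s (e 0%N))).
- move=> s; move: {1}0%N; elim: s => [|b s IH] n /=; first exact: DH.
  apply: (tame_ex tD (X := fun e y => X n.+1 s y /\ h b n y = e 0%N)).
  apply: tame_and => //; case: b => /=; last exact: tame_eq_var.
  by apply: tame_eq_fun => //; exact: tame_fun_var.
- by move=> s e e' /(_ 0%N isT) ->.
split=> [s|s b e|s e]; [|exact: X_sub|].
  suff [x Xx] : exists x, X 0%N s x by exists (fun=> x).
  move: 0%N; elim: s => [|b s IH] n //=.
  by have [y Xy] := IH n.+1; exists (h b n y), y.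
move: 0%N (e 0%N); elim: s => [|c s IH] n x /=.
  by case=> y [Hy <-] [z [Hz]] /esym; apply: H_disj.
by case=> y [Xy <-] [z [Xz /h_inj zy]]; apply: (IH n.+1 y) => //; rewrite -zy.
Qed.

(** * The descending chain condition *)

Section AdditiveGroup.

Variables (V : zmodType) (D : ((nat -> V) -> Prop) -> Prop).
Hypothesis tD : tame D.
Hypothesis D_add : D (fun e => e 0%N + e 1%N = e 2%N).

Lemma tame_fun_add F G :
  tame_fun D F -> tame_fun D G -> tame_fun D (fun e => F e + G e).
Proof. exact: tame_fun_op. Qed.

Lemma tame_fun_opp F : tame_fun D F -> tame_fun D (fun e => - F e).
Proof.
move=> DF; have D0 := tame_fun_cst tD (0 : V).
have := tame_eq_fun tD (tame_fun_add (tame_fun_ren tD succn DF) (tame_fun_var tD 0)) D0.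
apply: tame_ext => e; split=> [/eqP|<-]; last by rewrite subrr.
by rewrite addr_eq0 => /eqP ->; rewrite opprK.
Qed.

Lemma tame_fun_sum (I : Type) (r : seq I) (F : I -> (nat -> V) -> V) :
  (forall i, tame_fun D (F i)) -> tame_fun D (fun e => \sum_(i <- r) F i e).
Proof.
move=> DF; elim: r => [|i r IH].
  by apply: tame_ext (tame_fun_cst tD (0 : V)) => e; rewrite big_nil.
apply: tame_ext (tame_fun_add (DF i) IH) => e; rewrite big_cons //.
Qed.

Definition subgroup (H : V -> Prop) : Prop :=
  H 0 /\ forall x y, H x -> H y -> H (x - y).

Lemma no_subgroup_chain (H : nat -> V -> Prop) :
  (forall n, subgroup (H n)) -> (forall n, D (fun e => H n (e 0%N))) ->
  (forall n x, H n.+1 x -> H n x) -> (forall n, exists2 x, H n x & ~ H n.+1 x) ->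
  False.
Proof.
move=> Hsub DH Hdec Hneq.
have HD n x y : H n x -> H n y -> H n (x + y).
  move=> Hx Hy; rewrite -[y]opprK -[- y]add0r; apply: (Hsub n).2 => //.
  by apply: (Hsub n).2 => //; case: (Hsub n).
have /choice[a aP] : forall n, exists x, H n x /\ ~ H n.+1 x.
  by move=> n; have [x] := Hneq n; exists x.
apply: (@no_chain_of_maps _ D H (fun n x => a n + x)) => //.
- move=> n; apply: tame_fun_add; [exact: tame_fun_cst | exact: tame_fun_var].
- by move=> n; exists 0; exact: (Hsub n).1.
- move=> n x Hx; have Hx' := Hdec _ _ Hx; split=> //.
  by apply: HD => //; case: (aP n).
- move=> n x y Hx Hy axy; apply: (aP n).2.
  by rewrite -(addrK x (a n)) axy; apply: (Hsub n.+1).2.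
Qed.

(** The working form of the chain condition: without a minimal member, choosing smaller and smaller
    ones gives a strictly descending chain. *)
Lemma minimal_subgroup (F : (V -> Prop) -> Prop) :
  (exists H, F H) -> (forall H, F H -> subgroup H /\ D (fun e => H (e 0%N))) ->
  exists2 H, F H & forall H', F H' -> (forall x, H' x -> H x) -> forall x, H x -> H' x.
Proof.
move=> [H0 FH0] FP; apply: contrapT => nmin.
have next (H : {H | F H}) : exists H' : {H | F H},
    (forall x, sval H' x -> sval H x) /\ exists2 x, sval H x & ~ sval H' x.
  case: H => H FH /=; apply: contrapT => nH; apply: nmin; exists H => // H' FH' H'H x Hx.
  by apply: contrapT => nH'x; apply: nH; exists (exist _ H' FH'); split=> //; exists x.
have [nx nxP] := choice next.
pose H n := sval (iter n nx (exist _ H0 FH0)).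
apply: (@no_subgroup_chain H) => n; rewrite /H.
- by case: (FP _ (svalP (iter n nx (exist _ H0 FH0)))).
- by case: (FP _ (svalP (iter n nx (exist _ H0 FH0)))).
- by case: (nxP (iter n nx (exist _ H0 FH0))).
- by case: (nxP (iter n nx (exist _ H0 FH0))).
Qed.

End AdditiveGroup.

(** * Tame fields are closed under roots *)

Section TameField.

Variables (L : fieldType) (D : ((nat -> L) -> Prop) -> Prop).
Hypothesis tD : tame D.
Hypothesis D_add : D (fun e => e 0%N + e 1%N = e 2%N).
Hypothesis D_mul : D (fun e => e 0%N * e 1%N = e 2%N).
Hypothesis L_char0 : forall n, n.+1%:R != 0 :> L.
Implicit Types (X Y Z : L -> Prop) (a b x y : L).

Lemma tame_fun_mul F G :
  tame_fun D F -> tame_fun D G -> tame_fun D (fun e => F e * G e).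
Proof. exact: tame_fun_op. Qed.

Lemma tame_fun_exp n F : tame_fun D F -> tame_fun D (fun e => F e ^+ n).
Proof.
move=> DF; elim: n => [|n IH]; first exact: tame_fun_cst.
apply: tame_ext (tame_fun_mul DF IH) => e; by rewrite exprS.
Qed.

Definition def1 X : Prop := D (fun e => X (e 0%N)).

Lemma def1_affine X a b : def1 X -> def1 (fun x => X (a * x + b)).
Proof.
move=> DX; apply: (tame_unary tD (X := X)) => //; apply: tame_fun_add => //.
  by apply: tame_fun_mul; [exact: tame_fun_cst | exact: tame_fun_var].
exact: tame_fun_cst.
Qed.

Lemma def1_and X Y : def1 X -> def1 Y -> def1 (fun x => X x /\ Y x).
Proof. exact: tame_and. Qed.

Lemma def1_not X : def1 X -> def1 (fun x => ~ X x).
Proof. exact: tame_not. Qed.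

(* The affine-invariant ideal of subsets of [L] generated by [I]. *)
Inductive small (I : set (L -> Prop)) : (L -> Prop) -> Prop :=
| small_in X : I X -> small I X
| small_empty : small I (fun=> False)
| small_union X Y : small I X -> small I Y -> small I (fun x => X x \/ Y x)
| small_affine X a b : a != 0 -> small I X -> small I (fun x => X (a * x + b))
| small_sub X Y : (forall x, X x -> Y x) -> small I Y -> small I X.

Lemma small_mono (I J : set (L -> Prop)) X :
  (I `<=` J)%classic -> small I X -> small J X.
Proof.
move=> IJ; elim => {X}.
- by move=> X /IJ; exact: small_in.
- exact: small_empty.
- by move=> X Y _ HX _; exact: small_union.
- by move=> X a b a0 _; exact: small_affine.
- by move=> X Y XY _; exact: small_sub.
Qed.

(** Zorn's lemma is applied to generating families of definable sets. A derivation of [small] uses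
    finitely many generators, hence lives in a single member of a chain; the empty family generates
    only the empty set. *)
Lemma exists_maximal_ideal : exists I : set (L -> Prop),
  ~ small I (fun=> True) /\
  forall X, def1 X -> ~ small I X -> small (X |` I)%classic (fun=> True).
Proof.
have [F FP totF|I [[Idef Ismall] Imax]] := @Zorn_bigcup _
  [set I : set (L -> Prop) | (forall X, I X -> def1 X) /\ ~ small I (fun=> True)].
  split=> [X [I /FP[Idef _] IX]|]; first exact: Idef.
  have smallF X : small (\bigcup_(I in F) I)%classic X ->
      exists2 I, F I \/ I = set0 & small I X.
    elim => {X}.
    - by move=> X [I FI IX]; exists I; [left | apply: small_in].
    - by exists set0; [right | apply: small_empty].
    - move=> X Y _ [I FI IX] _ [J FJ JY].
      have IJ : (I `<=` J)%classic \/ (J `<=` I)%classic.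
        by case: FI FJ => [FI|->] [FJ|->]; [exact: totF | right | left | left].
      case: IJ => IJ; [exists J | exists I] => //; apply: small_union => //.
        exact: small_mono IX.
      exact: small_mono JY.
    - by move=> X a b a0 _ [I FI IX]; exists I => //; apply: small_affine.
    - by move=> X Y XY _ [I FI IY]; exists I => //; apply: small_sub IY.
  case/smallF => I [/FP[_] //|->].
  suff small0 X : small set0 X -> forall x, ~ X x by move=> /small0/(_ 0); apply.
  elim=> {X}; [by move=> X [] | by move=> x [] | | | ].
  - by move=> X Y _ nX _ nY x [/nX|/nY].
  - by move=> X a b _ _ nX x /nX.
  - by move=> X Y XY _ nY x /XY/nY.
exists I; split=> // X DX nIX; apply: contrapT => nXI.
apply: (Imax (X |` I)%classic); last by split=> // Y [->|/Idef].
by split=> [Y IY|XI]; [right | apply: nIX; apply/small_in/XI; left].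
Qed.

(** * Atoms modulo a maximal affine-invariant ideal *)

Section Ideal.

Variable I : set (L -> Prop).
Hypothesis I_proper : ~ small I (fun=> True).
Hypothesis I_max : forall X, def1 X -> ~ small I X ->
  small (X |` I)%classic (fun=> True).

Definition atom X : Prop := [/\ def1 X, ~ small I X &
  forall Y, def1 Y -> small I (fun x => X x /\ Y x) \/ small I (fun x => X x /\ ~ Y x)].

Lemma small_seq (T : eqType) (s : seq T) (F : T -> L -> Prop) :
  {in s, forall i, small I (F i)} ->
  small I (fun x => exists2 i, i \in s & F i x).
Proof.
elim: s => [|i s IH] Fs; first by apply: small_sub (small_empty I) => x [].
have Fi := Fs i (mem_head _ _).
have {}IH : small I (fun x => exists2 i, i \in s & F i x).
  by apply: IH => j js; apply: Fs; rewrite inE js orbT.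
apply: small_sub (small_union Fi IH) => x [j]; rewrite inE.
by move=> /predU1P[->|js] Fj; [left | right; exists j].
Qed.

(** If no atom lay below [X], every definable set below [X] that is not small would split into two
    disjoint ones of the same kind, and iteration would give a splitting tree. *)
Lemma exists_atom X : def1 X -> ~ small I X ->
  exists2 Y, atom Y & forall x, Y x -> X x.
Proof.
move=> DX nX; apply: contrapT => noatom.
pose bigP Y := def1 Y /\ ~ small I Y /\ forall x, Y x -> X x.
pose big := {Y | bigP Y}.
have split2 (Y : big) : exists Z : big * big,
    [/\ forall x, sval Z.1 x -> sval Y x, forall x, sval Z.2 x -> sval Y x
      & forall x, sval Z.1 x -> sval Z.2 x -> False].
  case: Y => Y [DY [nY YX]] /=; apply: contrapT => nZ.
  apply: noatom; exists Y => //; split=> // Z DZ.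
  have [|n1] := pselect (small I (fun x => Y x /\ Z x)); first by left.
  have [|n2] := pselect (small I (fun x => Y x /\ ~ Z x)); first by right.
  case: nZ.
  have W1 : bigP (fun x => Y x /\ Z x).
    by split; [apply: def1_and | split=> // x [/YX]].
  have W2 : bigP (fun x => Y x /\ ~ Z x).
    by split; [apply: def1_and => //; apply: def1_not | split=> // x [/YX]].
  by exists (exist bigP _ W1, exist bigP _ W2); split=> /= x [] // ? ? [].
have [f fP] := choice split2.
have X0 : bigP X by [].
pose node s : big := foldl (fun (Y : big) (b : bool) => if b then (f Y).1 else (f Y).2) (exist bigP X X0) s.
apply: (@tame_tree _ _ tD 1 (fun s e => sval (node s) (e 0%N))).
- by move=> s; case: (node s) => Y [].
- by move=> s e e' /(_ 0%N isT) ->.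
split=> [s|s b e|s e].
- case: (node s) => Y [_ [nY _]] /=; apply: contrapT => Y0; apply: nY.
  by apply: small_sub (small_empty I) => x Yx; apply: Y0; exists (fun=> x).
- rewrite /node foldl_rcons -/(node s); case: (fP (node s)) => H1 H2 _.
  by case: b; [exact: H1 | exact: H2].
- rewrite /node !foldl_rcons -/(node s); case: (fP (node s)) => _ _ H12.
  exact: H12.
Qed.

(** By maximality the whole line is derivable from [X] and [I]; the induction collects the finitely
    many affine images of [X] used in the derivation and a remainder in the ideal. *)
Lemma atom_cover X : def1 X -> ~ small I X ->
  exists (s : seq (L * L)) Z, [/\ all (fun p => p.1 != 0) s, small I Z &
    forall y, Z y \/ exists2 p, p \in s & X (p.1 * y + p.2)].
Proof.
move=> DX nX.
suff H Y : small (X |` I)%classic Y ->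
  exists (s : seq (L * L)) Z, [/\ all (fun p => p.1 != 0) s, small I Z &
    forall y, Y y -> Z y \/ exists2 p, p \in s & X (p.1 * y + p.2)].
  have [s [Z [s0 IZ HZ]]] := H _ (I_max DX nX).
  by exists s, Z; split=> // y; apply: HZ.
elim=> {Y}.
- move=> Y [->|IY].
    exists [:: (1, 0)], (fun=> False); split; [by rewrite /= oner_eq0 | exact: small_empty |].
    by move=> y Xy; right; exists (1, 0); rewrite ?mem_head // mul1r addr0.
  by exists [::], Y; split=> //; [apply: small_in | left].
- by exists [::], (fun=> False); split=> //; apply: small_empty.
- move=> Y Y' _ [s [Z [s0 IZ HZ]]] _ [s' [Z' [s0' IZ' HZ']]].
  exists (s ++ s'), (fun x => Z x \/ Z' x); split; [by rewrite all_cat s0 | exact: small_union |].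
  move=> y [/HZ|/HZ'] [|[p ps Xp]]; [by left; left | | by left; right | ];
    by right; exists p => //; rewrite mem_cat ps ?orbT.
- move=> Y a b a0 _ [s [Z [/allP s0 IZ HZ]]].
  exists [seq (p.1 * a, p.1 * b + p.2) | p <- s], (fun x => Z (a * x + b)); split.
  + by apply/allP => _ /mapP[p /s0 p0 ->] /=; rewrite mulf_neq0.
  + exact: small_affine.
  + move=> y /HZ [|[p ps Xp]]; [by left | right].
    exists (p.1 * a, p.1 * b + p.2); first by apply/mapP; exists p.
    by rewrite /= -mulrA addrA -mulrDr.
- by move=> Y Y' YY' _ [s [Z [s0 IZ HZ]]]; exists s, Z; split=> // y /YY'/HZ.
Qed.

Lemma small_affine_iff X a b : a != 0 ->
  small I (fun x => X (a * x + b)) <-> small I X.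
Proof.
move=> a0; split=> [H|]; last exact: small_affine.
apply: small_sub (small_affine (- b / a) (_ : a^-1 != 0) H); last by rewrite invr_eq0.
by move=> x Xx; rewrite mulrDr mulVKf // mulrCA divff // mulr1 addrNK.
Qed.

Lemma atom_affine X a b : a != 0 -> atom X -> atom (fun x => X (a * x + b)).
Proof.
move=> a0 [DX nX Xat]; split; [exact: def1_affine | by rewrite small_affine_iff |].
have inv x : a^-1 * (a * x + b) + - b / a = x.
  by rewrite mulrDr mulKf // mulNr [a^-1 * b]mulrC addrK.
move=> Y DY; have [] := Xat _ (def1_affine a^-1 (- b / a) DY) => H; [left | right].
  by apply: small_sub (small_affine b a0 H) => x [Xx Yx]; rewrite inv.
by apply: small_sub (small_affine b a0 H) => x [Xx nYx]; rewrite inv.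
Qed.

(* Some multiple [d * b'] of [b' = b / r`!] with [0 < d <= r] fixes the class of the
   atom modulo [I], because that class has at most [r] translates. *)
Lemma atom_translate X b : atom X -> small I (fun x => X x /\ ~ X (x + b)).
Proof.
move=> Xat; have [DX nX Xsplit] := Xat.
have [s [Z [/allP s0 IZ Zs]]] := atom_cover DX nX.
pose r := size s; pose c := b / (r`!)%:R.
pose T j x := X (x + c *+ j).
have small_T (P : L -> Prop) j : small I (fun x => P (x + c *+ j)) <-> small I P.
  rewrite -(small_affine_iff P (c *+ j) (oner_neq0 L)).
  by split; apply: small_sub => x; rewrite mul1r.
have T_atom j : atom (T j).
  have := atom_affine (c *+ j) (oner_neq0 L) Xat.
  by congr atom; apply/funext => x; rewrite /T mul1r.
(* Each of the [r + 1] translates meets one of the [r] covering sets in a set that is not small. Two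
   translates share such a covering set and, all three being atoms, agree modulo [I]. *)
have /choice[p pP] : forall j : 'I_r.+1, exists p,
    p \in s /\ ~ small I (fun x => T j x /\ X (p.1 * x + p.2)).
  move=> j; apply: contrapT => nex; have [_ nTj _] := T_atom j; apply: nTj.
  have H : small I (fun x => exists2 p, p \in s & T j x /\ X (p.1 * x + p.2)).
    by apply: small_seq => p ps; apply: contrapT => np; apply: nex; exists p.
  apply: small_sub (small_union IZ H) => x Tx.
  by case: (Zs x) => [|[p ps Xp]]; [left | right; exists p].
have [j [k [ltjk pjk]]] : exists j k : 'I_r.+1, (j < k)%N /\ p j = p k.
  have : ~~ injectiveb p.
    apply/negP => /injectiveP pinj.
    have : (size (map p (enum 'I_r.+1)) <= size s)%N.
      apply: uniq_leq_size; first by rewrite map_inj_uniq ?enum_uniq.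
      by move=> _ /mapP[i _ ->]; case: (pP i).
    by rewrite size_map size_enum_ord ltnn.
  case/injectivePn => j [k njk pjk].
  have [ltjk|ltkj|/val_inj jk] := ltngtP j k; first by exists j, k.
    by exists k, j.
  by rewrite jk eqxx in njk.
have H1 : small I (fun x => T j x /\ ~ T k x).
  have [_ nj] := pP j; have [ps nk] := pP k; rewrite pjk in nj.
  have Xp_atom := atom_affine (p k).2 (s0 _ ps) Xat.
  have [_ _ /(_ (fun x => X ((p k).1 * x + (p k).2))) Tj] := T_atom j.
  have [|//|Tj'] := Tj; first by case: Xp_atom.
  have [_ _ /(_ (T k)) Xp] := Xp_atom.
  have [|Xp'|Xp'] := Xp; first by case: (T_atom k).
    by case: nk; apply: small_sub Xp' => x [].
  apply: small_sub (small_union Tj' Xp') => x [Tx nTx].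
  by case: (pselect (X ((p k).1 * x + (p k).2))); [right | left].
pose d := (k - j)%N.
have H2 : small I (fun x => X x /\ ~ T d x).
  rewrite -(small_T _ j); apply: small_sub H1 => x [Xx nTx]; split=> //.
  by apply: contra_not nTx; rewrite /T /d -addrA -mulrnDr subnKC // ltnW.
have H3 i : small I (fun x => X x /\ ~ T (d * i)%N x).
  elim: i => [|i IH].
    by apply: small_sub (small_empty I) => x [Xx]; rewrite /T muln0 mulr0n addr0; apply.
  have {}H2 := (small_T _ (d * i)%N).2 H2.
  apply: small_sub (small_union IH H2) => x [Xx nTx].
  case: (pselect (T (d * i)%N x)) => HT; [right; split=> // | by left].
  by apply: contra_not nTx; rewrite /T -addrA -mulrnDr mulnS addnC.
have dr : (d %| r`!)%N.
  by rewrite dvdn_fact // subn_gt0 ltjk /= (leq_trans (leq_subr _ _)) // -ltnS.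
have r0 : (r`!)%:R != 0 :> L by rewrite -(prednK (fact_gt0 r)).
have := H3 (r`! %/ d)%N; rewrite mulnC divnK //.
by apply: small_sub => x; rewrite /T /c -[_ *+ _]mulr_natr divfK.
Qed.

(** [H] is not small, since finitely many multiples of it cover everything but 0; so some atom [X]
    lies inside [H]. Translation by [b] moves only a small part of [X] out of [X], hence some [t] in
    [X] has all the [t + b] in [X]. *)
Lemma thick (H : L -> Prop) (z : seq L) :
  def1 H -> {in z, forall a, a != 0} ->
  (forall x, x != 0 -> exists2 a, a \in z & H (a * x)) ->
  forall s : seq L, exists t, H t /\ {in s, forall b, H (t + b)}.
Proof.
move=> DH z0 Hz s.
(* If it were not small, this singleton would be an atom, but translation by 1 takes it off
   itself. *)
have small0 : small I (fun x => x = 0).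
  apply: contrapT => n0.
  have at0 : atom (fun x => x = 0).
    split=> //; first exact: tame_cst.
    move=> Y _; case: (pselect (Y 0)) => Y0; [right | left];
      by apply: small_sub (small_empty I) => x [->].
  apply: n0; apply: small_sub (atom_translate 1 at0) => x ->.
  by split=> //; rewrite add0r; apply/eqP; rewrite oner_neq0.
have nH : ~ small I H.
  move=> IH; apply: I_proper.
  have IzH : small I (fun x => exists2 a, a \in z & H (a * x)).
    apply: small_seq => a /z0 a0; apply: small_sub (small_affine 0 a0 IH) => x.
    by rewrite addr0.
  apply: small_sub (small_union small0 IzH) => x _.
  by have [|/Hz] := eqVneq x 0; [left | right].
have [X Xat XH] := exists_atom DH nH.
have Is : small I (fun x => exists2 b, b \in s & X x /\ ~ X (x + b)).
  by apply: small_seq => b _; apply: atom_translate.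
have [_ nX _] := Xat; apply: contrapT => nt; apply: nX.
apply: small_sub Is => x Xx; apply: contrapT => nb; apply: nt.
exists x; split; first exact: XH.
move=> b bs; apply: XH; apply: contrapT => nXb; apply: nb.
by exists b.
Qed.

End Ideal.

(** * Multiplicative subgroups of finite index *)

Section FiniteIndex.

Variables (H : L -> Prop) (z : seq L).
Hypothesis H1 : H 1.
Hypothesis H_neq0 : forall x, H x -> x != 0.
Hypothesis H_div : forall x y, H x -> H y -> H (x / y).
Hypothesis H_def : def1 H.
Hypothesis z_neq0 : {in z, forall a, a != 0}.
Hypothesis H_cover : forall x, x != 0 -> exists2 a, a \in z & H (a * x).

Lemma finite_index_inv x : H x -> H x^-1.
Proof. by rewrite -div1r; apply: H_div. Qed.

Lemma finite_index_mul x y : H x -> H y -> H (x * y).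
Proof. by move=> Hx /finite_index_inv; rewrite -{2}[y]invrK; apply: H_div. Qed.

Variable c : L.
Hypotheses (c_neq0 : c != 0) (Hc : ~ H c).

Let w (b : bool) : L := if b then 1 else c.

Let w_neq0 (b : bool) : w b != 0. Proof. by case: b; rewrite ?oner_neq0. Qed.

(** For [u = t^-1] the quotient [(x + w b * u) / x] equals [u * (t + w b / x)], so it is enough that
    [H] contains [t] and the finitely many [t + w b / x], which is what [thick] gives. *)
Lemma exists_infinitesimal (s : seq L) : {in s, forall t, t != 0} ->
  exists u, H u /\ {in s, forall t, forall b : bool, H ((t + w b * u) / t)}.
Proof.
move=> s0; have [I [Iproper Imax]] := exists_maximal_ideal.
have [t [Ht tP]] := thick Iproper Imax H_def z_neq0 H_cover
  [seq w b / x | x <- s, b : bool <- [:: true; false]].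
exists t^-1; split=> [|x xs b]; first exact: finite_index_inv.
have t0 := H_neq0 Ht; have x0 := s0 x xs.
rewrite (_ : _ / x = t^-1 * (t + w b / x)); last first.
  by field; rewrite t0 x0.
apply: finite_index_mul; first exact: finite_index_inv.
by apply: tP; apply: allpairs_f => //; rewrite !inE; case: b.
Qed.

(* If [c] is not in [H], choose [u_0, u_1, ...] in [H], each infinitesimal with
   respect to the previous ones.  Then [y - sum_(i < n) w_i u_i] lies in [w_n H]
   for [y = sum_i w_i u_i] with digits [w_i] in [{1, c}], and these conditions
   on [y] form a splitting tree. *)
Lemma finite_index_false : False.
Proof.
have /choice[f fP] : forall s : seq L, exists u, {in s, forall t, t != 0} ->
    H u /\ {in s, forall t, forall b : bool, H ((t + w b * u) / t)}.
  move=> s; case: (pselect {in s, forall t, t != 0}) => [/exists_infinitesimal[u uP]|ns].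
    by exists u.
  by exists 0.
(* [S n] collects all sums of consecutive terms [w_i * u_i] with [i < n], for all digits; [u n] is
   infinitesimal with respect to each of them. *)
pose next s := s ++ [seq t + w b * f s | t <- s, b : bool <- [:: true; false]]
                 ++ [:: f s; c * f s].
pose S n := iter n next [::]; pose u n := f (S n).
have SS n : S n.+1 = S n ++ [seq t + w b * u n | t <- S n, b : bool <- [:: true; false]]
    ++ [:: u n; c * u n] by [].
have S0 n : {in S n, forall t, t != 0}.
  elim: n => [|n IH] //= t; have [Hu uP] := fP _ IH.
  rewrite !mem_cat => /or3P[/IH//|/allpairsP[[x b] /= [xs _ ->]]|].
    by have := H_neq0 (uP x xs b); rewrite mulf_eq0 negb_or => /andP[].
  by rewrite !inE => /orP[] /eqP ->; rewrite ?mulf_neq0 ?(H_neq0 Hu).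
have uH n : H (u n) by case: (fP _ (S0 n)).
pose tail := fix tail k (s : seq bool) : L :=
  if s is b :: s' then w b * u k + tail k.+1 s' else 0.
have tail_rcons k s (b : bool) : tail k (rcons s b) = tail k s + w b * u (k + size s)%N.
  elim: s k => [|a s IH] k /=; first by rewrite addn0 addr0 add0r.
  by rewrite IH addrA addSnnS.
have tailP k (b : bool) s : tail k (b :: s) \in S (k + size s).+1 /\ H (tail k (b :: s) / w b).
  elim/last_ind: s => [|s a [IH1 IH2]].
    rewrite /= addr0 addn0 !mem_cat !inE mulrC mulfK //; split=> //.
    by rewrite /w; case: b; rewrite ?mulr1 ?[u k * c]mulrC eqxx ?orbT.
  rewrite -rcons_cons tail_rcons size_rcons /= addnS.
  have [_ /(_ _ IH1 a) Ha] := fP _ (S0 (k + size s).+1); split.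
    rewrite SS !mem_cat; apply/orP; right; apply/orP; left.
    apply/allpairsP; exists (tail k (b :: s), a); split=> //.
    by rewrite !inE; case: (a).
  have := finite_index_mul IH2 Ha.
  by rewrite mulrC mulrA divfK // (S0 _ _ IH1).
pose X := fix X k p (s : seq bool) (y : L) : Prop :=
  if s is b :: s' then H ((y - p) / w b) /\ X k.+1 (p + w b * u k) s' y else True.
apply: (@tame_tree _ _ tD 1 (fun s e => X 0%N 0 s (e 0%N))).
- move=> s; move: {1}0%N (0 : L); elim: s => [|b s IH] k p /=.
    exact: tame_prop.
  have DH : D (fun e => H ((e 0%N - p) / w b)).
    have := def1_affine (w b)^-1 (- p / w b) H_def.
    by apply: tame_ext => e; rewrite mulrBl [e 0%N / _]mulrC mulNr.
  exact: (tame_and tD DH (IH k.+1 (p + w b * u k))).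
- by move=> s e e' /(_ 0%N isT) ->.
split=> [s|s b e|s e].
- exists (fun=> 0 + tail 0%N s); move: 0%N (0 : L).
  elim: s => [|b s IH] k p //=; split; last first.
    by rewrite addrA; apply: IH.
  by rewrite addrC addKr; case: (tailP k b s).
- move: (e 0%N) => y; move: 0%N (0 : L); elim: s => [|a s IH] k p //= [? ?]; split=> //; exact: IH.
- move: (e 0%N) => y; move: 0%N (0 : L); elim: s => [|a s IH] k p /=; last first.
    by move=> [_ ?] [_ ?]; apply: (IH k.+1 (p + w a * u k)).
  rewrite /w divr1 => -[Hp _] [Hpc _]; apply: Hc.
  have := H_div Hp Hpc; rewrite invf_div mulrCA divff ?mulr1 //.
  exact: H_neq0 Hp.
Qed.

End FiniteIndex.

(** Distinct roots are collected one at a time: either the list becomes complete or it reaches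
    [n + 1] members, too many for a field. *)
Lemma finitely_many_unity_roots n : (0 < n)%N ->
  exists s : seq L, forall x, x ^+ n = 1 <-> x \in s.
Proof.
move=> n0.
suff [[s sP]|[s [s1 s2 /eqP s3]]] : (exists s : seq L, forall x, x ^+ n = 1 <-> x \in s) \/
    exists s : seq L, [/\ uniq s, all n.-unity_root s & size s == n.+1].
- by exists s.
- by have := max_unity_roots n0 s2 s1; rewrite s3 ltnn.
elim: n.+1 => [|k [|[s [s1 s2 /eqP s3]]]]; [by right; exists [::] | by left |].
case: (pselect (exists x, x ^+ n = 1 /\ x \notin s)) => [[x [xn xs]]|nx].
  right; exists (x :: s); rewrite /= xs s1 s3; split=> //.
  by rewrite unity_rootE xn eqxx.
left; exists s => x; split=> [xn|xs].
  by apply: contrapT => /negP nxs; apply: nx; exists x.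
by apply/eqP; rewrite -unity_rootE (allP s2).
Qed.

(* The chain of the groups of [q^n]-th powers stabilises at a subgroup of finite
   index of the multiplicative group. *)
Lemma tame_field_roots q (y : L) : (0 < q)%N -> exists x, x ^+ q = y.
Proof.
move=> q0.
(* Otherwise the groups of [q ^ n]-th powers of nonzero elements decrease strictly forever, and
   multiplication by [a n ^+ (q ^ n)] separates consecutive ones. *)
have [N NP] : exists N, forall x, x != 0 ->
    exists2 t, t != 0 & x ^+ (q ^ N) = t ^+ (q ^ N.+1).
  apply: contrapT => nN.
  have /choice[a aP] : forall n, exists x, x != 0 /\
      forall t, t != 0 -> x ^+ (q ^ n) <> t ^+ (q ^ n.+1).
    move=> n; apply: contrapT => na; apply: nN; exists n => x x0.
    apply: contrapT => nt; apply: na; exists x; split=> // t t0 xt.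
    by apply: nt; exists t.
  have a0 n : a n ^+ (q ^ n) != 0 by rewrite expf_neq0 //; case: (aP n).
  apply: (@no_chain_of_maps _ D
     (fun n x => exists t, t != 0 /\ x = t ^+ (q ^ n)) (fun n x => a n ^+ (q ^ n) * x)) => //.
  - move=> n; apply: (tame_ex tD (X := fun e t => t != 0 /\ e 0%N = t ^+ (q ^ n))).
    apply: tame_and => //.
      apply: tame_ext (tame_not tD (tame_cst tD 0)) => e.
      by split=> /eqP.
    by apply: (tame_eq_fun tD); [exact: tame_fun_var | apply: tame_fun_exp; exact: tame_fun_var].
  - move=> n; apply: tame_fun_mul; [exact: tame_fun_cst | exact: tame_fun_var].
  - by move=> n x x' /(mulfI (a0 n)).
  - by move=> n; exists 1, 1; rewrite oner_neq0 expr1n.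
  - move=> n _ [t [t0 ->]]; split.
      by exists (t ^+ q); rewrite expf_neq0 // -exprM expnS.
    exists (a n * t ^+ q); rewrite exprMn -exprM expnS mulf_neq0 ?expf_neq0 //.
    by case: (aP n).
  - move=> n _ _ [t [t0 ->]] [t' [t0' ->]].
    move=> E; case: (aP n) => _ /(_ (t' / t)); apply.
      by rewrite mulf_neq0 ?invr_eq0.
    by rewrite expr_div_n -E mulfK // expf_neq0.
have [->|y0] := eqVneq y 0; first by exists 0; rewrite expr0n gtn_eqF.
pose M := (q ^ N)%N; pose H x := exists t, t != 0 /\ x = t ^+ M.
have M0 : (0 < M)%N by rewrite expn_gt0 q0.
have NjP j x : x != 0 -> exists2 t, t != 0 & x ^+ M = t ^+ (M * q ^ j).
  move=> x0; elim: j => [|j [t t0 ->]]; first by exists x; rewrite ?muln1.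
  have [t' t'0 E] := NP t t0; exists t' => //.
  by rewrite exprM E -exprM /M !expnS; congr (_ ^+ _); ring.
have [s sP] := finitely_many_unity_roots M0.
(* By [NjP] the element [x ^+ M] is also the [M]-th power of some [t ^+ M], so that [t ^+ M / x] is
   an [M]-th root of unity: the finitely many roots of unity carry every nonzero [x] into [H]. *)
have Hy : H y.
  apply: contrapT; apply: (@finite_index_false H s).
  - by exists 1; rewrite oner_neq0 expr1n.
  - by move=> _ [t [t0 ->]]; rewrite expf_neq0.
  - move=> _ _ [t [t0 ->]] [t' [t0' ->]]; exists (t / t').
    by rewrite mulf_neq0 ?invr_eq0 // expr_div_n.
  - apply: (tame_ex tD (X := fun e t => t != 0 /\ e 0%N = t ^+ M)).
    apply: tame_and => //.
      apply: tame_ext (tame_not tD (tame_cst tD 0)) => e.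
      by split=> /eqP.
    by apply: (tame_eq_fun tD); [exact: tame_fun_var | apply: tame_fun_exp; exact: tame_fun_var].
  - move=> a /sP aM; apply/eqP => a0; move/eqP: aM.
    by rewrite a0 expr0n gtn_eqF // eq_sym oner_eq0.
  - move=> x x0; have [t t0 E] := NjP N x x0; exists (t ^+ M / x).
      by apply/sP; rewrite expr_div_n -exprM -E divff // expf_neq0.
    by rewrite divfK //; exists t.
  - exact: y0.
case: Hy => t [t0 ->]; have [t' t'0 ->] := NP t t0.
by exists (t' ^+ M); rewrite -exprM expnSr.
Qed.

End TameField.

(** * Tame fields are algebraically closed *)

Definition tame_ring (A : nzRingType) (D : ((nat -> A) -> Prop) -> Prop) : Prop :=
  [/\ tame D, D (fun e => e 0%N + e 1%N = e 2%N)
    & D (fun e => e 0%N * e 1%N = e 2%N)].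

Definition tame_field (F : fieldType) : Prop :=
  (forall n, n.+1%:R != 0 :> F) /\ exists D, @tame_ring F D.

(** [L] is interpreted in [K] by coordinates in a basis, with the structure constants as
    parameters. *)
Lemma tame_field_ext (K : fieldType) (L : fieldExtType K) :
  tame_field K -> tame_field L.
Proof.
move=> [K0 [D [tD D_add D_mul]]].
split=> [n|]; first by rewrite -(rmorph_nat (in_alg L)) fmorph_eq0.
(* The tuples of an interpretation have length [m.+1]. *)
set m := (\dim {:L}).-1.
have dimL : m.+1 = \dim {:L} by rewrite prednK // adim_gt0.
pose b (i : 'I_m.+1) : L := (vbasis {:L})`_i.
pose co (x : L) (i : 'I_m.+1) : K := coord (vbasis {:L}) (cast_ord dimL i) x.
pose pi (v : 'I_m.+1 -> K) : L := \sum_i v i *: b i.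
have coK v : co (pi v) = v.
  apply/funext => i; rewrite /co /pi.
  rewrite (reindex (cast_ord (esym dimL))) /=; last first.
    by exists (cast_ord dimL) => j _; apply: val_inj.
  rewrite coord_sum_free ?cast_ordK ?basis_free ?vbasisP //.
  exact: basis_free (vbasisP _).
have piK x : pi (co x) = x.
  rewrite {2}[x](coord_vbasis (memvf x)) /pi.
  rewrite (reindex (cast_ord (esym dimL))) /=; last first.
    by exists (cast_ord dimL) => j _; apply: val_inj.
  apply: eq_bigr => j _; congr (coord _ _ _ *: _); exact: val_inj.
have pi_inj v w : pi v = pi w -> v = w by move=> /(congr1 co); rewrite !coK.
have pi_surj x : exists v, pi v = x by exists (co x).
have var (i : nat) (j : 'I_m.+1) : tame_fun D (fun e => block e i j).
  exact: tame_fun_var.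
exists (pullback D pi); split.
- apply: tame_interpretation => //.
  have DX : D (fun e => forall j, block (m := m) e 0 j = block e 1 j).
    by apply: tame_all_ord => // j; apply: tame_eq_fun.
  rewrite /pullback; apply: tame_ext DX => e /=; split=> [H|/pi_inj H j]; first by congr pi; apply/funext.
  exact: (congr1 (fun f => f j) H).
- have DX : D (fun e => forall j, block (m := m) e 0 j + block e 1 j = block e 2 j).
    by apply: tame_all_ord => // j; apply: tame_eq_fun => //; apply: tame_fun_add.
  have piD v w : pi v + pi w = pi (fun i => v i + w i).
    by rewrite -big_split; apply: eq_bigr => i _; rewrite scalerDl.
  rewrite /pullback; apply: tame_ext DX => e /=; rewrite piD; split=> [H|/pi_inj H j]; first by congr pi; apply/funext.
  exact: (congr1 (fun f => f j) H).
- have DX : D (fun e => forall k,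
     \sum_i \sum_j block (m := m) e 0 i * block e 1 j * co (b i * b j) k = block e 2 k).
    apply: tame_all_ord => // k; apply: tame_eq_fun => //.
    do 2!apply: tame_fun_sum => // ?; apply: tame_fun_mul => //.
      exact: tame_fun_mul.
    exact: tame_fun_cst.
  have piM v w : pi v * pi w = pi (fun k => \sum_i \sum_j v i * w j * co (b i * b j) k).
    rewrite mulr_suml /pi; under [RHS]eq_bigr do rewrite scaler_suml.
    rewrite exchange_big; apply: eq_bigr => i _ /=.
    rewrite mulr_sumr; under [RHS]eq_bigr do rewrite scaler_suml.
    rewrite exchange_big; apply: eq_bigr => j _ /=.
    rewrite -scalerAl -scalerAr scalerA -{1}[b i * b j]piK scaler_sumr.
    by apply: eq_bigr => k _; rewrite scalerA.
  rewrite /pullback; apply: tame_ext DX => e /=; rewrite piM; split=> [H|/pi_inj H j]; first by congr pi; apply/funext.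
  exact: (congr1 (fun f => f j) H).
Qed.

Lemma tame_field_rootX (F : fieldType) q (y : F) :
  tame_field F -> (0 < q)%N -> exists x, x ^+ q = y.
Proof. by move=> [F0 [D [tD D_add D_mul]]]; exact: tame_field_roots D_mul F0 _ _. Qed.

Lemma splits_of_roots (F : fieldType) n :
  (forall p : {poly F}, (1 < size p <= n)%N -> exists x, root p x) ->
  forall p : {poly F}, (0 < size p <= n)%N ->
    exists s : seq F, p %= \prod_(z <- s) ('X - z%:P).
Proof.
move=> roots p; have [k] := ubnP (size p); elim: k p => // k IH p ltpk /andP[p0 pn].
have [p1|p1] := leqP (size p) 1.
  by exists [::]; rewrite big_nil -size_poly_eq1 eqn_leq p1.
have [|x /factor_theorem[q pE]] := roots p; first by rewrite p1.
have q0 : q != 0 by apply: contraTneq p0 => q0; rewrite pE q0 mul0r size_poly0.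
have szp : size p = (size q).+1 by rewrite pE size_Mmonic ?monicXsubC // size_XsubC addn2.
have [||s qs] := IH q; first by rewrite -ltnS -szp.
  by rewrite size_poly_gt0 q0 /= (leq_trans _ pn) // szp.
by exists (x :: s); rewrite big_cons pE mulrC eqp_mull.
Qed.

Lemma irreducible_of_no_root (F : fieldType) (p : {poly F}) :
  (forall q : {poly F}, (1 < size q < size p)%N -> exists x, root q x) ->
  (1 < size p)%N -> (forall x, ~~ root p x) -> irreducible_poly p.
Proof.
move=> roots p1 noroot; split=> // q q1 qp.
have p0 : p != 0 by rewrite -size_poly_gt0 ltnW.
have q0 : q != 0 by apply: contraTneq qp => ->; rewrite dvd0p.
rewrite -dvdp_size_eqp // eqn_leq dvdp_leq //= leqNgt; apply/negP => qltp.
have [|x rx] := roots q.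
  by rewrite qltp ltn_neqAle eq_sym q1 size_poly_gt0 q0.
by have := noroot x; rewrite (root_dvdp qp).
Qed.

Lemma irreducible_separable (F : fieldType) (p : {poly F}) :
  (forall n, n.+1%:R != 0 :> F) -> irreducible_poly p -> separable_poly p.
Proof.
move=> F0 irr; have [p1 _] := irr; rewrite separable_poly.unlock.
have p'0 : p^`() != 0.
  have [k Ek] : exists k, size p = k.+2.
    by case: (size p) p1 => [|[|k]] // _; exists k.
  apply/eqP => /(congr1 (fun r : {poly F} => r`_k)).
  rewrite coef_deriv coef0 => /eqP; rewrite -mulr_natr mulf_eq0 (negPf (F0 _)) orbF.
  have := lead_coef_eq0 p; rewrite /lead_coef Ek /= => ->.
  by rewrite (negPf (irredp_neq0 irr)).
have [|] := irredp_XsubCP irr (dvdp_gcdl p p^`()); first by rewrite gcdp_eqp1.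
move=> /eqp_dvdl H; have := dvdp_gcdr p p^`(); rewrite H => /(dvdp_leq p'0).
by rewrite leqNgt lt_size_deriv ?irredp_neq0.
Qed.

(** Cauchy's theorem gives an automorphism [x] of order [q], so that [N] is cyclic of degree [q]
    over the fixed field [E] of [x]. As [E] contains a root of unity [z] of order [q], Hilbert 90
    gives [b] with [x b = b / z], and [b ^+ q] lies in [E]. The tame field [E] has [q]-th roots, so
    [b] is in [E] too and is fixed by [x], a contradiction. *)
Lemma kummer_step (F : fieldType) (N : splittingFieldType F) (q : nat) :
  tame_field F -> galois 1 {:N} -> prime q -> (q %| #|'Gal({:N} / 1)%g|)%N ->
  (forall (E : fieldExtType F) (p : {poly E}),
     (1 < size p <= q)%N -> exists x, root p x) -> False.
Proof.
move=> tF galN q_pr q_dvd roots; have [F0 _] := tF.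
have /(Cauchy q_pr)[x _ ox]  := q_dvd.
pose E := [aspace of fixedField <[x]>%g].
have galE : 'Gal({:N} / E)%g = <[x]>%g by rewrite gal_fixedField.
have tE := tame_field_ext (subvs_of E) tF.
have [z [Ez zq z1]] : exists z : N, [/\ z \in E, z ^+ q = 1 & z != 1].
  (* The polynomial is [1 + X + ... + X^(q-1)], of size exactly [q]; its roots are the [q]-th roots
     of unity other than 1, since [q] is not 0 in [E]. *)
  have [|z rz] := roots (subvs_of E) (\poly_(i < q) 1).
    by rewrite size_poly_eq ?oner_eq0 // prime_gt1 /=.
  have sz : \sum_(i < q) z ^+ i = 0.
    by move/rootP: rz; rewrite horner_poly; under eq_bigr do rewrite mul1r.
  exists (val z); split; first exact: subvsP.
    have zq : z ^+ q = 1 by apply/eqP; rewrite -subr_eq0 subrX1 sz mulr0.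
    by have := rmorphXn (@vsval _ _ E) q z; rewrite zq rmorph1 => <-.
  apply/eqP => z1; move: sz; rewrite (_ : z = 1); last first.
    by apply: val_inj; rewrite z1; exact/esym/(rmorph1 (@vsval _ _ E)).
  under eq_bigr do rewrite expr1n.
  rewrite sumr_const card_ord => /eqP; apply/negP.
  by rewrite -(prednK (prime_gt0 q_pr)) -(rmorph_nat (in_alg (subvs_of E))) fmorph_eq0.
have normz : galNorm E {:N} z == 1.
  rewrite /galNorm (eq_bigr (fun=> z)) => [|g gE]; last exact: fixed_gal (subvf E) gE Ez.
  by rewrite prodr_const galE -orderE ox zq.
have genx : generator 'Gal({:N} / E)%g x by rewrite galE /generator.
have [b [_ b0] zb] := elimT (Hilbert's_theorem_90 genx (memvf z)) normz.
have xb0 : x b != 0 by rewrite fmorph_eq0.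
have xb : x b = b / z by rewrite zb invf_div mulrCA divff ?mulr1.
have Ebq : b ^+ q \in E.
  apply/fixedFieldP => [|g]; first exact: memvf.
  move=> /cycleP[i ->]; elim: i => [|i IH]; first by rewrite expg0 gal_id.
  by rewrite expgSr galM ?memvf // IH rmorphXn /= xb expr_div_n zq divr1.
have [c cq] := tame_field_rootX (Sub (b ^+ q) Ebq : subvs_of E) tE (prime_gt0 q_pr).
have {}cq : vsval c ^+ q = b ^+ q by rewrite -(rmorphXn (@vsval _ _ E)) cq.
have c0 : vsval c != 0 
  by apply: contraNneq b0 => c0; move: (expf_eq0 b q); rewrite -cq c0 expr0n gtn_eqF ?prime_gt0 // eqxx /= => <-.
have [m m_prim m_dvd] := prim_order_exists (prime_gt0 q_pr) zq.
have {m_dvd} mq : m = q.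
  have [_ /(_ _ m_dvd)/orP[|/eqP//]] := primeP q_pr; move=> /eqP m1.
  by move: (prim_expr_order m_prim); rewrite m1 expr1 => /eqP; rewrite (negPf z1).
rewrite mq in m_prim.
have [i bcE] : {i : 'I_q | b / vsval c = z ^+ i}.
  by apply: (prim_rootP m_prim); rewrite expr_div_n cq divff // expf_neq0.
have Eb : b \in E by rewrite -(divfK c0 b) bcE rpredM ?rpredX ?subvsP.
have : x b = b by apply: (fixed_gal (subvf E)) Eb; rewrite galE cycle_id.
by move=> xbb; move/eqP: z1; apply; rewrite zb xbb divff.
Qed.
(* With [p] of least degree among the polynomials without a root over some tame
   field, adjoining one root of [p] already splits it, so that the extension is
   Galois; a subextension of prime degree [q] is then a Kummer extension, the
   [q]-th roots of unity being roots of a polynomial of smaller degree. *)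
Lemma tame_field_root n (F : fieldType) (p : {poly F}) :
  tame_field F -> (1 < size p <= n)%N -> exists x, root p x.
Proof.
elim: n F p => [|n IH] F p tF /andP[p1 pn]; first by rewrite leqn0 -leqn0 leqNgt (ltnW p1) in pn.
apply: contrapT => noroot.
have [lepn|ltnp] := leqP (size p) n; first by apply: noroot; apply: IH; rewrite ?p1.
have {pn ltnp} szp : size p = n.+1 by apply/eqP; rewrite eqn_leq pn.
have p2 : (2 < size p)%N.
  rewrite ltnNge; apply: contra_notN noroot => p2.
  by have /poly2_root[x rx] : size p = 2; [apply/eqP; rewrite eqn_leq p2 | exists x].
have irr : irreducible_poly p.
  apply: irreducible_of_no_root => // [q|x]; last by apply/negP => rx; apply: noroot; exists x.
  by rewrite szp ltnS => qs; exact: IH.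
have [F0 _] := tF.
have [L dimL [a pa genL]] := irredp_FAdjoin irr.
have tL := tame_field_ext L tF.
set pL := map_poly _ p in pa.
have [s ps] : exists s : seq L, pL %= \prod_(z <- a :: s) ('X - z%:P).
  have [r pE] := factor_theorem _ _ pa.
  have r0 : r != 0.
    by apply: contraTneq p1 => r0; rewrite -(size_map_poly (in_alg L)) -/pL pE r0 mul0r size_poly0.
  have rn : (0 < size r <= n)%N.
    rewrite size_poly_gt0 r0 /= -ltnS -szp -(size_map_poly (in_alg L) p) -/pL pE.
    by rewrite size_Mmonic ?monicXsubC // size_XsubC addn2.
  have [s rs] := splits_of_roots (fun r' => IH L r' tL) rn.
  by exists s; rewrite big_cons pE mulrC eqp_mul2l ?polyXsubC_eq0.
have splitL : splitting_field_axiom L.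
  exists pL; first exact: alg_polyOver.
  exists (a :: s) => //; rewrite adjoin_cons genL.
  by apply/eqP; rewrite eqEsubv subvf subv_adjoin_seq.
have [N dimN galN] : exists2 N : splittingFieldType F, \dim {:N} = n & galois 1 {:N}.
  exists (HB.pack (FieldExt.sort L) (FieldExt_isSplittingField.Build F L splitL) : splittingFieldType F).
    by rewrite -[n]/n.+1.-1 -szp -dimL.
  apply/splitting_galoisField; exists pL; split.
  - exact: alg_polyOver.
  - by rewrite separable_map; apply: irreducible_separable.
  - exists (a :: s) => //; rewrite adjoin_cons genL.
    by apply/eqP; rewrite eqEsubv subvf subv_adjoin_seq.
have cardG : #|'Gal({:N} / 1)%g| = n.
  by rewrite -(galois_dim galN) dimv1 divn1.
have n1 : (1 < n)%N by rewrite -ltnS -szp.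
have [q q_pr qn] : exists2 q, prime q & (q %| n)%N.
  by exists (pdiv n); rewrite ?pdiv_prime ?pdiv_dvd.
have leqn : (q <= n)%N by rewrite dvdn_leq // ltnW.
apply: (kummer_step tF galN q_pr); first by rewrite cardG.
by move=> E q' /andP[q'1 q'q]; apply: IH; [exact: tame_field_ext | rewrite q'1 (leq_trans q'q)].
Qed.

(** * Closed subfields of tame local rings *)

(** [k] is [F] itself with more structure: a closed field is in particular a decidable field, and
    excluded middle decides the formulas over [F]. *)
Lemma closed_field_of_roots (F : fieldType) :
  (forall n, n.+1%:R != 0 :> F) ->
  (forall p : {poly F}, (1 < size p)%N -> exists x, root p x) ->
  exists (k : closedFieldType) (f : k -> F),
    [/\ [pchar k] =i pred0, {morph f : x y / x + y}, {morph f : x y / x * y} & f 1 = 1].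
Proof.
move=> F0 roots; pose sat (e : seq F) f := `[< GRing.holds e f >].
have satP : GRing.decidable_field_axiom sat by move=> e f; apply: asboolP.
pose dF : decFieldType := HB.pack (GRing.Field.sort F) (GRing.Field_isDecField.Build F satP).
have closed : GRing.closed_field_axiom dF.
  move=> n P n0; pose q : {poly F} := \poly_(i < n) P i.
  have szq : (size q < size ('X^n : {poly F}))%N by rewrite size_polyXn ltnS size_poly.
  have [|x] := roots ('X^n - q).
    by rewrite size_polyDl ?size_polyN // size_polyXn ltnS.
  rewrite /root hornerD hornerN hornerXn subr_eq0 => /eqP xn.
  by exists x; rewrite xn horner_poly.
pose k : closedFieldType := HB.pack (GRing.DecidableField.sort dF) (GRing.DecField_isAlgClosed.Build dF closed).
exists k, id; split=> // p; rewrite !inE; apply/negP => /andP[p_pr].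
by rewrite -(prednK (prime_gt0 p_pr)) (negPf (F0 _)).
Qed.

(** * Nilpotent and invertible elements *)

Section NilpotentsAndUnits.

Variable A : comNzRingType.
Implicit Types a b x y : A.

Definition nilpotent_elt a : Prop := exists n, a ^+ n = 0.
Definition invertible_elt a : Prop := exists b, a * b = 1.

Lemma nilpotent_mul a b : nilpotent_elt a -> nilpotent_elt (a * b).
Proof. by move=> [n an]; exists n; rewrite exprMn an mul0r. Qed.

Lemma invertible_mul a b :
  invertible_elt (a * b) <-> invertible_elt a /\ invertible_elt b.
Proof.
split=> [[c abc]|[[c ac] [d bd]]].
  by split; [exists (b * c); rewrite mulrA | exists (a * c); rewrite mulrCA mulrA].
by exists (c * d); rewrite mulrACA ac bd mulr1.
Qed.

Lemma invertible_1B a : nilpotent_elt a -> invertible_elt (1 - a).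
Proof.
move=> [n an]; exists (\sum_(i < n) a ^+ i).
by rewrite -[LHS]opprK -mulNr opprB -subrX1 an sub0r opprK.
Qed.

Lemma nilpotent_not_invertible a : nilpotent_elt a -> ~ invertible_elt a.
Proof.
move=> [n an] [b ab]; have := oner_neq0 A.
by rewrite -(expr1n A n) -ab exprMn an mul0r eqxx.
Qed.

Lemma horner_taylor (p : {poly A}) x h :
  exists r, p.[x + h] = p.[x] + p^`().[x] * h + h ^+ 2 * r.
Proof.
elim/poly_ind: p => [|p c [r IH]].
  by exists 0; rewrite deriv0 !horner0 mul0r mulr0 !addr0.
exists (r * (x + h) + p^`().[x]).
rewrite derivD derivM derivC derivX !hornerE IH; ring.
Qed.

Lemma horner_nilpotent (p : {poly A}) x y :
  nilpotent_elt (x - y) -> nilpotent_elt (p.[x] - p.[y]).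
Proof.
move=> nxy; have [r] := horner_taylor p y (x - y).
rewrite subrKC => ->.
rewrite (_ : _ - _ = (x - y) * (p^`().[y] + (x - y) * r)); last by ring.
exact: nilpotent_mul.
Qed.

End NilpotentsAndUnits.

(** * Maximal subfields of a commutative ring *)

Section Subfields.

Variable A : comNzRingType.

Record subfield (S : A -> Prop) : Prop := Subfield {
  subfield1 : S 1;
  subfieldB : forall x y, S x -> S y -> S (x - y);
  subfieldM : forall x y, S x -> S y -> S (x * y);
  subfieldV : forall x, S x -> x != 0 -> exists2 y, S y & x * y = 1
}.

Section SubfieldType.

Variables (S : A -> Prop) (S_sub : subfield S).

(** The proof is an argument so that the instances declared on the predicate can recover it by
    unification. *)
Definition subfield_pred (_ : subfield S) : {pred A} := fun x => `[< S x >].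
Notation Sp := (subfield_pred S_sub).

Lemma subfield_closed : subring_closed Sp.
Proof.
split; rewrite ?unfold_in /=; first by apply/asboolP; case: S_sub.
  by move=> x y; rewrite !unfold_in => /asboolP Sx /asboolP Sy; apply/asboolP; apply: subfieldB.
by move=> x y; rewrite !unfold_in => /asboolP Sx /asboolP Sy; apply/asboolP; apply: subfieldM.
Qed.

HB.instance Definition _ := GRing.isSubringClosed.Build A Sp subfield_closed.

Record subfield_type := SubfieldElt { subfield_val : A; _ : subfield_val \in Sp }.

HB.instance Definition _ := [isSub for subfield_val].
HB.instance Definition _ := [Choice of subfield_type by <:].
HB.instance Definition _ := [SubChoice_isSubComNzRing of subfield_type by <:].

Lemma subfield_inv_ex (x : subfield_type) :
  exists y : subfield_type, (x != 0 -> y * x = 1) /\ (x = 0 -> y = 0).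
Proof.
have [->|x0] := eqVneq x 0; first by exists 0; split=> //; rewrite eqxx.
have Sx : S (val x) by apply/asboolP; case: x {x0}.
have [|y Sy xy] := subfieldV S_sub Sx.
  by apply: contra x0 => /eqP x0; apply/eqP/val_inj; rewrite x0 rmorph0.
have Sy' : y \in Sp by apply/asboolP.
exists (SubfieldElt Sy'); split=> [_|x0']; last by rewrite x0' eqxx in x0.
by apply: val_inj; rewrite rmorphM rmorph1 /= mulrC.
Qed.

Definition subfield_inv (x : subfield_type) : subfield_type :=
  sval (cid (subfield_inv_ex x)).

Lemma subfield_mulVf x : x != 0 -> subfield_inv x * x = 1.
Proof. by rewrite /subfield_inv; case: cid => y []. Qed.

Lemma subfield_inv0 : subfield_inv 0 = 0.
Proof. by rewrite /subfield_inv; case: cid => y [_ /=]; apply. Qed.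

HB.instance Definition _ :=
  GRing.ComNzRing_isField.Build subfield_type subfield_mulVf subfield_inv0.

End SubfieldType.

(** When every polynomial over [S] takes at [x] the value 0 or an invertible value, the fractions of
    these values form a subfield containing [S] and [x]; by maximality [x] already belongs to
    [S]. *)
Lemma exists_maximal_subfield (S0 : A -> Prop) : subfield S0 ->
  exists (S : fieldType) (f : {rmorphism S -> A}), forall x,
    (forall p : {poly S}, (map_poly f p).[x] = 0 \/ invertible_elt (map_poly f p).[x]) ->
    exists s, x = f s.
Proof.
move=> sub0.
have [F FP totF|S [SP Smax]] :=
    @Zorn_bigcup _ [set S : set A | S = set0 \/ subfield S].
  have [[S1 FS1 sub1]|noS] := pselect (exists2 S, F S & subfield S); last first.
    left; apply/seteqP; split=> // x [S FS Sx].
    by case: (FP S FS) => [S0'|subS]; [rewrite S0' in Sx | case: noS; exists S].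
  have common x y : (\bigcup_(S in F) S)%classic x -> (\bigcup_(S in F) S)%classic y ->
      exists S, [/\ F S, subfield S, S x & S y].
    move=> [S FS Sx] [S' FS' S'y].
    have sub (B : set A) z : F B -> B z -> subfield B.
      by move=> FB Bz; case: (FP B FB) => // B0; rewrite B0 in Bz.
    have [SS'|S'S] := totF _ _ FS FS'.
      by exists S'; split=> //; [apply: sub S'y | apply: SS'].
    by exists S; split=> //; [apply: sub Sx | apply: S'S].
  right; split.
  - by exists S1 => //; case: sub1.
  - move=> x y Fx Fy; have [S [FS subS Sx Sy]] := common _ _ Fx Fy.
    by exists S => //; apply: subfieldB.
  - move=> x y Fx Fy; have [S [FS subS Sx Sy]] := common _ _ Fx Fy.
    by exists S => //; apply: subfieldM.
  - move=> x Fx x0; have [S [FS subS Sx _]] := common _ _ Fx Fx.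
    by have [y Sy xy] := subfieldV subS Sx x0; exists y => //; exists S.
have subS : subfield S.
  case: SP => // S_empty; exfalso; apply: (Smax S0); last by right.
  by rewrite S_empty; split=> [x []|/(_ 1 (subfield1 sub0))].
pose f : {rmorphism subfield_type subS -> A} := val.
exists (subfield_type subS : fieldType), f => x xP.
pose ev (p : {poly subfield_type subS}) : A := (map_poly f p).[x].
have evM p q : ev (p * q) = ev p * ev q by rewrite /ev rmorphM hornerM.
have evB p q : ev (p - q) = ev p - ev q by rewrite /ev rmorphB hornerD hornerN.
have ev1 : ev 1 = 1 by rewrite /ev rmorph1 hornerE.
have inv1 : invertible_elt (1 : A) by exists 1; rewrite mulr1.
pose S' y := exists p q, invertible_elt (ev q) /\ y * ev q = ev p.
have subS' : subfield S'.
  split.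
  - by exists 1, 1; rewrite ev1 mulr1.
  - move=> y z [p [q [invq yq]]] [p' [q' [invq' zq']]].
    exists (p * q' - p' * q), (q * q').
    rewrite evB !evM -yq -zq'; split; last by ring.
    exact/invertible_mul.
  - move=> y z [p [q [invq yq]]] [p' [q' [invq' zq']]].
    exists (p * p'), (q * q'); rewrite !evM -yq -zq'; split; last by ring.
    exact/invertible_mul.
  - move=> y [p [q [[c qc] yq]]] y0; have [p0|[d pd]] := xP p.
      by move: y0; rewrite -[y]mulr1 -qc mulrA yq /ev p0 mul0r eqxx.
    exists (ev q * d); last by rewrite mulrA yq.
    exists q, p; split; first by exists d.
    by rewrite mulrAC -mulrA pd mulr1.
have fS (s : A) : S s -> exists t, s = f t.
  move=> Ss; have Ss' : s \in subfield_pred subS by apply/asboolP.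
  by exists (SubfieldElt Ss').
have SS' : (S `<=` S')%classic.
  move=> s /fS[t ->]; exists t%:P, 1.
  by rewrite ev1 mulr1 /ev map_polyC hornerC.
apply: fS; have S'x : S' x.
  by exists 'X, 1; rewrite ev1 mulr1 /ev map_polyX hornerX.
by apply: contrapT => nSx; apply: (Smax S'); [split=> // /(_ x S'x) | right].
Qed.

End Subfields.

(** * Local rings with nil radical *)

Section LocalRing.

Variable A : comNzRingType.
Hypothesis nil_or_inv : forall a : A, nilpotent_elt a \/ invertible_elt a.
Implicit Types a b x y : A.

Lemma not_invertible a : ~ invertible_elt a <-> nilpotent_elt a.
Proof.
split; last exact: nilpotent_not_invertible.
by case: (nil_or_inv a).
Qed.

Lemma nilpotent_add a b : nilpotent_elt a -> nilpotent_elt b -> nilpotent_elt (a + b).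
Proof.
move=> na nb; apply/not_invertible => -[c abc].
have /invertible_mul[] : invertible_elt (a * c); last by move/not_invertible: na.
rewrite (_ : a * c = 1 - b * c); first exact/invertible_1B/nilpotent_mul.
by rewrite -abc; ring.
Qed.

Lemma nilpotent_opp a : nilpotent_elt a -> nilpotent_elt (- a).
Proof. by rewrite -mulrN1; apply: nilpotent_mul. Qed.

Lemma nilpotent_addl_iff a b :
  nilpotent_elt a -> (nilpotent_elt (a + b) <-> nilpotent_elt b).
Proof.
move=> na; split=> [nab|]; last exact: nilpotent_add.
by rewrite -(addKr a b); apply: nilpotent_add => //; apply: nilpotent_opp.
Qed.

(** Newton iteration: the derivative stays invertible at [w] because [w - a] is nilpotent, and the
    Taylor remainder contains the square of [p.[w]]. One more factor [p.[a]] per step is enough,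
    [p.[a]] being nilpotent. *)
Lemma newton_root (p : {poly A}) a : nilpotent_elt p.[a] ->
  invertible_elt p^`().[a] -> exists w, nilpotent_elt (w - a) /\ p.[w] = 0.
Proof.
move=> pa p'inv; have [n pn] := pa.
suff [w [c [wa pw]]] : exists w c, nilpotent_elt (w - a) /\ p.[w] = p.[a] ^+ n.+1 * c.
  by exists w; split=> //; rewrite pw exprS pn mulr0 mul0r.
elim: {pn}n => [|n [w [c [wa pw]]]].
  by exists a, 1; rewrite subrr expr1 mulr1; split=> //; exists 1%N; rewrite expr1.
have [d p'd] : invertible_elt p^`().[w].
  case: (nil_or_inv p^`().[w]) => // nw.
  have nwa : nilpotent_elt (p^`().[a] - p^`().[w]).
    by rewrite -opprB; apply/nilpotent_opp/horner_nilpotent.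
  have := nilpotent_add nwa nw.
  by rewrite subrK => /not_invertible/(_ p'inv).
have [r pr] := horner_taylor p w (- (p.[w] * d)).
(* With [p.[w] = p.[a] ^+ n.+1 * c], the remainder [(p.[w] * d) ^+ 2 * r] is [p.[a] ^+ n.+2] times
   this cofactor. *)
exists (w - p.[w] * d), (p.[a] ^+ n * (c * d) ^+ 2 * r); split.
  rewrite addrAC; apply: nilpotent_add => //; apply/nilpotent_opp/nilpotent_mul.
  by rewrite pw exprS -mulrA; apply: nilpotent_mul.
rewrite pr mulrN mulrCA p'd mulr1 subrr add0r pw !exprS; ring.
Qed.

Variables (S : fieldType) (f : {rmorphism S -> A}).
Hypothesis S_char0 : forall n, n.+1%:R != 0 :> S.
Hypothesis S_max : forall x,
  (forall p : {poly S}, (map_poly f p).[x] = 0 \/ invertible_elt (map_poly f p).[x]) ->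
  exists s, x = f s.

Notation ev p x := (map_poly f p).[x].

Let evM p q x : ev (p * q) x = ev p x * ev q x.
Proof. by rewrite rmorphM hornerM. Qed.

Let evD p q x : ev (p + q) x = ev p x + ev q x.
Proof. by rewrite rmorphD hornerD. Qed.

Lemma subfield_invertible s : s != 0 -> invertible_elt (f s).
Proof. by move=> s0; exists (f s^-1); rewrite -rmorphM divff ?rmorph1. Qed.

Lemma subfield_nilpotent s : nilpotent_elt (f s) <-> s = 0.
Proof.
split=> [/nilpotent_not_invertible ns|->]; last by exists 1%N; rewrite rmorph0 expr1.
by apply: contrapT => /eqP/subfield_invertible.
Qed.

(** A product of values is nilpotent only if one of them is, so a proper factorisation of [p] would
    contradict minimality; [p] is irreducible, hence separable in characteristic zero. *)
Lemma nilpotent_minimal_separable (p : {poly S}) a : p != 0 ->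
  nilpotent_elt (ev p a) ->
  (forall q : {poly S}, q != 0 -> nilpotent_elt (ev q a) -> (size p <= size q)%N) ->
  separable_poly p.
Proof.
move=> p0 pa pmin.
have p1 : (1 < size p)%N.
  rewrite ltnNge; apply/negP => /size1_polyC pE; move: pa p0; rewrite pE.
  by rewrite map_polyC hornerC => /subfield_nilpotent ->; rewrite eqxx.
apply: irreducible_separable => //; split=> // q q1 /dvdpP[r pE].
have [r0 q0] : r != 0 /\ q != 0.
  by apply/andP; rewrite -negb_or -mulf_eq0 -pE.
have [rinv|nq] : invertible_elt (ev r a) /\ invertible_elt (ev q a) \/
    nilpotent_elt (ev r a) \/ nilpotent_elt (ev q a).
- case: (nil_or_inv (ev r a)) => ra; first by right; left.
  by case: (nil_or_inv (ev q a)) => qa; [right; right | left].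
- by move: pa; rewrite pE evM => /nilpotent_not_invertible; case; apply/invertible_mul.
have szp : size p = (size r + size q).-1 by rewrite pE size_mul.
case: nq => [/(pmin _ r0)|/(pmin _ q0)] leps.
  move: leps q1; rewrite szp; rewrite -!size_poly_gt0 in r0 q0; lia.
by rewrite -dvdp_size_eqp ?eqn_leq ?leps ?dvdp_leq // pE dvdp_mull.
Qed.

(* If [x] is a root modulo nilpotents of some polynomial over [S], Newton iteration
   turns it into a root of a polynomial of minimal degree; a maximal [S] contains it. *)
Lemma maximal_subfield_retraction x : exists s, nilpotent_elt (x - f s).
Proof.
have [nil|] := pselect (exists p : {poly S}, p != 0 /\ nilpotent_elt (ev p x)); last first.
  move=> nex; have [|s ->] := S_max (x := x); last first.
    by exists s; rewrite subrr; exists 1%N; rewrite expr1.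
  move=> p; have [->|p0] := eqVneq p 0; first by left; rewrite rmorph0 horner0.
  by right; case: (nil_or_inv (ev p x)) => // np; case: nex; exists p.
have [p [p0 px pmin]] : exists p : {poly S}, [/\ p != 0, nilpotent_elt (ev p x) &
    forall q : {poly S}, q != 0 -> nilpotent_elt (ev q x) -> (size p <= size q)%N].
  case: nil => p []; have [n] := ubnP (size p); elim: n p => // n IH p ltpn p0 px.
  have [[q [q0 qx qp]]|nq] := pselect (exists q : {poly S},
      [/\ q != 0, nilpotent_elt (ev q x) & (size q < size p)%N]).
    by apply: (IH q); rewrite // (leq_trans qp).
  exists p; split=> // q q0 qx; rewrite leqNgt; apply/negP => qp.
  by apply: nq; exists q.
have sep := nilpotent_minimal_separable p0 px pmin.
have [w [wx pw]] : exists w, nilpotent_elt (w - x) /\ ev p w = 0.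
  apply: newton_root => //.
  (* A Bezout relation between [p] and its derivative, evaluated at [x], makes the value of [v]
     times that of the derivative equal to 1 minus a nilpotent element. *)
  move: sep; rewrite separable_poly.unlock => /Bezout_eq1_coprimepP[[u v] /= uv].
  have := congr1 (fun q => ev q x) uv; rewrite /= evD !evM rmorph1 hornerE => E.
  have : invertible_elt (ev v x * ev p^`() x).
    rewrite (_ : _ * _ = 1 - ev u x * ev p x); last by rewrite -E addrAC subrr add0r.
    by apply: invertible_1B; rewrite mulrC; apply: nilpotent_mul.
  by move/invertible_mul => []; rewrite deriv_map.
have [|s ws] := S_max (x := w); last first.
  exists s; rewrite -ws -opprB; exact: nilpotent_opp.
(* As [p] vanishes at [w], only the remainder [q %% p] counts there; a nilpotent value at [w]
   entails one at [x], and minimality of [p] makes the remainder 0. *)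
move=> q; case: (nil_or_inv (ev q w)) => [nq|]; [left | by right].
have E : ev q w = ev (q %% p) w.
  by rewrite {1}(divp_eq q p) evD evM pw mulr0 add0r.
rewrite E in nq *; have [->|r0] := eqVneq (q %% p) 0; first by rewrite rmorph0 horner0.
have : nilpotent_elt (ev (q %% p) x).
  rewrite -[ev _ x](subrK (ev (q %% p) w)); apply: nilpotent_add => //.
  by apply: horner_nilpotent; rewrite -opprB; apply: nilpotent_opp.
by move/(pmin _ r0); rewrite leqNgt ltn_modp p0.
Qed.

(** [S] comes from Zorn's lemma and need not be definable; it is interpreted as the residue field.
    [sel x] is the only [s] with [x - f s] nilpotent, and nilpotency is definable, being the failure
    of invertibility. *)
Lemma maximal_subfield_tame (D : ((nat -> A) -> Prop) -> Prop) :
  tame_ring D -> tame_field S.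
Proof.
move=> [tD D_add D_mul]; split=> //.
have [sel selP] := choice maximal_subfield_retraction.
have sel_eq x s : sel x = s <-> nilpotent_elt (x - f s).
  split=> [<-//|nxs]; apply/eqP; rewrite -subr_eq0; apply/eqP/subfield_nilpotent.
  rewrite rmorphB (_ : _ - _ = - (x - f (sel x)) + (x - f s)); last by ring.
  by apply: nilpotent_add => //; apply: nilpotent_opp.
have sel_cong x y s : nilpotent_elt (y - f s) -> (nilpotent_elt (x - y) <-> sel x = s).
  move=> ny; rewrite sel_eq (_ : x - f s = (y - f s) + (x - y)); last by ring.
  exact: iff_sym (nilpotent_addl_iff (x - y) ny).
pose pi (v : 'I_1 -> A) := sel (v ord0).
have Dnil F : tame_fun D F -> D (fun e => nilpotent_elt (F e)).
  move=> DF; have Dinv : D (fun e => exists b, F e * b = 1).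
    apply: (tame_ex tD (X := fun e b => F e * b = 1)).
    apply: (tame_eq_fun tD); last exact: tame_fun_cst.
    apply: (tame_fun_op tD D_mul); last exact: tame_fun_var.
    exact: (tame_fun_ren tD succn DF).
  by apply: tame_ext (tame_not tD Dinv) => e; rewrite -not_invertible.
have blk (e : nat -> A) i : pi (block e i) = sel (e i).
  by rewrite /pi /block muln1 addn0.
have pi_surj s : exists v, pi v = s.
  exists (fun=> f s); apply/sel_eq; rewrite subrr.
  by exists 1%N; rewrite expr1.
have sub F G : tame_fun D F -> tame_fun D G -> tame_fun D (fun e => F e - G e).
  by move=> DF DG; apply: tame_fun_add => //; apply: tame_fun_opp.
have var i : tame_fun D (fun e => e i) by apply: tame_fun_var.
exists (pullback D pi); split.
- apply: tame_interpretation => //; rewrite /pullback.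
  apply: tame_ext (Dnil _ (sub _ _ (var 0%N) (var 1%N))) => e.
  by rewrite !blk; apply: sel_cong.
- rewrite /pullback; have Dadd := tame_fun_add tD D_add (var 0%N) (var 1%N).
  apply: tame_ext (Dnil _ (sub _ _ (var 2%N) Dadd)) => e; rewrite !blk.
  rewrite (sel_cong _ _ (sel (e 0%N) + sel (e 1%N))); first by split=> ->.
  by rewrite rmorphD opprD addrACA; apply: nilpotent_add.
- rewrite /pullback; have Dmul := tame_fun_op tD D_mul (var 0%N) (var 1%N).
  apply: tame_ext (Dnil _ (sub _ _ (var 2%N) Dmul)) => e; rewrite !blk.
  rewrite (sel_cong _ _ (sel (e 0%N) * sel (e 1%N))); first by split=> ->.
  rewrite rmorphM (_ : _ - _ = (e 0%N - f (sel (e 0%N))) * e 1%N +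
    (e 1%N - f (sel (e 1%N))) * f (sel (e 0%N))); last by ring.
  by apply: nilpotent_add; apply: nilpotent_mul.
Qed.

End LocalRing.

(** The definable ideals generated by the [a ^+ n] stabilise, so that [a ^+ n = a ^+ n.+1 * b] for
    some [n]; then [a ^+ n * b ^+ n] is idempotent. If it is 0, [a] is nilpotent; if it is 1, [a] is
    invertible. *)
Lemma tame_nilpotent_or_invertible (A : comNzRingType)
    (D : ((nat -> A) -> Prop) -> Prop) :
  tame_ring D -> (forall e : A, e * e = e -> e = 0 \/ e = 1) ->
  forall a : A, nilpotent_elt a \/ invertible_elt a.
Proof.
move=> [tD D_add D_mul] idem a.
have [n [b ab]] : exists n b, a ^+ n = a ^+ n.+1 * b.
  apply: contrapT => nn.
  apply: (no_subgroup_chain tD D_add (H := fun n x => exists b, a ^+ n * b = x)).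
  - move=> n; split; first by exists 0; rewrite mulr0.
    by move=> _ _ [b <-] [c <-]; exists (b - c); rewrite mulrBr.
  - move=> n; apply: (tame_ex tD (X := fun e b => a ^+ n * b = e 0%N)).
    apply: (tame_eq_fun tD); last exact: tame_fun_var.
    apply: (tame_fun_op tD D_mul); [exact: tame_fun_cst | exact: tame_fun_var].
  - by move=> n _ [b <-]; exists (a * b); rewrite mulrA exprSr.
  - move=> n; exists (a ^+ n); first by exists 1; rewrite mulr1.
    by move=> [b ab]; apply: nn; exists n, b.
have abn m : a ^+ n = a ^+ (n + m) * b ^+ m.
  elim: m => [|m IH]; first by rewrite addn0 mulr1.
  have E : a ^+ (n + m) = a ^+ (n + m).+1 * b.
    by rewrite exprD {1}ab -addSn exprD mulrAC.
  by rewrite IH E -mulrA -exprS addnS.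
have := idem (a ^+ n * b ^+ n).
have ann : a ^+ n = a ^+ n * (a ^+ n * b ^+ n) by rewrite mulrA -exprD.
case; first by rewrite {1}[a ^+ n * b ^+ n]mulrC -mulrA -ann mulrC.
  by move=> e0; left; exists n; rewrite ann e0 mulr0.
move=> e1; right; case: n ab {abn ann} e1 => [|n] ab e1.
  by exists b; rewrite -[a]expr1 -ab.
by exists (a ^+ n * b ^+ n.+1); rewrite mulrA -exprS.
Qed.

Lemma local_ring_closed_subfield (A : comNzRingType)
    (D : ((nat -> A) -> Prop) -> Prop) :
  tame_ring D -> (forall n, n.+1%:R != 0 :> A) ->
  (forall e : A, e * e = e -> e = 0 \/ e = 1) ->
  exists (k : closedFieldType) (f : k -> A),
    [/\ [pchar k] =i pred0, {morph f : x y / x + y}, {morph f : x y / x * y} & f 1 = 1].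
Proof.
move=> tA A0 idem; have nil_or_inv := tame_nilpotent_or_invertible tA idem.
have nat_inv n : invertible_elt (n.+1%:R : A).
  case: (nil_or_inv n.+1%:R) => // -[m]; rewrite -natrX => /eqP.
  by rewrite -(prednK (_ : 0 < n.+1 ^ m)%N) ?expn_gt0 // (negPf (A0 _)).
(* The copy of the rationals in [A], the subfield from which Zorn's lemma starts. *)
pose Q (x : A) := exists (m : int) (n : nat), x * n.+1%:R = m%:~R.
have inj_mul n (x y : A) : x * n.+1%:R = y * n.+1%:R -> x = y.
  by have [c nc] := nat_inv n; move=> /(congr1 ( *%R^~ c)); rewrite -!mulrA nc !mulr1.
have [] := @exists_maximal_subfield A Q.
  split.
  - by exists 1, 0%N; rewrite mulr1.
  (* Denominators are stored minus 1: [n * n' + n + n'] is one less than [n.+1 * n'.+1]. *)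
  - move=> x y [m [n xn]] [m' [n' yn']]; exists (m * n'.+1%:Z - m' * n.+1%:Z), (n * n' + n + n')%N.
    rewrite rmorphB !rmorphM /= -xn -yn' -!pmulrn.
    have -> : (n * n' + n + n').+1%:R = n.+1%:R * n'.+1%:R :> A.
      by rewrite -natrM; congr (_%:R); ring.
    ring.
  - move=> x y [m [n xn]] [m' [n' yn']]; exists (m * m'), (n * n' + n + n')%N.
    rewrite rmorphM /= -xn -yn'.
    have -> : (n * n' + n + n').+1%:R = n.+1%:R * n'.+1%:R :> A.
      by rewrite -natrM; congr (_%:R); ring.
    ring.
  - move=> x [[m|m] [n xn]] x0.
    + case: m xn => [|m] xn.
        by move: x0; rewrite (inj_mul n x 0) ?eqxx // xn mul0r.
      have [c mc] := nat_inv m; exists (n.+1%:R * c); last by rewrite mulrA xn.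
      by exists n.+1%:Z, m; rewrite -mulrA [c * _]mulrC mc mulr1.
    + have [c mc] := nat_inv m; exists (- (n.+1%:R * c)).
        by exists (- n.+1%:Z), m; rewrite mulNr -mulrA [c * _]mulrC mc mulr1 mulrNz.
      by rewrite mulrN mulrA xn NegzE mulrNz mulNr opprK.
move=> S [f S_max].
have S0 n : n.+1%:R != 0 :> S.
  by apply: contra (A0 n) => /eqP n0; rewrite -(rmorph_nat f) n0 rmorph0.
have tS := maximal_subfield_tame nil_or_inv S0 S_max tA.
have [p p1|k [g [k0 gD gM g1]]] := closed_field_of_roots S0.
  by apply: (@tame_field_root (size p)); rewrite // p1 leqnn.
exists k, (f \o g); split=> // [x y|x y|] /=; first by rewrite gD rmorphD.
  by rewrite gM rmorphM.
by rewrite g1 rmorph1.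
Qed.

(** * Rational structure and complements *)

Section RatModule.

Variable V : zmodType.
Hypothesis V_div : forall m (x : V), (0 < m)%N -> exists y, y *+ m = x.
Hypothesis V_tf : forall m (x : V), (0 < m)%N -> x *+ m = 0 -> x = 0.

Lemma torsion_free_inj m : (0 < m)%N -> injective (fun x : V => x *+ m).
Proof.
move=> m0 x y /eqP; rewrite -subr_eq0 -mulrnBl => /eqP/(V_tf m0)/eqP.
by rewrite subr_eq0 => /eqP.
Qed.

Lemma rat_scale_ex (q : rat) (x : V) : exists y, y *+ `|denq q| = x *~ numq q.
Proof. by apply: V_div; rewrite absz_gt0 denq_neq0. Qed.

Definition rat_scale q x : V := sval (cid (rat_scale_ex q x)).

Lemma rat_scaleP (q : rat) x (m : int) (n : nat) : (0 < n)%N ->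
  q * n%:R = m%:~R -> rat_scale q x *+ n = x *~ m.
Proof.
move=> n0 qnm; rewrite /rat_scale; case: cid => y /= yP.
have d0 : (0 < `|denq q|)%N by rewrite absz_gt0 denq_neq0.
apply: (torsion_free_inj d0); rewrite /= mulrnAC yP !pmulrn -!mulrzA.
congr (_ *~ _).
have dE : (`|denq q|%:Z = denq q)%R by rewrite absz_denq.
apply: (@intr_inj rat); rewrite dE !rmorphM /= -qnm.
by rewrite mulrAC -{2}[q]divq_num_den divfK // intr_eq0 denq_neq0.
Qed.

Lemma rat_scale_unique (q : rat) x y (m : int) (n : nat) : (0 < n)%N ->
  q * n%:R = m%:~R -> y *+ n = x *~ m -> rat_scale q x = y.
Proof.
move=> n0 qnm yn; apply: (torsion_free_inj n0); rewrite /= yn.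
exact: rat_scaleP.
Qed.

Let den (q : rat) := `|denq q|%N.
Let den_gt0 q : (0 < den q)%N. Proof. by rewrite absz_gt0 denq_neq0. Qed.
Let denP q : q * (den q)%:R = (numq q)%:~R.
Proof.
have -> : (den q)%:R = (denq q)%:~R :> rat by rewrite -absz_denq.
by rewrite -{1}[q]divq_num_den divfK // intr_eq0 denq_neq0.
Qed.

Lemma rat_scaleA a b x : rat_scale a (rat_scale b x) = rat_scale (a * b) x.
Proof.
apply/esym/(@rat_scale_unique _ _ _ (numq a * numq b) (den a * den b)).
- by rewrite muln_gt0 !den_gt0.
- by rewrite natrM mulrACA !denP rmorphM.
- rewrite mulrnA (rat_scaleP _ (den_gt0 a) (denP a)) pmulrn -mulrzA.
  rewrite [numq a * (den b)%:Z]mulrC [LHS]mulrzA.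
  by rewrite -pmulrn (rat_scaleP _ (den_gt0 b) (denP b)) -mulrzA mulrC.
Qed.

Lemma rat_scale1 : left_id 1 rat_scale.
Proof. by move=> x; apply: (@rat_scale_unique _ _ _ 1 1); rewrite ?mul1r. Qed.

Lemma rat_scaleDr : right_distributive rat_scale +%R.
Proof.
move=> a x y; apply: (rat_scale_unique (den_gt0 a) (denP a)).
by rewrite mulrnDl !(rat_scaleP _ (den_gt0 a) (denP a)) mulrzDl.
Qed.

Lemma rat_scaleDl x : {morph rat_scale^~ x : a b / a + b}.
Proof.
move=> a b; apply: (@rat_scale_unique _ _ _
  (numq a * (den b)%:Z + numq b * (den a)%:Z) (den a * den b)).
- by rewrite muln_gt0 !den_gt0.
- by rewrite mulrDl natrM mulrA denP [_%:R * _%:R]mulrC mulrA denP rmorphD !rmorphM.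
- rewrite mulrnDl mulrnA (rat_scaleP _ (den_gt0 a) (denP a)).
  rewrite [(den a * den b)%N]mulnC mulrnA (rat_scaleP _ (den_gt0 b) (denP b)).
  by rewrite mulrzDr !mulrzA -!pmulrn.
Qed.

Definition rat_module (_ : forall m (x : V), (0 < m)%N -> exists y, y *+ m = x)
  (_ : forall m (x : V), (0 < m)%N -> x *+ m = 0 -> x = 0) : Type := V.

HB.instance Definition _ := GRing.Zmodule.on (rat_module V_div V_tf).
HB.instance Definition _ := GRing.Zmodule_isLmodule.Build rat (rat_module V_div V_tf)
  rat_scaleA rat_scale1 rat_scaleDr rat_scaleDl.

End RatModule.

Section Projection.

Variables (k : fieldType) (V : lmodType k).

Definition submodule (N : V -> Prop) : Prop :=
  N 0 /\ forall a x y, N x -> N y -> N (a *: x + y).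

Lemma submoduleD N x y : submodule N -> N x -> N y -> N (x + y).
Proof. by move=> [_ NP] Nx Ny; rewrite -[x]scale1r; apply: NP. Qed.

Lemma submoduleZ N a x : submodule N -> N x -> N (a *: x).
Proof. by move=> [N0 NP] Nx; rewrite -[_ *: _]addr0; apply: NP. Qed.

Lemma submoduleB N x y : submodule N -> N x -> N y -> N (x - y).
Proof. by move=> sN Nx Ny; apply: submoduleD => //; rewrite -scaleN1r; apply: submoduleZ. Qed.

(** A submodule [C] containing [M] and maximal among those meeting [N] in 0 is a complement of [N],
    for a vector outside their sum could be added to [C]. The map [q] is the projection onto [N]
    along [C]. *)
Lemma exists_projection (N M : V -> Prop) : submodule N -> submodule M ->
  (forall x, N x -> M x -> x = 0) ->
  exists q : V -> V, [/\ {morph q : x y / x + y}, forall a x, q (a *: x) = a *: q x,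
    forall x, N (q x), forall x, N x -> q x = x & forall x, M x -> q x = 0].
Proof.
move=> sN sM NM0.
pose P (C : set V) := [/\ submodule C, (M `<=` C)%classic & forall x, N x -> C x -> x = 0].
have [F FP totF|C [CP Cmax]] := @Zorn_bigcup _ [set C | C = set0 \/ P C].
  have [[C1 FC1 [sC1 MC1 _]]|noC] := pselect (exists2 C, F C & P C); last first.
    left; apply/seteqP; split=> // x [C FC Cx].
    by case: (FP C FC) => [C0|PC]; [rewrite C0 in Cx | case: noC; exists C].
  right; split.
  - split; first by exists C1 => //; case: sC1.
    move=> a x y [C FC Cx] [C' FC' C'y].
    have sub (B : set V) z : F B -> B z -> submodule B.
      by move=> FB Bz; case: (FP B FB) => [B0|[]//]; rewrite B0 in Bz.
    have [CC'|C'C] := totF _ _ FC FC'.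
      by exists C' => //; apply: (sub C' y FC' C'y).2 => //; apply: CC'.
    by exists C => //; apply: (sub C x FC Cx).2 => //; apply: C'C.
  - by move=> x /MC1 C1x; exists C1.
  - move=> x Nx [C FC Cx]; case: (FP C FC) => [C0|[_ _]]; last exact.
    by rewrite C0 in Cx.
have {CP} [sC MC NC0] : P C.
  case: CP => // C0; exfalso; apply: (Cmax M); last by right; split.
  by rewrite C0; split=> // /(_ 0); apply; case: sM.
have dec x : exists n, N n /\ C (x - n).
  apply: contrapT => nx; pose C' y := exists a c, C c /\ y = c + a *: x.
  have CC' c : C c -> C' c by move=> Cc; exists 0, c; rewrite scale0r addr0.
  apply: (Cmax C').
    split=> // C'C; apply: nx; exists 0; split; first by case: sN.
    rewrite subr0; apply: C'C; exists 1, 0; rewrite add0r scale1r.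
    by split=> //; case: sC.
  right; split.
  - split; first by apply: CC'; case: sC.
    move=> a _ _ [b [c [Cc ->]]] [b' [c' [Cc' ->]]].
    exists (a * b + b'), (a *: c + c'); split; first exact: sC.2.
    by rewrite scalerDr scalerA scalerDl addrACA.
  - by move=> y /MC /CC'.
  - move=> y Ny [a [c [Cc yE]]]; have [a0|a0] := eqVneq a 0.
      by apply: NC0 => //; rewrite yE a0 scale0r addr0.
    case: nx; exists (a^-1 *: y); split; first exact: submoduleZ.
    have -> : x - a^-1 *: y = (- a^-1) *: c.
      by rewrite yE scalerDr scalerA mulVf // scale1r opprD addrCA subrr addr0 scaleNr.
    exact: submoduleZ.
have [q qP] := choice dec.
have q_unique x n : N n -> C (x - n) -> q x = n.
  move=> Nn Cn; have [Nq Cq] := qP x; apply/eqP; rewrite -subr_eq0; apply/eqP.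
  apply: NC0; first exact: submoduleB.
  have -> : q x - n = (x - n) - (x - q x) by rewrite opprB [RHS]addrC addrA subrK.
  exact: submoduleB.
exists q; split.
- move=> x y; have [Nx Cx] := qP x; have [Ny Cy] := qP y.
  by apply: q_unique; rewrite ?opprD ?[_ + y + _]addrACA; apply: submoduleD.
- move=> a x; have [Nx Cx] := qP x.
  by apply: q_unique; rewrite -?scalerBr; apply: submoduleZ.
- by move=> x; case: (qP x).
- by move=> x Nx; apply: q_unique; rewrite ?subrr //; case: sC.
- by move=> x Mx; apply: q_unique; rewrite ?subr0; [case: sN | apply: MC].
Qed.

End Projection.

(** * Scalars of a nonassociative ring *)

Section NonAssocTheory.

Variable R : naRingType.
Implicit Types x y z : R.

Lemma namul0r x : 0 ** x = 0.
Proof. by apply: (@addrI _ (0 ** x)); rewrite -namulDl !addr0. Qed.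

Lemma namulr0 x : x ** 0 = 0.
Proof. by apply: (@addrI _ (x ** 0)); rewrite -namulDr !addr0. Qed.

Lemma namulNl x y : (- x) ** y = - (x ** y).
Proof. by apply/eqP; rewrite -addr_eq0 -namulDl addNr namul0r. Qed.

Lemma namulNr x y : x ** (- y) = - (x ** y).
Proof. by apply/eqP; rewrite -addr_eq0 -namulDr addNr namulr0. Qed.

Lemma namulBl x y z : (x - y) ** z = x ** z - y ** z.
Proof. by rewrite namulDl namulNl. Qed.

Lemma namulBr x y z : x ** (y - z) = x ** y - x ** z.
Proof. by rewrite namulDr namulNr. Qed.

Definition ann x : Prop := forall y, x ** y = 0 /\ y ** x = 0.

Lemma ann0 : ann 0.
Proof. by move=> y; rewrite namul0r namulr0. Qed.

Lemma annB x y : ann x -> ann y -> ann (x - y).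
Proof.
move=> ax ay z; have [? ?] := ax z; have [? ?] := ay z.
by split; [rewrite namulBl | rewrite namulBr]; apply/eqP; rewrite subr_eq0; apply/eqP; congruence.
Qed.

Lemma annD x y : ann x -> ann y -> ann (x + y).
Proof.
by move=> ax ay; rewrite -[y]opprK -[- y]add0r; do 2!apply: annB => //; exact: ann0.
Qed.

Definition additive_fun (f : R -> R) : Prop := {morph f : x y / x + y}.

Lemma additive0 f : additive_fun f -> f 0 = 0.
Proof. by move=> fD; apply: (@addrI _ (f 0)); rewrite -fD !addr0. Qed.

Lemma additiveN f x : additive_fun f -> f (- x) = - f x.
Proof. by move=> fD; apply/eqP; rewrite -addr_eq0 -fD addNr additive0. Qed.

Lemma additiveB f x y : additive_fun f -> f (x - y) = f x - f y.
Proof. by move=> fD; rewrite fD additiveN. Qed.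

Lemma additive_sum f I (r : seq I) (F : I -> R) :
  additive_fun f -> f (\sum_(i <- r) F i) = \sum_(i <- r) f (F i).
Proof. by move=> fD; apply: (big_morph f fD); apply: additive0. Qed.

Lemma additiveMn f x n : additive_fun f -> f (x *+ n) = f x *+ n.
Proof.
by move=> fD; elim: n => [|n IH]; rewrite ?mulr0n ?additive0 // !mulrS fD IH.
Qed.

End NonAssocTheory.

Section Scalars.

Variable R : naRingType.
Implicit Types (x y z : R) (al be : R -> R).

(* [pr] projects [R] onto a complement of its annihilator along the annihilator, so
   that additive maps [al] with [al \o pr = al = pr \o al] are the endomorphisms
   of [R / ann R]. *)
Variable pr : R -> R.
Hypothesis prD : additive_fun pr.
Hypothesis pr_ann : forall x, ann x -> pr x = 0.
Hypothesis prP : forall x, ann (x - pr x).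

Lemma pr_idem x : pr (pr x) = pr x.
Proof.
by apply/esym/eqP; rewrite -subr_eq0 -additiveB // pr_ann.
Qed.

Lemma pr_mull x y : pr x ** y = x ** y.
Proof.
by apply/esym/eqP; rewrite -subr_eq0 -namulBl; apply/eqP; case: (prP x y).
Qed.

Lemma pr_mulr x y : y ** pr x = y ** x.
Proof.
by apply/esym/eqP; rewrite -subr_eq0 -namulBr; apply/eqP; case: (prP x y).
Qed.

Lemma pr_eq x y : ann (x - y) -> pr x = pr y.
Proof. by move=> /pr_ann; rewrite additiveB // => /eqP; rewrite subr_eq0 => /eqP. Qed.

(** The part of the condition on scalars that is first-order. [sc_prod] says that on products [al]
    agrees, modulo [ann], with the intended extension, which sends [x ** y] to [al x ** y]. *)
Record prescalar al : Prop := Prescalar {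
  scD : additive_fun al;
  sc_pr : forall x, al (pr x) = al x;
  sc_im : forall x, pr (al x) = al x;
  sc_adj : forall x y, al x ** y = x ** al y;
  sc_prod : forall x y, al (x ** y) = pr (al x ** y)
}.

(* [al] extends to [R ** R] as far as sums of [n] products are concerned. *)
Definition extends al (n : nat) : Prop := forall r : seq (R * R), size r = n ->
  \sum_(p <- r) p.1 ** p.2 = 0 -> \sum_(p <- r) al p.1 ** p.2 = 0.

Definition scalar al : Prop := prescalar al /\ forall n, extends al n.

Lemma sc_ann al x : prescalar al -> ann x -> al x = 0.
Proof. by move=> sa ax; rewrite -(sc_pr sa) pr_ann // additive0 //; case: sa. Qed.

Lemma prescalar_pr : prescalar pr.
Proof.
split=> // [x|x|x y|x y]; rewrite ?pr_idem ?pr_mull ?pr_mulr //.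
Qed.

Lemma scalar_pr : scalar pr.
Proof.
split=> [|n r _ r0]; first exact: prescalar_pr.
by under eq_bigr do rewrite pr_mull.
Qed.

Lemma prescalarB al be : prescalar al -> prescalar be ->
  prescalar (fun x => al x - be x).
Proof.
move=> sa sb; split.
- by move=> x y /=; rewrite (scD sa) (scD sb) opprD addrACA.
- by move=> x; rewrite (sc_pr sa) (sc_pr sb).
- by move=> x; rewrite additiveB // (sc_im sa) (sc_im sb).
- by move=> x y; rewrite namulBl namulBr (sc_adj sa) (sc_adj sb).
- by move=> x y; rewrite namulBl additiveB // (sc_prod sa) (sc_prod sb).
Qed.

Lemma extendsB al be n : extends al n -> extends be n ->
  extends (fun x => al x - be x) n.
Proof.
move=> ea eb r rn r0; under eq_bigr do rewrite namulBl.
by rewrite sumrB ea // eb // subrr.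
Qed.

Lemma scalarB al be : scalar al -> scalar be -> scalar (fun x => al x - be x).
Proof.
move=> [sa ea] [sb eb]; split; first exact: prescalarB.
by move=> n; apply: extendsB.
Qed.

Lemma scalar0 : scalar (fun=> 0).
Proof.
have -> : (fun=> 0) = (fun x => pr x - pr x) by apply/funext => x; rewrite subrr.
by apply: scalarB; apply: scalar_pr.
Qed.

Lemma scalarN al : scalar al -> scalar (fun x => - al x).
Proof.
move=> sa; have -> : (fun x => - al x) = (fun x => 0 - al x).
  by apply/funext => x; rewrite sub0r.
exact: scalarB scalar0 sa.
Qed.

Lemma scalarD al be : scalar al -> scalar be -> scalar (fun x => al x + be x).
Proof.
move=> sa sb; have -> : (fun x => al x + be x) = (fun x => al x - (- be x)).
  by apply/funext => x; rewrite opprK.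
exact: scalarB sa (scalarN sb).
Qed.

(** The extension of [be] is applied to the relation [x ** al y - al x ** y = 0], which has two
    products. Commutativity of the scalars comes from here. *)
Lemma scalar_swap al be x y : prescalar al -> scalar be ->
  be x ** al y = be (al x) ** y.
Proof.
move=> sa [sb eb]; have := eb 2 [:: (x, al y); (- al x, y)] erefl.
rewrite !big_cons !big_nil /= !addr0 namulNl (sc_adj sa) subrr => /(_ erefl) /eqP.
by rewrite (additiveN _ (scD sb)) namulNl subr_eq0 => /eqP.
Qed.

Lemma scalar_comm al be x : prescalar al -> scalar be -> al (be x) = be (al x).
Proof.
move=> sa sb; have [psb _] := sb.
rewrite -(sc_im sa) -[RHS](sc_im psb); apply: pr_eq => y.
rewrite namulBl namulBr; split; apply/eqP; rewrite subr_eq0; apply/eqP.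
  by rewrite (sc_adj sa) (scalar_swap _ _ sa sb).
by rewrite -(sc_adj sa) -(sc_adj psb y) (scalar_swap _ _ sa sb) (sc_adj psb).
Qed.

Lemma prescalar_comp al be : prescalar al -> scalar be -> prescalar (al \o be).
Proof.
move=> sa sb; have [psb _] := sb; split=> /=.
- by move=> x y /=; rewrite (scD psb) (scD sa).
- by move=> x; rewrite (sc_pr psb).
- by move=> x; rewrite (sc_im sa).
- by move=> x y; rewrite (scalar_comm x sa sb) (sc_adj psb) (sc_adj sa).
- by move=> x y; rewrite (sc_prod psb) (sc_pr sa) (sc_prod sa).
Qed.

Lemma scalar_comp al be : scalar al -> scalar be -> scalar (al \o be).
Proof.
move=> [sa ea] sb; split; first exact: prescalar_comp.
move=> n r rn r0; have [_ eb] := sb.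
have := ea n [seq (be p.1, p.2) | p <- r]; rewrite size_map !big_map /=.
by apply=> //; apply: (eb n).
Qed.

(** * The commutative ring of scalars below an idempotent *)

Section Corner.

Variable e : R -> R.
Hypothesis e_scalar : scalar e.
Hypothesis e_idem : forall x, e (e x) = e x.
Hypothesis e_neq0 : exists x, e x != 0.

Record corner_of (e : R -> R) := Corner {
  corner_fun :> R -> R;
  corner_scalar : scalar corner_fun;
  cornerP : forall x, corner_fun (e x) = corner_fun x
}.

(** The ring operations depend on these hypotheses, so they are arguments of the type, where
    unification finds them. *)
Definition corner (_ : additive_fun pr) (_ : forall x, ann x -> pr x = 0)
  (_ : forall x, ann (x - pr x)) (_ : scalar e) (_ : forall x, e (e x) = e x)
  (_ : exists x, e x != 0) : Type := corner_of e.
Notation corner_e := (corner prD pr_ann prP e_scalar e_idem e_neq0).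

HB.instance Definition _ := gen_eqMixin corner_e.
HB.instance Definition _ := gen_choiceMixin corner_e.

Lemma corner_inj (a b : corner_e) :
  (forall x, corner_fun a x = corner_fun b x) -> a = b.
Proof.
case: a b => [a sa ca] [b sb cb] /= /funext ab; subst b.
by congr Corner; apply: Prop_irrelevance.
Qed.

Definition corner_zero : corner_e := @Corner e _ scalar0 (fun=> erefl).
Definition corner_one : corner_e := @Corner e _ e_scalar e_idem.

Program Definition corner_add (a b : corner_e) : corner_e :=
  @Corner e _ (scalarD (corner_scalar a) (corner_scalar b)) _.
Next Obligation. by rewrite /= (cornerP a) (cornerP b). Qed.

Program Definition corner_opp (a : corner_e) : corner_e :=
  @Corner e _ (scalarN (corner_scalar a)) _.
Next Obligation. by rewrite /= (cornerP a). Qed.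

Program Definition corner_mul (a b : corner_e) : corner_e :=
  @Corner e _ (scalar_comp (corner_scalar a) (corner_scalar b)) _.
Next Obligation. by rewrite /= (cornerP b). Qed.

Lemma corner_addA : associative corner_add.
Proof. by move=> a b c; apply: corner_inj => x /=; rewrite addrA. Qed.
Lemma corner_addC : commutative corner_add.
Proof. by move=> a b; apply: corner_inj => x /=; rewrite addrC. Qed.
Lemma corner_add0 : left_id corner_zero corner_add.
Proof. by move=> a; apply: corner_inj => x /=; rewrite add0r. Qed.
Lemma corner_addN : left_inverse corner_zero corner_opp corner_add.
Proof. by move=> a; apply: corner_inj => x /=; rewrite addNr. Qed.

HB.instance Definition _ := Algebra.isZmodule.Build corner_e
  corner_addA corner_addC corner_add0 corner_addN.

Lemma corner_mulA : associative corner_mul.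
Proof. by move=> a b c; apply: corner_inj. Qed.
Lemma corner_mulC : commutative corner_mul.
Proof.
move=> a b; apply: corner_inj => x /=; apply: scalar_comm.
  by case: (corner_scalar a).
exact: corner_scalar.
Qed.
Lemma corner_mul1 : left_id corner_one corner_mul.
Proof.
move=> a; apply: corner_inj => x /=; rewrite -(cornerP a).
rewrite -(@scalar_comm a e) ?cornerP //; last by case: (corner_scalar a).
Qed.
Lemma corner_mulDl : left_distributive corner_mul corner_add.
Proof. by move=> a b c; apply: corner_inj. Qed.
Lemma corner_1_neq0 : corner_one != 0.
Proof.
apply/eqP => /(congr1 (fun a : corner_e => corner_fun a)) /= e0.
by have [x] := e_neq0; rewrite e0 eqxx.
Qed.

HB.instance Definition _ := GRing.Zmodule_isComNzRing.Build corner_e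
  corner_mulA corner_mulC corner_mul1 corner_mulDl corner_1_neq0.

Lemma corner_addE (a b : corner_e) x :
  corner_fun (a + b) x = corner_fun a x + corner_fun b x.
Proof. by []. Qed.

Lemma corner_mulE (a b : corner_e) x :
  corner_fun (a * b) x = corner_fun a (corner_fun b x).
Proof. by []. Qed.

Lemma corner_1E x : corner_fun (1 : corner_e) x = e x.
Proof. by []. Qed.

Lemma corner_natE n x : corner_fun (n%:R : corner_e) x = e x *+ n.
Proof.
by elim: n => [|n IH]; [rewrite !mulr0n | rewrite !mulrS corner_addE IH corner_1E].
Qed.

End Corner.

End Scalars.

(** * Definability of scalars *)

Section ScalarsDefinable.

Variables (R : naRingType) (D : ((nat -> R) -> Prop) -> Prop).
Hypothesis tD : tame D.
Hypothesis D_add : D (fun e => e 0%N + e 1%N = e 2%N).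
Hypothesis D_mul : D (fun e => e 0%N ** e 1%N = e 2%N).

Lemma tame_fun_namul F G :
  tame_fun D F -> tame_fun D G -> tame_fun D (fun e => F e ** G e).
Proof. exact: tame_fun_op. Qed.

Lemma tame_fun_mulrn F n : tame_fun D F -> tame_fun D (fun e => F e *+ n).
Proof.
move=> DF; elim: n => [|n IH]; first exact: tame_fun_cst.
by apply: tame_ext (tame_fun_add tD D_add DF IH) => e; rewrite mulrS.
Qed.

(** A minimal group [n R] among the groups of multiples equals [m n R]; torsion-freeness cancels [n]
    in [y *+ (m * n) = x *+ n]. *)
Lemma tame_divisible : (forall x m, (0 < m)%N -> x *+ m = 0 -> x = 0 :> R) ->
  forall m (x : R), (0 < m)%N -> exists y, y *+ m = x.
Proof.
move=> R0 m x m0.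
have [||H [n [n0 ->]] Hmin] := minimal_subgroup (D := D) tD D_add
  (F := fun H => exists n, (0 < n)%N /\ H = fun x : R => exists y, y *+ n = x).
- by eexists; exists 1%N.
- move=> _ [n [n0 ->]]; split.
    split; first by exists 0; rewrite mul0rn.
    by move=> _ _ [y <-] [z <-]; exists (y - z); rewrite mulrnBl.
  apply: (tame_ex tD (X := fun e y => y *+ n = e 0%N)).
  apply: (tame_eq_fun tD); last exact: tame_fun_var.
  by apply: tame_fun_mulrn; apply: tame_fun_var.
have [y yE] : exists y, y *+ (m * n) = x *+ n.
  apply: (Hmin (fun x => exists y, y *+ (m * n) = x)) => [|_ [y <-]|].
  - by exists (m * n)%N; rewrite muln_gt0 m0.
  - by exists (y *+ m); rewrite mulrnA.
  - by exists x.
exists y; apply/eqP; rewrite -subr_eq0; apply/eqP/(R0 _ n n0).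
by rewrite mulrnBl -mulrnA yE subrr.
Qed.

(** A minimal annihilator of a finite set annihilates every [y], because adding [y] to the set
    cannot make it smaller. *)
Lemma finite_annihilating_system : exists m (s : 'I_m.+1 -> R),
  forall x, (forall j, x ** s j = 0 /\ s j ** x = 0) -> ann x.
Proof.
pose annS (s : seq R) x := {in s, forall y, x ** y = 0 /\ y ** x = 0}.
have [||H [s ->] Hmin] := minimal_subgroup (D := D) tD D_add
  (F := fun H => exists s, H = annS s).
- by exists (annS [::]), [::].
- move=> _ [s ->]; split.
    split=> [y _|x y xs ys z zs]; first by rewrite namul0r namulr0.
    have [x1 x2] := xs z zs; have [y1 y2] := ys z zs.
    by rewrite namulBl namulBr x1 x2 y1 y2 subrr.
  have DX : D (fun e => forall j : 'I_(size s),
      e 0%N ** s`_j = 0 /\ s`_j ** e 0%N = 0).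
    apply: tame_all_ord => // j; have v0 := tame_fun_var tD 0; have c := tame_fun_cst tD.
    by apply: (tame_and tD); apply: (tame_eq_fun tD) => //; apply: tame_fun_namul.
  apply: tame_ext DX => e; split=> [H y ys|H j]; last exact/H/mem_nth.
  by rewrite -(nth_index 0 ys); move: ys; rewrite -index_mem => ys; apply: (H (Ordinal ys)).
(* The last index gives the default value 0; it keeps the system nonempty. *)
exists (size s), (fun j : 'I_(size s).+1 => s`_j) => x xs y.
have annSx : annS (y :: s) x.
  apply: (Hmin (annS (y :: s))) => [|z zy z' z's|z].
  - by exists (y :: s).
  - by apply: zy; rewrite inE z's orbT.
  - rewrite -index_mem => ltz.
    by have := xs (widen_ord (leqnSn _) (Ordinal ltz)); rewrite /= nth_index // -index_mem.
exact: annSx (mem_head y s).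
Qed.

Variable pr : R -> R.
Hypothesis prD : additive_fun pr.
Hypothesis pr_ann : forall x, ann x -> pr x = 0.
Hypothesis prP : forall x, ann (x - pr x).

Variables (m : nat) (s : 'I_m.+1 -> R).
Hypothesis s_ann : forall x, (forall j, x ** s j = 0 /\ s j ** x = 0) -> ann x.

Implicit Types (t : 'I_m.+1 -> R) (x y z : R) (al be : R -> R).

(* Modulo the annihilator, a scalar [al] is determined by the values [al (s j)]. *)
Definition codes t al : Prop := forall j, ann (t j - al (s j)).

(** If [t] codes [al], then [x ** t j = x ** al (s j) = al x ** s j], and likewise on the other
    side: the equations say that [y] and [al x] act alike on the system [s], hence are equal modulo
    [ann]. *)
Definition graph t x y : Prop := forall j, y ** s j = x ** t j /\ s j ** y = t j ** x.

(** The graph of the extension of the coded map to sums of [n] products; for each [n] it unfolds to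
    a first-order formula in [t]. *)
Fixpoint sums n t x y : Prop :=
  if n is n'.+1 then exists a b c x' y',
    [/\ graph t a b, sums n' t x' y', x = a ** c + x' & y = b ** c + y']
  else x = 0 /\ y = 0.

Lemma codes_ex al : exists t, codes t al.
Proof. by exists (fun j => al (s j)) => j; rewrite subrr; exact: ann0. Qed.

Lemma graphP t al x y : prescalar pr al -> codes t al ->
  graph t x y <-> ann (y - al x).
Proof.
move=> sa cta.
have tl j : x ** t j = al x ** s j.
  rewrite (sc_adj sa); apply/eqP; rewrite -subr_eq0 -namulBr; apply/eqP.
  by case: (cta j x).
have tr j : t j ** x = s j ** al x.
  rewrite -(sc_adj sa); apply/eqP; rewrite -subr_eq0 -namulBl; apply/eqP.
  by case: (cta j x).
split=> [H|H j].
  apply: s_ann => j; have [H1 H2] := H j.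
  by rewrite namulBl namulBr H1 H2 tl tr !subrr.
have [H1 H2] := H (s j); rewrite tl tr.
by split; apply/eqP; rewrite -subr_eq0 -?namulBl -?namulBr ?H1 ?H2.
Qed.

Lemma codes_inj t al be : prescalar pr al -> prescalar pr be ->
  codes t al -> codes t be -> al = be.
Proof.
move=> sa sb ca cb; apply/funext => x; rewrite -(sc_im sa) -(sc_im sb).
apply: pr_eq => //; apply/(graphP x (al x) sb cb)/(graphP x (al x) sa ca).
by rewrite subrr; exact: ann0.
Qed.

Lemma sumsP t al n x y : prescalar pr al -> codes t al ->
  sums n t x y <-> exists r : seq (R * R), [/\ size r = n,
    x = \sum_(p <- r) p.1 ** p.2 & y = \sum_(p <- r) al p.1 ** p.2].
Proof.
move=> sa ca; elim: n x y => [|n IH] x y /=.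
  split=> [[-> ->]|[[|? ?] [//= _ -> ->]]]; last by rewrite !big_nil.
  by exists [::]; rewrite !big_nil.
split=> [[a [b [c [x' [y' [/graphP G /IH[r [rn -> ->]] -> ->]]]]]]|[[|[a c] r] [//= [rn] -> ->]]].
  exists ((a, c) :: r); rewrite /= rn !big_cons /=; split=> //.
  congr (_ + _); apply/eqP; rewrite -subr_eq0 -namulBl; apply/eqP.
  by case: (G al sa ca c).
exists a, (al a), c, (\sum_(p <- r) p.1 ** p.2), (\sum_(p <- r) al p.1 ** p.2).
rewrite !big_cons; split=> //; last by apply/IH; exists r.
by apply/(graphP _ _ sa ca); rewrite subrr; exact: ann0.
Qed.

Section CornerTame.

Variable e : R -> R.
Hypothesis e_scalar : scalar pr e.
Hypothesis e_idem : forall x, e (e x) = e x.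

Definition stage n t : Prop := exists al,
  [/\ prescalar pr al, extends al n, forall x, al (e x) = al x & codes t al].

(** In order: the coded relation is total, it satisfies [sc_adj] and [sc_prod], [t] lists values at
    [s], the map absorbs [e] (tested at [s] only), and it extends to sums of [n] products.
    Additivity comes from that of the equations in [graph]. *)
Definition stage_formula n t : Prop :=
  ((forall x, exists y, graph t x y) /\
   (forall x y x' y', graph t x y -> graph t x' y' -> y ** x' = x ** y')) /\
  ((forall x y z, graph t x y -> graph t (x ** z) (y ** z)) /\
   (forall j, graph t (s j) (t j))) /\
  ((forall j, graph t (s j - e (s j)) 0) /\
   (forall y, sums n t 0 y -> y = 0)).

Lemma stageP n t : stage n t <-> stage_formula n t.
Proof.
split=> [[al [sa ea ae ca]]|[[c1 c2] [[c3 c4] [c5 c6]]]].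
  have G x y := graphP x y sa ca.
  have anneq x y z : ann (x - y) -> x ** z = y ** z /\ z ** x = z ** y.
    move=> axy; have [H1 H2] := axy z.
    by split; apply/eqP; rewrite -subr_eq0 -?namulBl -?namulBr ?H1 ?H2.
  split; [split|split; split].
  - by move=> x; exists (al x); apply/G; rewrite subrr; exact: ann0.
  - move=> x y x' y' /G/anneq-/(_ x')[-> _] /G/anneq-/(_ x)[_ ->].
    exact: sc_adj sa _ _.
  - move=> x y z /G/anneq-/(_ z)[-> _]; apply/G; rewrite (sc_prod sa).
    exact: prP.
  - by move=> j; apply/G.
  - move=> j; apply/G; rewrite (additiveB _ _ (scD sa)) ae subrr subr0; exact: ann0.
  - move=> y /(sumsP _ _ _ sa ca)[r [rn /esym r0 ->]]; exact: ea.
have [f fP] := choice c1.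
have Guniq x y y' : graph t x y -> graph t x y' -> ann (y - y').
  move=> H H'; apply: s_ann => j; have [H1 H2] := H j; have [H1' H2'] := H' j.
  by rewrite namulBl namulBr H1 H2 H1' H2' !subrr.
have GD x y x' y' : graph t x y -> graph t x' y' -> graph t (x + x') (y + y').
  move=> H H' j; have [H1 H2] := H j; have [H1' H2'] := H' j.
  by rewrite !namulDl !namulDr H1 H2 H1' H2'.
have Gann x y : ann (x - y) -> forall z, graph t z x -> graph t z y.
  move=> axy z H j; have [H1 H2] := H j; rewrite -H1 -H2.
  have [A1 A2] := axy (s j).
  by split; apply/esym/eqP; rewrite -subr_eq0 -?namulBl -?namulBr ?A1 ?A2.
pose al x := pr (f x).
have alP x : graph t x (al x) by apply: (Gann (f x)).
have al_unique x y : graph t x y -> al x = pr y.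
  by move=> H; apply: (pr_eq prD pr_ann); apply: Guniq H.
have sa : prescalar pr al.
  split.
  - move=> x y; rewrite (al_unique _ (al x + al y)); last exact: GD.
    by rewrite prD !(pr_idem prD pr_ann prP).
  - move=> x; apply: al_unique => j; have [H1 H2] := fP x j.
    by rewrite H1 H2 (pr_mull prP) (pr_mulr prP).
  - by move=> x; rewrite (pr_idem prD pr_ann prP).
  - by move=> x y; apply: (c2 x (al x) y (al y)).
  - by move=> x y; apply: al_unique; apply: c3.
have ca : codes t al.
  by move=> j; apply: Guniq (c4 j) (alP (s j)).
exists al; split=> //.
- move=> r rn r0; apply: c6; apply/(sumsP _ _ _ sa ca).
  by exists r.
(* Adjointness moves [al] and [e] to the factor [s j], which reduces the identity to the tested
   values. *)
- move=> x; rewrite -(sc_im sa) -[RHS](sc_im sa); apply: pr_eq => //.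
  apply: s_ann => j.
  have sj : al (e (s j)) = al (s j).
    have := al_unique _ _ (c5 j); rewrite (additiveB _ _ (scD sa)) additive0 //.
    by move/eqP; rewrite subr_eq0 => /eqP.
  have [pse _] := e_scalar; have comm := scalar_comm prD pr_ann (s j) sa e_scalar.
  split; apply/eqP; rewrite ?namulBl ?namulBr subr_eq0; apply/eqP.
    by rewrite !(sc_adj sa) (sc_adj pse) -comm sj.
  by rewrite -!(sc_adj sa) -(sc_adj pse) -comm sj.
Qed.

Lemma tame_graph (t : 'I_m.+1 -> (nat -> R) -> R) F G :
  (forall j, tame_fun D (t j)) -> tame_fun D F -> tame_fun D G ->
  D (fun v => graph (fun j => t j v) (F v) (G v)).
Proof.
move=> Dt DF DG; apply: tame_all_ord => // j; have c := tame_fun_cst tD.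
by apply: (tame_and tD); apply: (tame_eq_fun tD); apply: tame_fun_namul.
Qed.

Lemma tame_sums n (t : 'I_m.+1 -> (nat -> R) -> R) F G :
  (forall j, tame_fun D (t j)) -> tame_fun D F -> tame_fun D G ->
  D (fun v => sums n (fun j => t j v) (F v) (G v)).
Proof.
elim: n t F G => [|n IH] t F G Dt DF DG /=.
  by apply: (tame_and tD); apply: (tame_eq_fun tD) => //; apply: tame_fun_cst.
pose X v a b c x' y' := (graph (fun j => t j v) a b /\ sums n (fun j => t j v) x' y') /\
  (F v = a ** c + x' /\ G v = b ** c + y').
have DX : D (fun v => exists a b c x' y', X v a b c x' y').
  apply: (tame_ex tD (X := fun v a => exists b c x' y', X v a b c x' y')).
  apply: (tame_ex tD (X := fun v b => exists c x' y', X (fun i => v i.+1) (v 0%N) b c x' y')).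
  apply: (tame_ex tD (X := fun v c => exists x' y',
     X (fun i => v i.+2) (v 1%N) (v 0%N) c x' y')).
  apply: (tame_ex tD (X := fun v x' => exists y',
     X (fun i => v i.+3) (v 2%N) (v 1%N) (v 0%N) x' y')).
  apply: (tame_ex tD (X := fun v y' =>
     X (fun i => v i.+4) (v 3%N) (v 2%N) (v 1%N) (v 0%N) y')).
  have var i : tame_fun D (fun v => v i) by apply: tame_fun_var.
  have ren H : tame_fun D H -> tame_fun D (fun v => H (fun i => v (5 + i)%N)).
    exact: tame_fun_ren.
  have lin i j k : tame_fun D (fun v => v i ** v j + v k).
    exact: (tame_fun_add tD D_add (tame_fun_namul (var i) (var j)) (var k)).
  apply: (tame_and tD); apply: (tame_and tD).
  - by apply: (tame_graph (t := fun j v => t j (fun i => v (5 + i)%N))) => // j; apply: ren.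
  - by apply: (IH (fun j v => t j (fun i => v (5 + i)%N))) => // j; apply: ren.
  - by apply: (tame_eq_fun tD (ren _ DF)); apply: (lin 4 2 1).
  - by apply: (tame_eq_fun tD (ren _ DG)); apply: (lin 3 2 0).
apply: tame_ext DX => v; split=> [[a [b [c [x' [y' [[? ?] [? ?]]]]]]]|[a [b [c [x' [y' [? ? ? ?]]]]]]].
  by exists a, b, c, x', y'.
by exists a, b, c, x', y'.
Qed.

Lemma tame_stage n (t : 'I_m.+1 -> (nat -> R) -> R) :
  (forall j, tame_fun D (t j)) -> D (fun v => stage n (fun j => t j v)).
Proof.
move=> Dt.
have DX : D (fun v => stage_formula n (fun j => t j v)).
  have var i : tame_fun D (fun v => v i) by apply: tame_fun_var.
  have cst a : tame_fun D (fun=> a) by apply: tame_fun_cst.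
  have ren k j : tame_fun D (fun v => t j (fun i => v (k + i)%N)) by apply: tame_fun_ren.
  have gr k F G : tame_fun D F -> tame_fun D G ->
      D (fun v => graph (fun j => t j (fun i => v (k + i)%N)) (F v) (G v)).
    by move=> DF DG; apply: (tame_graph (t := fun j v => t j (fun i => v (k + i)%N))).
  apply: (tame_and tD); [|apply: (tame_and tD)]; apply: (tame_and tD).
  - apply: (tame_all tD (X := fun v x => exists y, graph (fun j => t j v) x y)).
    apply: (tame_ex tD (X := fun v y => graph (fun j => t j (fun i => v i.+1)) (v 0%N) y)).
    exact: (gr 2 _ _ (var 1%N) (var 0%N)).
  - apply: (tame_all tD (X := fun v x => forall y x' y', graph (fun j => t j v) x y ->
      graph (fun j => t j v) x' y' -> y ** x' = x ** y')).
    apply: (tame_all tD (X := fun v y => forall x' y',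
      graph (fun j => t j (fun i => v i.+1)) (v 0%N) y ->
      graph (fun j => t j (fun i => v i.+1)) x' y' -> y ** x' = v 0%N ** y')).
    apply: (tame_all tD (X := fun v x' => forall y',
      graph (fun j => t j (fun i => v i.+2)) (v 1%N) (v 0%N) ->
      graph (fun j => t j (fun i => v i.+2)) x' y' -> v 0%N ** x' = v 1%N ** y')).
    apply: (tame_all tD (X := fun v y' =>
      graph (fun j => t j (fun i => v i.+3)) (v 2%N) (v 1%N) ->
      graph (fun j => t j (fun i => v i.+3)) (v 0%N) y' -> v 1%N ** v 0%N = v 2%N ** y')).
    apply: (tame_imp tD); first exact: (gr 4 _ _ (var 3%N) (var 2%N)).
    apply: (tame_imp tD); first exact: (gr 4 _ _ (var 1%N) (var 0%N)).
    exact: (tame_eq_fun tD (tame_fun_namul (var 2%N) (var 1%N))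
                           (tame_fun_namul (var 3%N) (var 0%N))).
  - apply: (tame_all tD (X := fun v x => forall y z, graph (fun j => t j v) x y ->
      graph (fun j => t j v) (x ** z) (y ** z))).
    apply: (tame_all tD (X := fun v y => forall z,
      graph (fun j => t j (fun i => v i.+1)) (v 0%N) y ->
      graph (fun j => t j (fun i => v i.+1)) (v 0%N ** z) (y ** z))).
    apply: (tame_all tD (X := fun v z =>
      graph (fun j => t j (fun i => v i.+2)) (v 1%N) (v 0%N) ->
      graph (fun j => t j (fun i => v i.+2)) (v 1%N ** z) (v 0%N ** z))).
    apply: (tame_imp tD); first exact: (gr 3 _ _ (var 2%N) (var 1%N)).
    exact: (gr 3 _ _ (tame_fun_namul (var 2%N) (var 0%N)) (tame_fun_namul (var 1%N) (var 0%N))).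
  - apply: tame_all_ord => // j.
    exact: (tame_graph Dt (cst (s j)) (Dt j)).
  - apply: tame_all_ord => // j.
    exact: (tame_graph Dt (cst (s j - e (s j))) (cst 0)).
  - apply: (tame_all tD (X := fun v y => sums n (fun j => t j v) 0 y -> y = 0)).
    apply: (tame_imp tD); last exact: (tame_eq_fun tD (var 0%N) (cst 0)).
    exact: (tame_sums n (ren 1) (cst 0) (var 0%N)).
by apply: tame_ext DX => v; rewrite stageP.
Qed.

(* The descending chain of the groups [stage n] stabilises, so that being a scalar
   is a definable property of the code. *)
Lemma stage_stable : exists N, forall t, stage N t ->
  exists al, [/\ scalar pr al, forall x, al (e x) = al x & codes t al].
Proof.
(* As finite functions the codes form an additive group, to which the chain condition applies. *)
pose pi (t : 'I_m.+1 -> R) : {ffun 'I_m.+1 -> R} := [ffun j => t j].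
have pi_inj t t' : pi t = pi t' <-> forall j, t j = t' j.
  split=> [/ffunP tt' j|tt']; first by have := tt' j; rewrite !ffunE.
  by apply/ffunP => j; rewrite !ffunE.
have pi_surj v : exists t, pi t = v.
  by exists v; apply/ffunP => j; rewrite ffunE.
have var (i : nat) (j : 'I_m.+1) : tame_fun D (fun v => block v i j) by apply: tame_fun_var.
have tV : tame (pullback D pi).
  apply: tame_interpretation => //; rewrite /pullback.
  have DX : D (fun v => forall j, block (m := m) v 0 j = block v 1 j).
    by apply: tame_all_ord => // j; apply: tame_eq_fun.
  by apply: tame_ext DX => v; rewrite -pi_inj.
have addV : pullback D pi (fun v => v 0%N + v 1%N = v 2%N).
  rewrite /pullback.
  have DX : D (fun v => forall j, block (m := m) v 0 j + block v 1 j = block v 2 j).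
    by apply: tame_all_ord => // j; apply: tame_eq_fun => //; apply: (tame_fun_add tD D_add).
  apply: tame_ext DX => v; split=> [vP|/ffunP vP j]; last by have := vP j; rewrite !ffunE.
  by apply/ffunP => j; rewrite !ffunE.
have [||H [N ->] Hmin] := minimal_subgroup tV addV
  (F := fun H => exists n, H = fun v : {ffun 'I_m.+1 -> R} => stage n v).
- by eexists; exists 0%N.
- move=> _ [n ->]; split; last first.
    rewrite /pullback; apply: tame_ext (tame_stage n (var 0%N)) => v.
    by rewrite (_ : (fun j => block v 0 j) = pi (block v 0)) //; apply/funext => j; rewrite ffunE.
  split.
    exists (fun=> 0); split=> //.
    - by case: (scalar0 prD pr_ann prP).
    - by case: (scalar0 prD pr_ann prP) => _; apply.
    - by move=> j; rewrite ffunE subrr; exact: ann0.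
  move=> t t' [al [sa ea ae ca]] [be [sb eb be_e cb]].
  exists (fun x => al x - be x); split.
  - exact: prescalarB.
  - exact: extendsB.
  - by move=> x; rewrite ae be_e.
  - move=> j; rewrite !ffunE.
    have -> : t j - t' j - (al (s j) - be (s j)) = (t j - al (s j)) - (t' j - be (s j)).
      by rewrite !opprB addrACA [RHS]addrACA; congr (_ + _); exact: addrC.
    exact: annB (ca j) (cb j).
exists N => t tN.
have stageS n k u : (n <= k)%N -> stage k u -> stage n u.
  move=> /subnKC <-; elim: (k - n)%N => [|i IH]; first by rewrite addn0.
  (* The sum is lengthened by the product [0 ** 0]. *)
  rewrite addnS => -[al [sa ea ae ca]]; apply: IH; exists al; split=> // r rn r0.
  have := ea ((0, 0) :: r); rewrite /= rn !big_cons /= namulr0 r0 addr0.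
  by rewrite namulr0 add0r; apply.
have all_stage n : stage n t.
  have sN : stage (maxn n N) (pi t).
    apply: (Hmin (fun v : {ffun 'I_m.+1 -> R} => stage (maxn n N) v)).
    - by exists (maxn n N).
    - by move=> v; apply: stageS; rewrite leq_maxr.
    - by rewrite (_ : (pi t : 'I_m.+1 -> R) = t) //; apply/funext => j; rewrite ffunE.
  apply: (@stageS _ (maxn n N)); first by rewrite leq_maxl.
  by move: sN; rewrite (_ : (pi t : 'I_m.+1 -> R) = t) //; apply/funext => j; rewrite ffunE.
(* Each stage supplies a map of its own, but [t] codes only one prescalar, so that the map of stage
   0 passes all stages. *)
have [al [sa ea ae ca]] := all_stage 0%N.
exists al; split=> //; split=> // n.
have [be [sb eb _ cb]] := all_stage n.
by rewrite (codes_inj sa sb ca cb).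
Qed.

Hypothesis e_neq0 : exists x, e x != 0.
Notation corner_e := (corner prD pr_ann prP e_scalar e_idem e_neq0).

(** An element of the corner is coded by its values on [s]. By [stage_stable] the set of codes is
    definable; all other tuples stand for 0. Equality, sum and product are expressed through graphs
    modulo [ann]. *)
Lemma corner_tame : exists Dc : ((nat -> corner_e) -> Prop) -> Prop, tame_ring Dc.
Proof.
have [N NP] := stage_stable.
pose dom t := exists a : corner_e, codes t (corner_fun a).
have domE t : dom t <-> stage N t.
  split=> [[a ca]|/NP[al [sa ae ca]]]; last by exists (@Corner _ pr e al sa ae).
  have [sa ea] := corner_scalar a.
  by exists (corner_fun a); split=> //; apply: cornerP.
pose pi t : corner_e := if pselect (dom t) is left H then sval (cid H) else 0.
have piP t : dom t -> codes t (corner_fun (pi t)).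
  by move=> dt; rewrite /pi; case: pselect => // H; case: cid.
have pi0 t : ~ dom t -> pi t = 0 by rewrite /pi; case: pselect.
have presc (a : corner_e) : prescalar pr (corner_fun a) by case: (corner_scalar a).
have pi_surj a : exists t, pi t = a.
  have [t ta] := codes_ex (corner_fun a); exists t.
  apply: corner_inj => x; rewrite (codes_inj (presc (pi t)) (presc a) _ ta) //.
  by apply: piP; exists a.
(* The definable form of equality of [y] with [pi t x] modulo [ann]; the second case is that of the
   tuples sent to 0. *)
pose F t x y := stage N t /\ graph t x y \/ ~ stage N t /\ ann y.
have FP t x y : F t x y <-> ann (y - corner_fun (pi t) x).
  rewrite /F -domE; case: (pselect (dom t)) => dt.
    have := graphP x y (presc (pi t)) (piP _ dt).
    by split=> [[[_ /H]|[]]|/H] //; left.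
  by rewrite pi0 //= subr0; split=> [[[]|[]]|] //; right.
have Fval t x : F t x (corner_fun (pi t) x) by apply/FP; rewrite subrr; exact: ann0.
have var i : tame_fun D (fun v => v i) by apply: tame_fun_var.
have Dann G : tame_fun D G -> D (fun v => ann (G v)).
  move=> DG; apply: (tame_all tD (X := fun v y => G v ** y = 0 /\ y ** G v = 0)).
  have DG' := tame_fun_ren tD succn DG; have cst := tame_fun_cst tD.
  by apply: (tame_and tD); apply: (tame_eq_fun tD) => //; apply: tame_fun_namul.
have DF (t : 'I_m.+1 -> (nat -> R) -> R) G H :
    (forall j, tame_fun D (t j)) -> tame_fun D G -> tame_fun D H ->
    D (fun v => F (fun j => t j v) (G v) (H v)).
  move=> Dt DG DH; have Ds := tame_stage N Dt; apply: (tame_or tD).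
    exact: (tame_and tD Ds (tame_graph Dt DG DH)).
  exact: (tame_and tD (tame_not tD Ds) (Dann _ DH)).
have bvar k (i : nat) (j : 'I_m.+1) : tame_fun D (fun v => block (fun n => v (k + n)%N) i j).
  exact: tame_fun_var.
exists (pullback D pi); split.
- apply: tame_interpretation => //; rewrite /pullback.
  have DX : D (fun v => forall x y, F (block v 0) x y -> F (block v 1) x y).
    apply: (tame_all tD (X := fun v x => forall y, F (block v 0) x y -> F (block v 1) x y)).
    apply: (tame_all tD (X := fun v y => F (block (fun n => v (1 + n)%N) 0) (v 0%N) y ->
      F (block (fun n => v (1 + n)%N) 1) (v 0%N) y)).
    apply: (tame_imp tD).
      exact: (DF _ _ _ (bvar 2 0%N) (var 1%N) (var 0%N)).
    exact: (DF _ _ _ (bvar 2 1%N) (var 1%N) (var 0%N)).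
  apply: tame_ext DX => v; split=> [H|H x y /FP]; last by rewrite H => /FP.
  apply: corner_inj => x; have /FP/(pr_eq prD pr_ann) := H _ _ (Fval (block v 0) x).
  by rewrite !(sc_im (presc _)).
- rewrite /pullback.
  have DX : D (fun v => forall x y z, F (block v 0) x y -> F (block v 1) x z ->
     F (block v 2) x (y + z)).
    apply: (tame_all tD (X := fun v x => forall y z, F (block v 0) x y ->
      F (block v 1) x z -> F (block v 2) x (y + z))).
    apply: (tame_all tD (X := fun v y => forall z, F (block (fun n => v (1 + n)%N) 0) (v 0%N) y ->
      F (block (fun n => v (1 + n)%N) 1) (v 0%N) z ->
      F (block (fun n => v (1 + n)%N) 2) (v 0%N) (y + z))).
    apply: (tame_all tD (X := fun v z => F (block (fun n => v (2 + n)%N) 0) (v 1%N) (v 0%N) ->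
      F (block (fun n => v (2 + n)%N) 1) (v 1%N) z ->
      F (block (fun n => v (2 + n)%N) 2) (v 1%N) (v 0%N + z))).
    apply: (tame_imp tD); first exact: (DF _ _ _ (bvar 3 0%N) (var 2%N) (var 1%N)).
    apply: (tame_imp tD); first exact: (DF _ _ _ (bvar 3 1%N) (var 2%N) (var 0%N)).
    exact: (DF _ _ _ (bvar 3 2%N) (var 2%N) (tame_fun_add tD D_add (var 1%N) (var 0%N))).
  apply: tame_ext DX => v; split=> [H|H x y z /FP Fy /FP Fz].
    apply: corner_inj => x.
    have /FP/(pr_eq prD pr_ann) := H _ _ _ (Fval (block v 0) x) (Fval (block v 1) x).
    by rewrite prD !(sc_im (presc _)).
  apply/FP; rewrite -H corner_addE opprD addrACA.
  exact: annD.
- rewrite /pullback.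
  have DX : D (fun v => forall x y z, F (block v 1) x y -> F (block v 0) y z ->
     F (block v 2) x z).
    apply: (tame_all tD (X := fun v x => forall y z, F (block v 1) x y ->
      F (block v 0) y z -> F (block v 2) x z)).
    apply: (tame_all tD (X := fun v y => forall z, F (block (fun n => v (1 + n)%N) 1) (v 0%N) y ->
      F (block (fun n => v (1 + n)%N) 0) y z ->
      F (block (fun n => v (1 + n)%N) 2) (v 0%N) z)).
    apply: (tame_all tD (X := fun v z => F (block (fun n => v (2 + n)%N) 1) (v 1%N) (v 0%N) ->
      F (block (fun n => v (2 + n)%N) 0) (v 0%N) z ->
      F (block (fun n => v (2 + n)%N) 2) (v 1%N) z)).
    apply: (tame_imp tD); first exact: (DF _ _ _ (bvar 3 1%N) (var 2%N) (var 1%N)).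
    apply: (tame_imp tD); first exact: (DF _ _ _ (bvar 3 0%N) (var 1%N) (var 0%N)).
    exact: (DF _ _ _ (bvar 3 2%N) (var 2%N) (var 0%N)).
  apply: tame_ext DX => v; split=> [H|H x y z /FP/(pr_eq prD pr_ann) Fy /FP Fz].
    apply: corner_inj => x.
    have /FP/(pr_eq prD pr_ann) := H _ _ _ (Fval (block v 1) x)
      (Fval (block v 0) (corner_fun (pi (block v 1)) x)).
    by rewrite !(sc_im (presc _)).
  apply/FP; rewrite -H corner_mulE; move: Fy; rewrite (sc_im (presc _)) => <-.
  by rewrite (sc_pr (presc _)).
Qed.

End CornerTame.

Hypothesis R_char0 : forall x n, (0 < n)%N -> x *+ n = 0 -> x = 0 :> R.

Definition primitive_idempotent e : Prop :=
  [/\ scalar pr e, forall x, e (e x) = e x, (exists x, e x != 0) &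
    forall f, scalar pr f -> (forall x, f (f x) = f x) -> (forall x, f (e x) = f x) ->
      (forall x, f x = 0) \/ (forall x, f x = e x)].

Lemma primitive_closed_field e : primitive_idempotent e ->
  exists (k : closedFieldType) (f : k -> R -> R),
    [/\ [pchar k] =i pred0, forall a, scalar pr (f a) /\ forall x, f a (e x) = f a x,
      forall a b x, f (a + b) x = f a x + f b x,
      forall a b x, f (a * b) x = f a (f b x) & forall x, f 1 x = e x].
Proof.
move=> [e_sc e_idem e_neq0 e_prim].
have [Dc tDc] := corner_tame e_sc e_idem e_neq0.
have [||k [f [k0 fD fM f1]]] := local_ring_closed_subfield tDc.
- move=> n; apply/eqP => /(congr1 (fun a => corner_fun a)) n0.
  have [x] := e_neq0; rewrite (R_char0 (n := n.+1) (x := e x)) ?eqxx //.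
  by have := congr1 (@^~ x) n0; rewrite corner_natE.
- move=> a aa; have [|x|x|a0|a1] := e_prim (corner_fun a).
  + exact: corner_scalar.
  + by rewrite -corner_mulE aa.
  + exact: cornerP.
  + by left; apply: corner_inj.
  + by right; apply: corner_inj => x; rewrite a1.
exists k, (fun a => corner_fun (f a)); split=> //.
- by move=> a; split; [apply: corner_scalar | apply: cornerP].
- by move=> a b x; rewrite fD.
- by move=> a b x; rewrite fM.
- by move=> x; rewrite f1.
Qed.

Definition orthogonal_primitives n (es : 'I_n -> R -> R) e : Prop :=
  [/\ forall i, primitive_idempotent (es i),
      forall i j x, i != j -> es i (es j x) = 0
    & forall x, \sum_i es i x = e x].

Lemma orthogonal_primitives_absorb n (es : 'I_n -> R -> R) e i x :
  orthogonal_primitives es e -> es i (e x) = es i x /\ e (es i x) = es i x.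
Proof.
move=> [prim orth sum_e]; have [[psc _] idem _ _] := prim i.
rewrite -!sum_e (additive_sum _ _ (scD psc)); split;
  by rewrite (bigD1 i) //= idem big1 ?addr0 // => j ji; apply: orth; rewrite // eq_sym.
Qed.

Lemma orthogonal_primitives_cat n1 n2 (es1 : 'I_n1 -> R -> R) (es2 : 'I_n2 -> R -> R) g h :
  orthogonal_primitives es1 g -> orthogonal_primitives es2 h ->
  (forall x, g (h x) = 0) -> (forall x, h (g x) = 0) ->
  orthogonal_primitives
    (fun i => match fintype.split i with inl j => es1 j | inr j => es2 j end)
    (fun x => g x + h x).
Proof.
move=> P1 P2 gh hg; have [prim1 orth1 sum1] := P1; have [prim2 orth2 sum2] := P2.
have zero1 i : es1 i 0 = 0 by have [[/scD/additive0]] := prim1 i.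
have zero2 i : es2 i 0 = 0 by have [[/scD/additive0]] := prim2 i.
split=> [i|i j x ij|x]; first by case: fintype.split.
- rewrite -[i]fintype.splitK -[j]fintype.splitK in ij *; rewrite !unsplitK.
  move: ij; case: (fintype.split i) => i'; case: (fintype.split j) => j' /= ij.
  + by apply: orth1; apply: contra ij => /eqP ->.
  + have [<- _] := orthogonal_primitives_absorb i' (es2 j' x) P1.
    by have [_ <-] := orthogonal_primitives_absorb j' x P2; rewrite gh.
  + have [<- _] := orthogonal_primitives_absorb i' (es1 j' x) P2.
    by have [_ <-] := orthogonal_primitives_absorb j' x P1; rewrite hg.
  + by apply: orth2; apply: contra ij => /eqP ->.
- rewrite big_split_ord -sum1 -sum2; congr (_ + _); apply: eq_bigr => i _.
    by rewrite (unsplitK (inl _ i)).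
  by rewrite (unsplitK (inr _ i)).
Qed.

(** Among the idempotents without decomposition choose [f] such that the group of elements fixed by
    [f] modulo [ann] is minimal. It is neither 0 nor primitive, so it is the sum of orthogonal
    idempotents [g] and [f - g] with smaller groups, whose decompositions can be joined. *)
Lemma idempotent_decomposition e : scalar pr e -> (forall x, e (e x) = e x) ->
  exists n (es : 'I_n -> R -> R), orthogonal_primitives es e.
Proof.
move=> e_sc e_id; apply: contrapT => bad_e.
pose bad f := [/\ scalar pr f, forall x, f (f x) = f x &
  ~ exists n (es : 'I_n -> R -> R), orthogonal_primitives es f].
have [||H [f [[f_sc f_id f_bad] ->]] Hmin] := minimal_subgroup (D := D) tD D_add
  (F := fun H => exists f, bad f /\ H = fun x => ann (x - f x)).
- by eexists; exists e.
- move=> _ [f [[[f_sc _] f_id _] ->]]; split.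
    split=> [|x y xa ya]; first by rewrite (additive0 (scD f_sc)) subrr; exact: ann0.
    have -> : x - y - f (x - y) = (x - f x) - (y - f y).
      by rewrite (additiveB _ _ (scD f_sc)) !opprB addrACA [RHS]addrACA; congr (_ + _); exact: addrC.
    exact: annB.
  (* A code of [f] supplies the parameters that define the group. *)
  have [t tf] := codes_ex f.
  have var0 := tame_fun_var tD 0.
  have := tame_graph (t := fun j _ => t j) (fun j => tame_fun_cst tD (t j)) var0 var0.
  by apply: tame_ext => v; exact: graphP.
have smaller g : scalar pr g -> (forall x, g (g x) = g x) -> (forall x, f (g x) = g x) ->
    (exists x, f x != g x) -> exists n (es : 'I_n -> R -> R), orthogonal_primitives es g.
  move=> g_sc g_id fg [x fgx]; apply: contrapT => g_bad.
  have [psf _] := f_sc; have [psg _] := g_sc.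
  have := Hmin (fun x => ann (x - g x)) (ex_intro _ g (conj (And3 g_sc g_id g_bad) erefl)).
  have gf z : g (f z) = g z by rewrite (scalar_comm prD pr_ann z psg f_sc).
  have sub z : ann (z - g z) -> ann (z - f z).
    move=> za; have prz := pr_eq prD pr_ann za; rewrite (sc_im psg) in prz.
    by rewrite -(sc_pr psf) prz fg.
  have ann_f : ann (f x - f (f x)) by rewrite f_id subrr; exact: ann0.
  move=> /(_ sub (f x) ann_f)/(pr_eq prD pr_ann).
  rewrite (sc_im psf) (sc_im psg) gf => fxE.
  by rewrite fxE eqxx in fgx.
have [psf _] := f_sc.
have f_neq0 : exists x, f x != 0.
  apply: contrapT => f0; apply: f_bad; exists 0%N, (fun _ => f); split=> [[]//|[]//|x].
  rewrite big_ord0; apply/esym/eqP; apply: contrapT => /negP fx0; apply: f0; by exists x.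
have [g [g_sc g_id gf [x gx] [y gy]]] : exists g, [/\ scalar pr g,
    forall x, g (g x) = g x, forall x, g (f x) = g x, (exists x, g x != 0) &
    exists x, g x != f x].
  apply: contrapT => ng; apply: f_bad; exists 1%N, (fun _ => f); split=> [i|i j|x].
  - split=> // g g_sc g_id gf; apply: contrapT => /not_orP[g1 g2]; apply: ng.
    exists g; split=> //; apply: contrapT => nx; [apply: g1 | apply: g2] => x;
      by apply/eqP; apply: contrapT => /negP ?; apply: nx; exists x.
  - by rewrite !ord1.
  - by rewrite big_ord1.
have [psg _] := g_sc.
have fg z : f (g z) = g z by rewrite (scalar_comm prD pr_ann z psf g_sc).
have [|n1 [es1 P1]] := smaller g g_sc g_id fg; first by exists y; rewrite eq_sym.
have h_sc : scalar pr (fun z => f z - g z) by apply: scalarB.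
have [|||n2 [es2 P2]] := smaller (fun z => f z - g z) h_sc.
- move=> z; rewrite (additiveB _ _ (scD psf)) (additiveB _ _ (scD psg)).
  by rewrite f_id fg gf g_id subrr subr0.
- by move=> z; rewrite (additiveB _ _ (scD psf)) f_id fg.
- by exists x; rewrite -subr_eq0 opprB addrC subrK.
apply: f_bad; exists (n1 + n2)%N; eexists.
have := orthogonal_primitives_cat P1 P2; rewrite (_ : (fun x => _) = f); last first.
  by apply/funext => z; rewrite addrC subrK.
apply=> z; last by rewrite fg g_id subrr.
by rewrite (additiveB _ _ (scD psg)) gf g_id subrr.
Qed.

End ScalarsDefinable.

(** * Algebras from commuting actions *)

(** There is no unit law: [sc 1] is an idempotent, and the elements that it fixes form the vector
    space. *)
Record action (k : fieldType) (V : zmodType) (sc : k -> V -> V) : Prop := Action {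
  actDr : forall a, {morph sc a : x y / x + y};
  actDl : forall x, {morph sc^~ x : a b / a + b};
  actA : forall a b x, sc a (sc b x) = sc (a * b) x
}.

Section FixedPoints.

Variables (k : fieldType) (V : zmodType) (sc : k -> V -> V).
Hypothesis sc_act : action sc.

Definition fixed_pred (_ : action sc) : {pred V} := fun x => sc 1 x == x.
Notation Fp := (fixed_pred sc_act).

Lemma act0 a : sc a 0 = 0.
Proof. by apply: (@addrI _ (sc a 0)); rewrite -(actDr sc_act) !addr0. Qed.

Lemma actN a x : sc a (- x) = - sc a x.
Proof. by apply/eqP; rewrite -addr_eq0 -(actDr sc_act) addNr act0. Qed.

Lemma fixed_closed : zmod_closed Fp.
Proof.
split=> [|x y]; rewrite !unfold_in ?act0 // => /eqP Fx /eqP Fy.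
by rewrite (actDr sc_act) actN Fx Fy.
Qed.

HB.instance Definition _ := GRing.isZmodClosed.Build V Fp fixed_closed.

Record fixed_points := FixedPoint { fixed_val : V; _ : fixed_val \in Fp }.

HB.instance Definition _ := [isSub for fixed_val].
HB.instance Definition _ := [Choice of fixed_points by <:].
HB.instance Definition _ := [SubChoice_isSubZmodule of fixed_points by <:].

Lemma fixed_pointP (x : fixed_points) : sc 1 (val x) = val x.
Proof. by case: x => x /= /eqP. Qed.

Lemma act_fixed a x : sc a x \in Fp.
Proof. by rewrite unfold_in (actA sc_act) mul1r. Qed.

Definition to_fixed x : fixed_points := FixedPoint (act_fixed 1 x).

Lemma to_fixedD : {morph to_fixed : x y / x + y}.
Proof. by move=> x y; apply: val_inj; rewrite /= (actDr sc_act). Qed.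

Lemma to_fixedK x : to_fixed (val x) = x.
Proof. by apply: val_inj; rewrite /= fixed_pointP. Qed.

Definition fixed_scale a (x : fixed_points) : fixed_points :=
  FixedPoint (act_fixed a (val x)).

Lemma fixed_scaleA a b x : fixed_scale a (fixed_scale b x) = fixed_scale (a * b) x.
Proof. by apply: val_inj; rewrite /= (actA sc_act). Qed.
Lemma fixed_scale1 : left_id 1 fixed_scale.
Proof. by move=> x; apply: val_inj; rewrite /= fixed_pointP. Qed.
Lemma fixed_scaleDr : right_distributive fixed_scale +%R.
Proof. by move=> a x y; apply: val_inj; rewrite /= (actDr sc_act). Qed.
Lemma fixed_scaleDl x : {morph fixed_scale^~ x : a b / a + b}.
Proof. by move=> a b; apply: val_inj; rewrite /= (actDl sc_act). Qed.

HB.instance Definition _ := GRing.Zmodule_isLmodule.Build k fixed_points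
  fixed_scaleA fixed_scale1 fixed_scaleDr fixed_scaleDl.

End FixedPoints.

Record central_action (k : fieldType) (R : naRingType) (sc : k -> R -> R) : Prop :=
  CentralAction {
    central_act : action sc;
    central_mull : forall a x y, sc a (x ** y) = sc a x ** y;
    central_mulr : forall a x y, sc a (x ** y) = x ** sc a y
  }.

Section Component.

Variables (k : fieldType) (R : naRingType) (sc : k -> R -> R).
Hypothesis sc_central : central_action sc.

Definition component (c : central_action sc) : Type := fixed_points (central_act c).
Notation C := (component sc_central).

HB.instance Definition _ := GRing.Lmodule.on C.

Lemma component_closed (x y : C) : val x ** val y \in fixed_pred (central_act sc_central).
Proof. by rewrite unfold_in (central_mull sc_central) fixed_pointP. Qed.

Definition component_mul (x y : C) : C := FixedPoint (component_closed x y).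

Lemma component_mulDl : left_distributive component_mul +%R.
Proof. by move=> x y z; apply: val_inj; rewrite /= namulDl. Qed.
Lemma component_mulDr : right_distributive component_mul +%R.
Proof. by move=> x y z; apply: val_inj; rewrite /= namulDr. Qed.

HB.instance Definition _ :=
  Zmodule_isNonAssocRing.Build C component_mulDl component_mulDr.

Lemma component_scalel (a : k) (x y : C) : a *: (x ** y) = (a *: x) ** y.
Proof. by apply: val_inj; rewrite /= (central_mull sc_central). Qed.
Lemma component_scaler (a : k) (x y : C) : a *: (x ** y) = x ** (a *: y).
Proof. by apply: val_inj; rewrite /= (central_mulr sc_central). Qed.

HB.instance Definition _ :=
  Lmodule_isNonAssocAlgebra.Build k C component_scalel component_scaler.

End Component.

Section Decomposition.

Variable R : naRingType.
Variables (n : nat) (k : 'I_n -> fieldType) (sc : forall i : 'I_n, k i -> R -> R).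
Arguments sc : clear implicits.
Hypothesis sc_central : forall i, central_action (sc i).
Hypothesis sc_orth : forall i j a b x, i != j -> sc i a (sc j b x) = 0.
Variable sc0 : rat -> R -> R.
Hypothesis sc0_central : central_action sc0.
Hypothesis sc_sum : forall x, \sum_i sc i 1 x + sc0 1 x = x.
Hypothesis sc0_ann : forall a x, ann (sc0 a x).

Let rhoD i : {morph sc i 1 : x y / x + y}.
Proof. by case: (sc_central i) => -[]. Qed.

Let rho_idem i x : sc i 1 (sc i 1 x) = sc i 1 x.
Proof. by rewrite (actA (central_act (sc_central i))) mulr1. Qed.

Let rho_sum i j x : sc i 1 (sc j 1 x) = if i == j then sc j 1 x else 0.
Proof. by case: eqP => [->|/eqP]; [exact: rho_idem | exact: sc_orth]. Qed.

Let sc0_rho j x : sc0 1 (sc j 1 x) = 0.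
Proof.
have := sc_sum (sc j 1 x); under eq_bigr do rewrite rho_sum.
by rewrite -big_mkcond big_pred1_eq -{3}[sc j 1 x]addr0 => /addrI.
Qed.

Let rho_sc0 j x : sc j 1 (sc0 1 x) = 0.
Proof.
have := sc_sum (sc0 1 x); rewrite (actA (central_act sc0_central)) mulr1.
rewrite -{3}[sc0 1 x]add0r => /addIr /(congr1 (sc j 1)).
rewrite (additive_sum _ _ (rhoD j)) (additive0 (rhoD j)).
under eq_bigr do rewrite rho_sum.
by rewrite (bigD1 j) //= eqxx big1 ?addr0 // => i /negPf; rewrite eq_sym => ->.
Qed.

(** The idempotents [sc i 1] and [sc0 1] are orthogonal with sum the identity. Commuting with
    multiplications on either side, each is a ring homomorphism onto its component. *)
Lemma component_decomposition :
  ring_isomorphic R ({dffun forall i, component (sc_central i)} *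
    component sc0_central)%type.
Proof.
pose f x : {dffun forall i, component (sc_central i)} * component sc0_central :=
  ([ffun i => to_fixed (central_act (sc_central i)) x],
   to_fixed (central_act sc0_central) x).
exists f; split.
- exists (fun p : {dffun forall i, component (sc_central i)} * component sc0_central =>
    \sum_i val (p.1 i) + val p.2) => [x|[g r]].
    rewrite /f /= -[RHS]sc_sum; congr (_ + _).
    by apply: eq_bigr => i _; rewrite ffunE.
  have gE j : sc j 1 (val (g j)) = val (g j) by exact: fixed_pointP.
  have rE : sc0 1 (val r) = val r by exact: fixed_pointP.
  congr pair; last first.
    apply: val_inj; rewrite /= (actDr (central_act sc0_central)) rE.
    rewrite (additive_sum _ _ (actDr (central_act sc0_central) 1)).
    by rewrite big1 ?add0r // => i _; rewrite -gE sc0_rho.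
  apply/ffunP => j; rewrite ffunE; apply: val_inj => /=.
  rewrite rhoD -rE rho_sc0 addr0 (additive_sum _ _ (rhoD j)).
  rewrite (bigD1 j) //= gE big1 ?addr0 // => i ij.
  by rewrite -gE rho_sum eq_sym (negPf ij).
- move=> x y; congr pair; last exact: to_fixedD.
  by apply/ffunP => i; rewrite !ffunE; exact: to_fixedD.
- move=> x y; congr pair.
    apply/ffunP => i; rewrite !ffunE; apply: val_inj => /=.
    have [_ mull mulr] := sc_central i.
    by rewrite -mull -mulr rho_idem.
  apply: val_inj => /=; have [_ mull _] := sc0_central.
  by rewrite mull; case: (sc0_ann 1 x y) => -> _; case: (sc0_ann 1 x (sc0 1 y)) => ->.
Qed.

Lemma component0_mul (x y : component sc0_central) : x ** y = 0.
Proof.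
apply: val_inj => /=.
by have := sc0_ann 1 (val x) (val y); rewrite fixed_pointP => -[].
Qed.

End Decomposition.

Section Indecomposable.

Variables (k : fieldType) (R : naRingType) (sc : k -> R -> R).
Hypothesis sc_central : central_action sc.
Hypothesis sc_prim : forall rho : R -> R, {morph rho : x y / x + y} ->
  (forall x y, rho (x ** y) = rho x ** y) -> (forall x y, rho (x ** y) = x ** rho y) ->
  (forall x, rho (rho x) = rho x) -> (forall x, sc 1 (rho x) = rho x) ->
  (forall x, rho (sc 1 x) = rho x) ->
  (forall x, rho x = 0) \/ (forall x, rho x = sc 1 x).

(** The projection of a product [B * C] onto [B], transported to [R], is a central idempotent [rho]
    below [sc 1]. By [sc_prim] it is 0 or [sc 1], which kills [b] or [c]. *)
Lemma component_indecomposable : indecomposable (component sc_central).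
Proof.
move=> [B [C [[b [b0 [c [c0]]]]]]]; move=> [phi [[psi phiK psiK] phiD phiM phiZ]].
have act := central_act sc_central.
have psiD : {morph psi : x y / x + y}.
  by move=> x y; apply: (can_inj phiK); rewrite phiD !psiK.
pose fx : R -> component sc_central := to_fixed (central_act sc_central).
have fxD : {morph fx : x y / x + y} by exact: to_fixedD.
pose left (p : B * C) : B * C := (p.1, 0).
pose rho x : R := val (psi (left (phi (fx x)))).
have val_fx x : val (fx x) = sc 1 x by [].
have fxM x y : fx (x ** y) = fx x ** fx y.
  apply: val_inj => /=; have [_ mull mulr] := sc_central.
  by rewrite -mull -mulr (actA act) mulr1.
have valM (x y : component sc_central) : val (x ** y) = val x ** val y by [].
have fx_val (x : component sc_central) : fx (val x) = x by exact: to_fixedK.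
have psiM x y : psi (x ** y) = psi x ** psi y.
  by apply: (can_inj phiK); rewrite phiM !psiK.
have phi0 : phi 0 = 0 by apply: (@addrI _ (phi 0)); rewrite -phiD !addr0.
have leftD p q : left (p + q) = left p + left q.
  by congr pair; rewrite /= addr0.
have leftl p q : left (p ** q) = left p ** q.
  by congr pair; rewrite /= ?namul0r.
have leftr p q : left (p ** q) = p ** left q.
  by congr pair; rewrite /= ?namulr0.
have val_ann (u : component sc_central) y : val u ** sc 1 y = val u ** y /\
    sc 1 y ** val u = y ** val u.
  have [_ mull mulr] := sc_central.
  by split; [rewrite -mulr mull fixed_pointP | rewrite -mull mulr fixed_pointP].
have [||||||rho0|rho1] := sc_prim (rho := rho).
- by move=> x y; rewrite /rho fxD phiD leftD psiD.
- move=> x y; rewrite /rho fxM phiM leftl psiM valM phiK val_fx.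
  by case: (val_ann (psi (left (phi (fx x)))) y).
- move=> x y; rewrite /rho fxM phiM leftr psiM valM phiK val_fx.
  by case: (val_ann (psi (left (phi (fx y)))) x).
- by move=> x; rewrite /rho fx_val psiK.
- by move=> x; rewrite fixed_pointP.
- by move=> x; rewrite /rho; congr (val (psi (left (phi _)))); apply: val_inj; rewrite /= (actA act) mulr1.
- have := rho0 (val (psi (b, 0))); rewrite /rho fx_val psiK.
  move/(@val_inj _ _ _ _ 0)/(congr1 phi); rewrite psiK phi0 => /(congr1 fst) /= bE.
  by rewrite bE eqxx in b0.
- have := rho1 (val (psi (0, c))); rewrite /rho fx_val psiK fixed_pointP.
  move/val_inj/(congr1 phi); rewrite !psiK => /(congr1 snd) /= cE.
  by rewrite -cE eqxx in c0.
Qed.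

End Indecomposable.

(** * Lifting the action of the scalars *)

Section SquareSpace.

Variables (R : naRingType) (pr : R -> R).
Hypothesis prD : additive_fun pr.
Hypothesis pr_ann : forall x, ann x -> pr x = 0.
Hypothesis prP : forall x, ann (x - pr x).
Implicit Types (x y : R) (al be : R -> R) (r : seq (R * R)).

Definition sqsum r : R := \sum_(p <- r) p.1 ** p.2.
Definition square x : Prop := exists r, x = sqsum r.

Lemma square_mul x y : square (x ** y).
Proof. by exists [:: (x, y)]; rewrite /sqsum big_seq1. Qed.

Lemma squareD x y : square x -> square y -> square (x + y).
Proof. by move=> [r ->] [r' ->]; exists (r ++ r'); rewrite /sqsum big_cat. Qed.

Lemma square0 : square 0.
Proof. by exists [::]; rewrite /sqsum big_nil. Qed.

Lemma sqsum_map f r : {morph f : x y / x + y} ->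
  (forall x y, f (x ** y) = f x ** y) ->
  sqsum [seq (f p.1, p.2) | p <- r] = f (sqsum r).
Proof.
move=> fD fM; rewrite /sqsum big_map (additive_sum _ _ fD).
by apply: eq_bigr => p _; rewrite fM.
Qed.

Lemma square_sum (I : Type) (s : seq I) (F : I -> R) :
  (forall i, square (F i)) -> square (\sum_(i <- s) F i).
Proof.
move=> sF; elim: s => [|i s IH]; rewrite ?big_nil ?big_cons; first exact: square0.
exact: squareD.
Qed.

(* The extension of a scalar to [R ** R]; it is only meaningful there. *)
Definition extend_scalar al x : R :=
  if pselect (square x) is left H then
    sqsum [seq (al p.1, p.2) | p <- sval (cid H)] else 0.

(** Independence of the chosen representation: [extends] is applied to that representation followed
    by the negative of [r], a sum with value 0. *)
Lemma extend_scalarE al r : scalar pr al ->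
  extend_scalar al (sqsum r) = sqsum [seq (al p.1, p.2) | p <- r].
Proof.
move=> [sa ea]; rewrite /extend_scalar; case: pselect => [H|[]]; last by exists r.
case: cid => r' /= rE; apply/eqP; rewrite -subr_eq0.
have := ea (size (r' ++ [seq (- p.1, p.2) | p <- r])) _ erefl.
rewrite !big_cat !big_map /=.
have -> : \sum_(p <- r) (- p.1) ** p.2 = - sqsum r.
  by rewrite /sqsum -sumrN; apply: eq_bigr => p _; rewrite namulNl.
have -> : \sum_(p <- r) al (- p.1) ** p.2 = - sqsum [seq (al p.1, p.2) | p <- r].
  rewrite /sqsum big_map -sumrN; apply: eq_bigr => p _.
  by rewrite (additiveN _ (scD sa)) namulNl.
rewrite -/(sqsum r') rE subrr => /(_ erefl) E.
by rewrite -E /sqsum big_map.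
Qed.

Lemma extend_mul al x y : scalar pr al -> extend_scalar al (x ** y) = al x ** y.
Proof.
move=> sa; have := extend_scalarE [:: (x, y)] sa.
by rewrite /sqsum /= !big_seq1.
Qed.

Lemma extend_square al x : square (extend_scalar al x).
Proof.
rewrite /extend_scalar; case: pselect => [H|_]; last exact: square0.
by eexists.
Qed.

Lemma extendD al x y : scalar pr al -> square x -> square y ->
  extend_scalar al (x + y) = extend_scalar al x + extend_scalar al y.
Proof.
move=> sa [r ->] [r' ->].
have -> : sqsum r + sqsum r' = sqsum (r ++ r') by rewrite /sqsum big_cat.
by rewrite !extend_scalarE // map_cat /sqsum big_cat.
Qed.

Lemma extend_addl al be x : scalar pr al -> scalar pr be -> square x ->
  extend_scalar (fun z => al z + be z) x = extend_scalar al x + extend_scalar be x.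
Proof.
move=> sa sb [r ->]; rewrite !extend_scalarE //; last exact: scalarD.
rewrite /sqsum !big_map -big_split; apply: eq_bigr => p _ /=.
by rewrite namulDl.
Qed.

Lemma extend_comp al be x : scalar pr al -> scalar pr be -> square x ->
  extend_scalar (al \o be) x = extend_scalar al (extend_scalar be x).
Proof.
move=> sa sb [r ->]; rewrite !extend_scalarE //; last exact: scalar_comp.
by congr sqsum; rewrite -map_comp.
Qed.

Lemma extend_pr x : square x -> extend_scalar pr x = x.
Proof.
move=> [r ->]; rewrite extend_scalarE; last exact: scalar_pr.
by rewrite /sqsum big_map; apply: eq_bigr => p _; rewrite (pr_mull prP).
Qed.

Lemma extend_zero x : square x -> extend_scalar (fun=> 0) x = 0.
Proof.
move=> [r ->]; rewrite extend_scalarE; last exact: scalar0.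
by rewrite /sqsum big_map big1 // => p _; rewrite namul0r.
Qed.

Lemma pr_extend al x : scalar pr al -> square x -> pr (extend_scalar al x) = al x.
Proof.
move=> sal [r ->]; have [sa _] := sal; rewrite extend_scalarE // /sqsum big_map.
rewrite (additive_sum _ _ prD) (additive_sum _ _ (scD sa)).
by apply: eq_bigr => p _; rewrite (sc_prod sa).
Qed.

Lemma extend_eq al be x : (forall z, al z = be z) -> extend_scalar al x = extend_scalar be x.
Proof. by move=> /funext ->. Qed.

Lemma extend_sum (I : Type) (s : seq I) (F : I -> R -> R) x :
  (forall i, scalar pr (F i)) -> square x ->
  extend_scalar (fun z => \sum_(i <- s) F i z) x = \sum_(i <- s) extend_scalar (F i) x.
Proof.
move=> sF sx; elim: s => [|i s IH].
  rewrite big_nil (extend_eq (be := fun=> 0)) ?extend_zero // => z.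
  by rewrite big_nil.
have sS : scalar pr (fun z => \sum_(j <- s) F j z).
  elim: s {IH} => [|j s IHs].
    rewrite (_ : (fun=> _) = (fun=> 0)); first exact: scalar0.
    by apply/funext => z; rewrite big_nil.
  rewrite (_ : (fun=> _) = (fun z => F j z + \sum_(i <- s) F i z)); first exact: scalarD.
  by apply/funext => z; rewrite big_cons.
rewrite big_cons -IH -extend_addl //; apply: extend_eq => z.
by rewrite big_cons.
Qed.

End SquareSpace.

(** * Projections over the rationals *)

Section RationalProjections.

Variable R : naRingType.
Hypothesis R_div : forall m (x : R), (0 < m)%N -> exists y, y *+ m = x.
Hypothesis R_tf : forall m (x : R), (0 < m)%N -> x *+ m = 0 -> x = 0.
Notation rat_scale := (rat_scale R_div).

Lemma additive_rat_scale (f : R -> R) q x : additive_fun f ->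
  f (rat_scale q x) = rat_scale q (f x).
Proof.
move=> fD; have d0 : (0 < `|denq q|)%N by rewrite absz_gt0 denq_neq0.
have qd : q * `|denq q|%:R = (numq q)%:~R.
  have -> : (`|denq q|%N)%:R = (denq q)%:~R :> rat by rewrite -absz_denq.
  by rewrite -{1}[q]divq_num_den divfK // intr_eq0 denq_neq0.
apply/esym/(@rat_scale_unique _ R_div R_tf _ _ _ _ _ d0 qd).
rewrite -additiveMn // (@rat_scaleP _ R_div R_tf _ _ _ _ d0 qd).
have fN := fun z => additiveN z fD.
by case: (numq q) => j; rewrite ?NegzE ?mulrNz ?fN -!pmulrn additiveMn.
Qed.

Lemma rat_scale_mull q x y : rat_scale q (x ** y) = rat_scale q x ** y.
Proof.
apply/esym; apply: (additive_rat_scale (f := fun z => z ** y)) => u v.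
exact: namulDl.
Qed.

Lemma rat_scale_mulr q x y : rat_scale q (x ** y) = x ** rat_scale q y.
Proof.
apply/esym; apply: (additive_rat_scale (f := fun z => x ** z)) => u v.
exact: namulDr.
Qed.

Lemma rat_scale0 q : rat_scale q 0 = 0.
Proof.
apply: (@addrI _ (rat_scale q 0)).
by rewrite -(rat_scaleDr R_div R_tf) !addr0.
Qed.

Lemma ann_rat_scale q x : ann x -> ann (rat_scale q x).
Proof.
move=> ax y; rewrite -rat_scale_mull -rat_scale_mulr.
by have [-> ->] := ax y; rewrite rat_scale0.
Qed.

Lemma square_rat_scale q x : square x -> square (rat_scale q x).
Proof.
move=> [r ->]; exists [seq (rat_scale q p.1, p.2) | p <- r].
rewrite (sqsum_map (f := rat_scale q)) // => u v.
  exact: rat_scaleDr.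
exact: rat_scale_mull.
Qed.

Notation V := (rat_module R_div R_tf).

Lemma submodule_ann : @submodule rat V (@ann R).
Proof.
split=> [|a x y ax ay]; first exact: ann0.
by apply: annD => //; apply: ann_rat_scale.
Qed.

Lemma submodule_square : @submodule rat V (@square R).
Proof.
split=> [|a x y sx sy]; first exact: square0.
by apply: squareD => //; apply: square_rat_scale.
Qed.

Lemma submodule_zero : @submodule rat V (fun x => x = 0).
Proof. by split=> // a x y -> ->; rewrite scaler0 addr0. Qed.

Lemma exists_pr : exists pr : R -> R, [/\ additive_fun pr,
  forall x, ann x -> pr x = 0 & forall x, ann (x - pr x)].
Proof.
have [x _ ->//|q [qD _ qann q_id _]] := exists_projection submodule_ann submodule_zero.
exists (fun x => x - q x); split.
- by move=> x y /=; rewrite qD opprD addrACA.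
- by move=> x ax; rewrite q_id ?subrr.
- by move=> x; rewrite opprB addrC subrK; apply: qann.
Qed.

(** [nu] projects onto the annihilating elements of [R ** R], and its kernel within [ann] is a
    complement of these in [ann]. Letting [theta] vanish on that complement makes it agree with [nu]
    on [ann], whence it preserves [ann]. *)
Lemma exists_square_projection : exists theta : R -> R, [/\ additive_fun theta,
  forall x, square (theta x), forall x, square x -> theta x = x
  & forall x, ann x -> ann (theta x)].
Proof.
have subZ : @submodule rat V (fun x => square x /\ ann x).
  split=> [|a x y [sx ax] [sy ay]]; first by split; [exact: square0 | exact: ann0].
  by split; [apply: submodule_square.2 | apply: submodule_ann.2].
have [x _ ->//|nu [nuD nuZ nu_im nu_id _]] := exists_projection subZ submodule_zero.
have subM : @submodule rat V (fun x => ann x /\ nu x = 0).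
  split=> [|a x y [ax nx] [ay ny]]; first by split; [exact: ann0 | apply: additive0].
  split; first exact: submodule_ann.2.
  by rewrite nuD nuZ nx ny scaler0 addr0.
have [x sx [ax nx]|theta [tD _ t_im t_id t_M]] := exists_projection submodule_square subM.
  by rewrite -(nu_id x).
exists theta; split=> // x ax; have [snx anx] := nu_im x.
have -> : theta x = nu x.
  have -> : theta x = theta (nu x) + theta (x - nu x) by rewrite -tD addrC subrK.
  rewrite t_id // t_M ?addr0 //; split; first exact: annB.
  by rewrite (additiveB _ _ nuD) (nu_id (nu x)) // subrr.
exact: anx.
Qed.

End RationalProjections.

Section Lift.

Variable R : naRingType.
Variable pr : R -> R.
Hypothesis prD : additive_fun pr.
Hypothesis pr_ann : forall x, ann x -> pr x = 0.
Hypothesis prP : forall x, ann (x - pr x).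
Variable theta : R -> R.
Hypothesis thetaD : additive_fun theta.
Hypothesis theta_square : forall x, square (theta x).
Hypothesis theta_id : forall x, square x -> theta x = x.
Hypothesis theta_ann : forall x, ann x -> ann (theta x).
Variables (n : nat) (es : 'I_n -> R -> R).
Hypothesis es_prim : orthogonal_primitives pr es pr.
Variables (k : 'I_n -> fieldType) (io : forall i : 'I_n, k i -> R -> R).
Arguments io : clear implicits.
Hypothesis io_scalar : forall i a, scalar pr (io i a).
Arguments io_scalar : clear implicits.
Hypothesis io_es : forall i a x, io i a (es i x) = io i a x.
Hypothesis ioD : forall i a b x, io i (a + b) x = io i a x + io i b x.
Hypothesis ioM : forall i a b x, io i (a * b) x = io i a (io i b x).
Hypothesis io1 : forall i x, io i 1 x = es i x.

Let es_scalar i : scalar pr (es i). Proof. by case: es_prim => /(_ i)[]. Qed.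

Let io_presc i a : prescalar pr (io i a). Proof. by case: (io_scalar i a). Qed.
Arguments io_presc : clear implicits.

Let es_io i a x : es i (io i a x) = io i a x.
Proof. by rewrite -io1 -ioM mul1r. Qed.

Let io_orth i j a b x : i != j -> io i a (io j b x) = 0.
Proof.
move=> ij; rewrite -(io_es a) -(es_io b x); case: es_prim => _ orth _.
by rewrite orth // (additive0 (scD (io_presc i a))).
Qed.

Let io_action i : action (io i).
Proof.
split=> [a x y|x a b|a b x]; [exact: scD (io_presc i a) _ _ | exact: ioD | by rewrite ioM].
Qed.

(* The kernel of [q] in [pr R] is a complement of [pr (R ** R)] stable under all
   the fields. *)
Lemma exists_square_complement : exists q : R -> R, [/\ additive_fun q,
  forall i a x, q (io i a x) = io i a (q x), forall x, exists2 y, square y & q x = pr y,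
  forall x, square x -> q x = pr x & forall x, q (pr x) = q x].
Proof.
have es_sum x : \sum_i es i x = pr x by case: es_prim.
(* The part of [R / ann R] that belongs to [es i], as a vector space over [k i]; [N i] is the image
   of [R ** R] in it. *)
pose F i : lmodType (k i) := fixed_points (io_action i).
pose N i (x : F i) := exists2 y, square y & val x = es i y.
have subN i : submodule (@N i).
  split; first by exists 0; rewrite ?(additive0 (scD (es_scalar i).1)) //; exact: square0.
  move=> a x x' [y sy xy] [y' sy' xy'].
  exists (extend_scalar (io i a) y + y'); first by apply: squareD => //; apply: extend_square.
  rewrite (scD (es_scalar i).1) /= xy xy' io_es; congr (_ + _).
  by rewrite -(sc_pr (es_scalar i).1) (pr_extend prD) // es_io.
have sub0 i : submodule (fun x : F i => x = 0).
  by split=> // a x y -> ->; rewrite scaler0 addr0.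
have Q i : exists q : F i -> F i, [/\ {morph q : x y / x + y},
    forall a x, q (a *: x) = a *: q x, forall x, N i (q x) & forall x, N i x -> q x = x].
  have [x _ ->//|q [qD qZ qN qid _]] := exists_projection (subN i) (sub0 i).
  by exists q.
pose q i := sval (cid (Q i)).
have qP i : [/\ {morph q i : x y / x + y}, forall a x, q i (a *: x) = a *: q i x,
    forall x, N i (q i x) & forall x, N i x -> q i x = x] by rewrite /q; case: cid.
pose tf i x : F i := to_fixed (io_action i) x.
have tfE i x : val (tf i x) = es i x by rewrite /= io1.
pose Qf i x : R := val (q i (tf i x)).
have QfD i : additive_fun (Qf i).
  by move=> x y; rewrite /Qf /tf to_fixedD; case: (qP i) => -> _ _ _.
have Qf_es i x : io i 1 (Qf i x) = Qf i x by exact: fixed_pointP.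
have Qf_io i a x : Qf i (io i a x) = io i a (Qf i x).
  have -> : Qf i (io i a x) = val (q i (a *: tf i x)).
    by congr (val (q i _)); apply: val_inj; rewrite /= -!ioM mul1r mulr1.
  by case: (qP i) => _ -> _ _.
have Qf_orth i j a x : i != j -> Qf i (io j a x) = 0.
  move=> ij; have -> : Qf i (io j a x) = val (q i (0 *: tf i x)).
    by congr (val (q i _)); apply: val_inj; rewrite scale0r /= io_orth.
  by case: (qP i) => _ -> _ _; rewrite scale0r.
have QfN i x : exists2 y, square y & Qf i x = es i y.
  by case: (qP i) => _ _ qN _; apply: qN.
have Qf_sq i x : square x -> Qf i x = es i x.
  move=> sx; rewrite /Qf -[RHS]tfE; congr val; case: (qP i) => _ _ _; apply.
  by exists x.
have Qf_pr i x : Qf i (pr x) = Qf i x.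
  by congr (val (q i _)); apply: val_inj; rewrite /= !io1 (sc_pr (es_scalar i).1).
exists (fun x => \sum_i Qf i x); split.
- by move=> x y; rewrite -big_split; apply: eq_bigr => i _; apply: QfD.
- move=> j a x; rewrite (additive_sum _ _ (scD (io_presc j a))).
  rewrite (bigD1 j) //= [RHS](bigD1 j) //= Qf_io; congr (_ + _).
  rewrite !big1 // => i ij; first by rewrite -Qf_es io_orth // eq_sym.
  exact: Qf_orth.
- move=> x; have /choice[y yP] : forall i, exists y, square y /\ Qf i x = es i y.
    by move=> i; have [y] := QfN i x; exists y.
  exists (\sum_i extend_scalar (es i) (y i)).
    by apply: square_sum => i; apply: extend_square.
  rewrite (additive_sum _ _ prD); apply: eq_bigr => i _; have [sy ->] := yP i.
  by rewrite (pr_extend prD).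
- by move=> x sx; rewrite -es_sum; apply: eq_bigr => i _; apply: Qf_sq.
- by move=> x; apply: eq_bigr => i _; apply: Qf_pr.
Qed.

(** Every [x] is the sum of [w x], of [p2 x] in [R ** R] and of an annihilating rest. A scalar acts
    by [io] on the first part, by its extension on the second and as 0 on the rest. So an
    annihilating element of a component has [w x = 0] and lies in [R ** R]. *)
Lemma lift_action : exists sc : forall i : 'I_n, k i -> R -> R,
  [/\ forall i, central_action (sc i),
    forall i j a b x, i != j -> sc i a (sc j b x) = 0,
    forall x, ann (x - \sum_i sc i 1 x),
    forall i x, ann x -> sc i 1 x = x -> square x
  & forall i x, pr (sc i 1 x) = es i x].
Proof.
have [q [qD q_io q_im q_sq q_pr]] := exists_square_complement.
have es_sum x : \sum_i es i x = pr x by case: es_prim.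
have io_pr i a x : io i a (pr x) = io i a x by apply: sc_pr (io_presc i a) x.
have q_idem x : q (q x) = q x.
  by have [y sy ->] := q_im x; rewrite q_pr (q_sq _ sy).
have pr_q x : pr (q x) = q x.
  by have [y sy ->] := q_im x; rewrite (pr_idem prD pr_ann prP).
pose w x := pr x - q x.
have wD : additive_fun w by move=> x y; rewrite /w prD qD opprD addrACA.
have w_sq x : square x -> w x = 0 by move=> sx; rewrite /w q_sq // subrr.
have w_io i a x : w (io i a x) = io i a (w x).
  by rewrite /w (sc_im (io_presc i a)) q_io (additiveB _ _ (scD (io_presc i a))) io_pr.
have w_idem x : w (w x) = w x.
  rewrite {1}/w /w prD (additiveN _ prD) (pr_idem prD pr_ann prP) pr_q.
  by rewrite (additiveB _ _ qD) q_pr q_idem subrr subr0.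
have w_ann x : ann x -> w x = 0.
  by move=> ax; rewrite /w -q_pr pr_ann // (additive0 qD) subrr.
pose p2 x := theta (x - w x).
have p2D : additive_fun p2.
  by move=> x y; rewrite /p2 wD -thetaD; congr theta; rewrite opprD addrACA.
have p2_square x : square (p2 x) by apply: theta_square.
have p2_id x : square x -> p2 x = x by move=> sx; rewrite /p2 w_sq // subr0 theta_id.
have p2_w x : p2 (w x) = 0 by rewrite /p2 w_idem subrr (additive0 thetaD).
have p0_ann x : ann (x - w x - p2 x).
  have [y sy qy] := q_im x.
  have xE : x - w x = ((x - pr x) - (y - pr y)) + y.
    by rewrite /w qy !opprB -addrA subrK [pr y - _]addrC addrA.
  have : ann (x - pr x - (y - pr y)) by apply: annB.
  rewrite /p2 xE thetaD (theta_id sy); move: (_ - (y - pr y)) => z az.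
  by rewrite opprD addrACA subrr addr0; apply: annB => //; apply: theta_ann.
(* Scalars vanish on [ann], hence on the rest. *)
have io_split i a x : io i a x = io i a (w x) + io i a (p2 x).
  have xE : x = (x - w x - p2 x) + (w x + p2 x) by rewrite [w x + _]addrC addrA !subrK.
  have ioD' := scD (io_presc i a).
  by rewrite {1}xE ioD' (sc_ann pr_ann (io_presc i a) (p0_ann x)) add0r ioD'.
have io_zero i a : io i a 0 = 0 by apply: additive0 (scD (io_presc i a)).
pose ext i a := extend_scalar (io i a).
have ext_square i a x : square (ext i a x) by apply: extend_square.
pose sc i a x := io i a (w x) + ext i a (p2 x).
have w_sc i a x : w (sc i a x) = io i a (w x).
  by rewrite wD w_io w_idem (w_sq _ (ext_square i a _)) addr0.
have p2_sc i a x : p2 (sc i a x) = ext i a (p2 x).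
  by rewrite p2D -{1}(w_idem x) -w_io p2_w add0r p2_id.
have sc_comp i j a b x : sc i a (sc j b x) =
    io i a (io j b (w x)) + extend_scalar (io i a \o io j b) (p2 x).
  by rewrite {1}/sc w_sc p2_sc (extend_comp prD pr_ann).
have ext_mull i a x y : square x -> ext i a x ** y = io i a x ** y.
  by move=> sx; rewrite -(pr_mull prP) (pr_extend prD).
have ext_mulr i a x y : square x -> y ** ext i a x = y ** io i a x.
  by move=> sx; rewrite -(pr_mulr prP) (pr_extend prD).
have sc_mul i a x y : sc i a (x ** y) = io i a x ** y.
  rewrite /sc (w_sq _ (square_mul x y)) io_zero add0r p2_id; last exact: square_mul.
  exact: extend_mul (io_scalar i a).
have w_pr x : pr (w x) = w x.
  by rewrite /w (additiveB _ _ prD) (pr_idem prD pr_ann prP) pr_q.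
exists sc; split.
- move=> i; split; first split.
  + move=> a x y; rewrite /sc wD p2D (scD (io_presc i a)) addrACA; congr (_ + _).
    by apply: (extendD (io_scalar i a)).
  + move=> x a b; rewrite /sc ioD addrACA; congr (_ + _).
    rewrite -(extend_addl prD pr_ann prP (io_scalar i a) (io_scalar i b)) //.
    by apply: extend_eq => z; rewrite ioD.
  + move=> a b x; rewrite sc_comp /sc ioM; congr (_ + _).
    by apply: extend_eq => z; rewrite /= ioM.
  + move=> a x y; rewrite sc_mul namulDl ext_mull // -namulDl.
    by rewrite -io_split.
  + move=> a x y; rewrite sc_mul namulDr ext_mulr // -namulDr.
    by rewrite -io_split (sc_adj (io_presc i a)).
- move=> i j a b x ij; rewrite sc_comp io_orth // add0r.
  rewrite (extend_eq (be := fun=> 0)) ?(extend_zero prD pr_ann prP) // => z.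
  exact: io_orth.
- move=> x; rewrite (_ : \sum_i sc i 1 x = w x + p2 x); last first.
    rewrite /sc big_split /= -{2}(extend_pr prD pr_ann prP (p2_square x)).
    congr (_ + _); first by under eq_bigr do rewrite io1; rewrite es_sum w_pr.
    rewrite -(extend_sum prD pr_ann prP _ (F := fun i => io i 1)) //.
    by apply: extend_eq => z; under eq_bigr do rewrite io1.
  by rewrite opprD addrA; apply: p0_ann.
- by move=> i x ax <-; rewrite /sc w_ann // io_zero add0r.
- move=> i x; rewrite /sc prD (sc_im (io_presc i 1)) (pr_extend prD) //.
  by rewrite -io_split io1.
Qed.

End Lift.

(** * The decomposition *)

Lemma omega_stable_tame (R : naRingType) : omega_stable R ->
  let D := @definable (ring_structure R) in
  [/\ tame D, D (fun e => e 0%N + e 1%N = e 2%N) & D (fun e => e 0%N ** e 1%N = e 2%N)].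
Proof.
move=> R_stable D; split.
- split.
  + exact: definable_not.
  + exact: definable_and.
  + exact: definable_ren.
  + exact: definable_ex.
  + exact: definable_eq.
  + exact: definable_cst.
  + move=> n X DX Xdep; apply: no_splitting_tree DX Xdep => A Acount.
    by apply: R_stable.
- exact: (definable_add (ring_structure R)).
- exact: (definable_mul (ring_structure R)).
Qed.

Theorem theorem1p1 (R : naRingType) (R_stable : omega_stable R)
    (R_char0 : char_zero R) :
  exists (n : nat) (k : 'I_n -> closedFieldType)
         (Ri : forall i : 'I_n, naAlgType (k i)) (R0 : naAlgType rat),
    [/\ forall i : 'I_n, [pchar (k i)] =i pred0,
        forall i : 'I_n, indecomposable (Ri i),
        forall x y : R0, x ** y = 0
      & ring_isomorphic R ({dffun forall i : 'I_n, Ri i} * R0)%type].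
Proof.
have [tD D_add D_mul] := omega_stable_tame R_stable.
have R_tf (m : nat) (x : R) : (0 < m)%N -> x *+ m = 0 -> x = 0 by exact: R_char0.
have R_div := tame_divisible tD D_add R_char0.
have [pr [prD pr_ann prP]] := exists_pr R_div R_tf.
have [theta [thetaD theta_sq theta_id theta_ann]] := exists_square_projection R_div R_tf.
have [m [s s_ann]] := finite_annihilating_system tD D_add D_mul.
have pr_idem' := pr_idem prD pr_ann prP.
have [n [es es_prim]] := idempotent_decomposition tD D_add D_mul prD pr_ann s_ann
  (scalar_pr prD pr_ann prP) pr_idem'.
have [prim orth es_sum] := es_prim.
have fieldP i := primitive_closed_field tD D_add D_mul prD pr_ann prP s_ann
  (fun x m => R_tf m x) (prim i).
pose k i := sval (cid (fieldP i)); have kP i := svalP (cid (fieldP i)).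
pose io i : k i -> R -> R := sval (cid (kP i)).
have ioP i : [/\ [pchar k i] =i pred0,
    forall a, scalar pr (@io i a) /\ forall x, @io i a (es i x) = @io i a x,
    forall a b x, @io i (a + b) x = @io i a x + @io i b x,
    forall a b x, @io i (a * b) x = @io i a (@io i b x) &
    forall x, @io i 1 x = es i x] := svalP (cid (kP i)).
have [sc [sc_central sc_orth sc_ann sc_square pr_sc]] := lift_action prD pr_ann prP
  thetaD theta_sq theta_id theta_ann es_prim (k := fun i => k i : fieldType) (io := io)
  (fun i a => let: And5 _ H _ _ _ := ioP i in (H a).1)
  (fun i a => let: And5 _ H _ _ _ := ioP i in (H a).2)
  (fun i => let: And5 _ _ H _ _ := ioP i in H)
  (fun i => let: And5 _ _ _ H _ := ioP i in H)
  (fun i => let: And5 _ _ _ _ H := ioP i in H).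
(* The projection onto the part on which all the fields act as 0; it is annihilating and becomes the
   null algebra, with the rational scaling. *)
pose p0 x := x - \sum_i sc i 1 x.
have p0D : additive_fun p0.
  move=> x y; rewrite /p0 [RHS]addrACA -opprD -big_split /=; congr (_ - _).
  apply: eq_bigr => i _; exact: (actDr (central_act (sc_central i)) 1).
pose sc0 q x := rat_scale R_div q (p0 x).
have rho_D i : additive_fun (@sc i 1) by exact: actDr (central_act (sc_central i)) 1.
have p0_idem x : p0 (p0 x) = p0 x.
  rewrite {1}/p0 big1 ?subr0 // => i _.
  rewrite (additiveB _ _ (rho_D i)) (additive_sum _ _ (rho_D i)) (bigD1 i) //=.
  rewrite (actA (central_act (sc_central i))) mulr1 big1 ?addr0 ?subrr // => j ji.
  by rewrite sc_orth // eq_sym.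
have sc0_ann q x : ann (sc0 q x).
  by apply: ann_rat_scale => //; apply: sc_ann.
have sc0_mul q x y : sc0 q (x ** y) = 0.
  rewrite /sc0 (_ : p0 (x ** y) = 0) ?rat_scale0 //.
  have [<- _] := sc_ann x y; rewrite -/(p0 x) namulBl; congr (_ - _).
  rewrite (additive_sum (f := fun z => z ** y)) => [|u v]; last exact: namulDl.
  by apply: eq_bigr => i _; rewrite (central_mull (sc_central i)).
have sc0_central : central_action sc0.
  split; first split.
  - by move=> q x y; rewrite /sc0 p0D rat_scaleDr.
  - by move=> x q q'; rewrite /sc0 rat_scaleDl.
  - by move=> q q' x; rewrite /sc0 additive_rat_scale // p0_idem rat_scaleA.
  - by move=> q x y; rewrite sc0_mul; case: (sc0_ann q x y).
  - by move=> q x y; rewrite sc0_mul; case: (sc0_ann q y x).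
exists n, k, (fun i => component (sc_central i)), (component sc0_central); split.
- by move=> i; case: (ioP i).
- move=> i; apply: component_indecomposable => rho rhoD rho_mull rho_mulr rho_idem rho_l rho_r.
  (* Such a [sigma] has values in [ann], hence in [R ** R] by [sc_square]; applied to its own value,
     written as a sum of products, it multiplies annihilating elements and gives 0. *)
  have sigma0 (sigma : R -> R) : {morph sigma : x y / x + y} ->
      (forall x y, sigma (x ** y) = sigma x ** y) ->
      (forall x, sigma (sigma x) = sigma x) -> (forall x, sc i 1 (sigma x) = sigma x) ->
      (forall x, pr (sigma x) = 0) -> forall x, sigma x = 0.
    move=> sD s_mull s_idem s_l pr_s x.
    have s_ann' z : ann (sigma z) by rewrite -[sigma z]subr0 -(pr_s z).
    have [r rE] := sc_square i (sigma x) (s_ann' x) (s_l x).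
    rewrite -s_idem rE -sqsum_map // /sqsum big_map big1 // => p _.
    by case: (s_ann' p.1 p.2).
  have rho_ann z : ann z -> ann (rho z).
    by move=> az y; rewrite -rho_mull -rho_mulr; have [-> ->] := az y; rewrite (additive0 rhoD).
  have pr_rho x : pr (rho (pr x)) = pr (rho x).
    apply/esym/(pr_eq prD pr_ann); rewrite -(additiveB _ _ rhoD).
    exact: rho_ann.
  have [_ _ _ prim_i] := prim i.
  (* Modulo [ann], [rho] is an idempotent scalar below [es i], so that primitivity applies to it. *)
  have f_scalar : scalar pr (fun x => pr (rho x)).
    split; first split.
    + by move=> x y /=; rewrite rhoD prD.
    + exact: pr_rho.
    + by move=> x; rewrite pr_idem'.
    + by move=> x y; rewrite (pr_mull prP) (pr_mulr prP) -rho_mull rho_mulr.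
    + by move=> x y; rewrite rho_mull; apply/esym; rewrite (pr_mull prP).
    + move=> N r _ r0; under eq_bigr do rewrite (pr_mull prP) -rho_mull.
      by rewrite -(additive_sum _ _ rhoD) r0 (additive0 rhoD).
  have [x|x|f0|f1] := prim_i _ f_scalar.
  + by rewrite pr_rho rho_idem.
  + by rewrite -pr_sc pr_rho rho_r.
  + by left; apply: sigma0.
  (* Primitivity gives the equality only modulo [ann]; [sigma0] disposes of the difference
     [sc i 1 z - rho z], again a central idempotent map. *)
  + right=> x; apply/esym/eqP; rewrite -subr_eq0; apply/eqP.
    have act := central_act (sc_central i).
    apply: (sigma0 (fun z => sc i 1 z - rho z)) => {x} [x y|x y|x|x|x].
    * by rewrite rho_D rhoD opprD addrACA.
    * by rewrite (central_mull (sc_central i)) rho_mull namulBl.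
    * rewrite (additiveB _ _ (rho_D i)) (additiveB _ _ rhoD) (actA act) mulr1.
      by rewrite rho_l rho_r rho_idem subrr subr0.
    * by rewrite (additiveB _ _ (rho_D i)) (actA act) mulr1 rho_l.
    * by rewrite (additiveB _ _ prD) pr_sc f1 subrr.
- exact: component0_mul.
- apply: component_decomposition sc0_ann => [i j a b x ij|x]; first exact: sc_orth.
  by rewrite /sc0 rat_scale1 // /p0 addrC subrK.
Qed.
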